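(* Let $p>1$ and $-n<q<0$. (i) Let $f\in C_e^\infty(S^{n-1})$ be a positive function such that $f^{p-1}\cdot r^q$ is a positive definite distribution. If $g\in C_e^\infty(S^{n-1})$ is a positive function with $T_qf(\xi)\le T_qg(\xi)$ for every $\xi\in S^{n-1}$, then $\|f\|_{L_p(S^{n-1})}\le\|g\|_{L_p(S^{n-1})}$. (ii) Let $g\in C_e^\infty(S^{n-1})$ be strictly positive such that $g^{p-1}\cdot r^q$ is not a positive definite distribution. Then there exists a strictly positive $f\in C_e^\infty(S^{n-1})$ with $T_qf(\xi)\le T_qg(\xi)$ for every $\xi\in S^{n-1}$, but $\|f\|_{L_p(S^{n-1})}>\|g\|_{L_p(S^{n-1})}$.
   Context: $C_e^\infty(S^{n-1})$ is the space of even real-valued infinitely differentiable functions on $S^{n-1}$; positive means $\ge0$ everywhere, strictly positive means $>0$ everywhere. For $h$ on $S^{n-1}$ and real $s$, $h\cdot r^s(x)=|x|_2^s h(x/|x|_2)$ on $\mathbb{R}^n\setminus\{0\}$, viewed as a Schwartz distribution. Fourier transform: $\hat\phi(x)=\int_{\mathbb{R}^n}\phi(\xi)e^{-i(x,\xi)}d\xi$, extended to distributions by $\langle\hat h,\phi\rangle=\langle h,\hat\phi\rangle$. An even distribution is positive definite if its Fourier transform is nonnegative on every nonnegative even Schwartz test function. For $-n<q<0$ and $f\in C_e^\infty(S^{n-1})$, the Fourier transform of $f\cdot r^{-n-q}$ is of the form $g\cdot r^q$ with $g\in C_e^\infty(S^{n-1})$ (a known fact), and $T_qf:=g$, i.e.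 $T_qf(\xi)=(f\cdot r^{-n-q})^\wedge(\xi)$ for $\xi\in S^{n-1}$. $L_p$ norms are with respect to surface measure on $S^{n-1}$. *)

(* Defs.v *)
From HB Require Import structures.
From mathcomp Require Import all_boot all_order all_algebra.
From mathcomp Require Import all_classical all_reals all_analysis.

Set Implicit Arguments.
Unset Strict Implicit.
Unset Printing Implicit Defensive.

Import Order.TTheory GRing.Theory Num.Theory.
Import numFieldNormedType.Exports.

Local Open Scope classical_set_scope.
Local Open Scope ring_scope.

Section Defs.
Variables (R : realType) (n : nat).

Definition enorm (x : 'rV[R]_n) : R := Num.sqrt (\sum_(i < n) x ord0 i ^+ 2).
Definition dotp (x y : 'rV[R]_n) : R := \sum_(i < n) x ord0 i * y ord0 i.

Definition sphere : set 'rV[R]_n := [set x | enorm x = 1].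
Definition normalize (x : 'rV[R]_n) : 'rV[R]_n := (enorm x)^-1 *: x.

Definition pderiv (i : 'I_n) (f : 'rV[R]_n -> R) : 'rV[R]_n -> R :=
  fun x => 'D_(delta_mx 0 i) f x.
Definition iderive (s : seq 'I_n) (f : 'rV[R]_n -> R) : 'rV[R]_n -> R :=
  foldr pderiv f s.

Definition smooth_on (U : set 'rV[R]_n) (f : 'rV[R]_n -> R) : Prop :=
  forall (s : seq 'I_n) (x : 'rV[R]_n), U x -> differentiable (iderive s f) x.

(* C_e^infty(S^{n-1}): a function on the sphere (only its values on the sphere
   matter) is smooth iff its 0-homogeneous extension x |-> f(x/|x|) is smooth
   on R^n \ {0}; it is even if f(-x) = f(x) on the sphere. *)
Definition Ce_inf (f : 'rV[R]_n -> R) : Prop :=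
  smooth_on [set x | x != 0] (fun x => f (normalize x)) /\
  (forall x, sphere x -> f (- x) = f x).

Definition positive_on_sphere (f : 'rV[R]_n -> R) : Prop :=
  forall x, sphere x -> 0 <= f x.
Definition strictly_positive_on_sphere (f : 'rV[R]_n -> R) : Prop :=
  forall x, sphere x -> 0 < f x.

Definition schwartz (phi : 'rV[R]_n -> R) : Prop :=
  smooth_on setT phi /\
  forall (s : seq 'I_n) (k : nat), exists C : R, forall x,
    (1 + enorm x) ^+ k * `|iderive s phi x| <= C.

Definition even_fun (phi : 'rV[R]_n -> R) : Prop := forall x, phi (- x) = phi x.

End Defs.

(* Lebesgue integral over R^n, written as the iterated integral
   dx_1 dx_2 ... dx_n of one-dimensional Lebesgue integrals
   (equal to the n-dimensional Lebesgue integral for integrable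
   functions, by Fubini). *)
Fixpoint intRn (R : realType) (n : nat) : ('rV[R]_n -> R) -> R :=
  match n with
  | 0 => fun f => f 0
  | m.+1 => fun f =>
      Rintegral (@lebesgue_measure R) setT
        (fun t : R => @intRn R m (fun y => f (row_mx (\row_(j < 1) t) y)))
  end.

Section Defs2.
Variables (R : realType) (n : nat).

(* Fourier transform  phi^(x) = int phi(xi) e^{-i(x,xi)} dxi  of a real test
   function, split into real and imaginary parts. *)
Definition fourier_re (phi : 'rV[R]_n -> R) (x : 'rV[R]_n) : R :=
  intRn (fun xi => phi xi * cos (dotp x xi)).
Definition fourier_im (phi : 'rV[R]_n -> R) (x : 'rV[R]_n) : R :=
  - intRn (fun xi => phi xi * sin (dotp x xi)).

(* The distribution h . r^s paired with a (real) test function psi: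
   <h . r^s, psi> = int_{R^n} |x|_2^s h(x/|x|_2) psi(x) dx. *)
Definition hom_pair (s : R) (h : 'rV[R]_n -> R) (psi : 'rV[R]_n -> R) : R :=
  intRn (fun x => powR (enorm x) s * h (normalize x) * psi x).

(* h . r^s is positive definite: for every nonnegative even Schwartz phi,
   <(h . r^s)^, phi> = <h . r^s, phi^> is a nonnegative (real) number. *)
Definition pos_def (s : R) (h : 'rV[R]_n -> R) : Prop :=
  forall phi : 'rV[R]_n -> R, schwartz phi -> even_fun phi ->
    (forall x, 0 <= phi x) ->
    0 <= hom_pair s h (fourier_re phi) /\ hom_pair s h (fourier_im phi) = 0.

(* g = T_q f : g in C_e^infty and (f . r^{-n-q})^ = g . r^q as distributions,
   tested against all real Schwartz functions (complex ones are combinations). *)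
Definition is_Tq (q : R) (f g : 'rV[R]_n -> R) : Prop :=
  Ce_inf g /\
  forall phi : 'rV[R]_n -> R, schwartz phi ->
    hom_pair (- n%:R - q) f (fourier_re phi) = hom_pair q g phi /\
    hom_pair (- n%:R - q) f (fourier_im phi) = 0.

(* T_q f (the function g above; its existence is the known fact quoted). *)
Definition Tq (q : R) (f : 'rV[R]_n -> R) : 'rV[R]_n -> R :=
  get [set g | is_Tq q f g].

(* integral over S^{n-1} w.r.t. surface measure, via polar coordinates:
   int_{S^{n-1}} h dsigma = n * int_{|x|<1} h(x/|x|) dx *)
Definition sphere_int (h : 'rV[R]_n -> R) : R :=
  n%:R * intRn (fun x => if enorm x < 1 then h (normalize x) else 0).

Definition Lpnorm (p : R) (h : 'rV[R]_n -> R) : R :=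
  powR (sphere_int (fun x => powR `|h x| p)) p^-1.

End Defs2.

(* Main.v *)
(* Put s = n + q, so that 0 < s < n. For an even Schwartz function P, the Mellin
   integral  mel s P x = int_R P(e^u x) e^(s u) du  is smooth and homogeneous of
   degree -s off the origin. Dilations are reversed by the Fourier transform, so
   Parseval and the inversion formula P^^ = c P give
     T_q (mel s P^) = mel (n - s) (c P)   on the sphere.
   Every f in C_e^infty is some mel s P on the sphere (take for P the function
   f(x/|x|) times a radial bump), so T_q is well defined and injective. By polar
   coordinates <F r^q, P^> is a positive multiple of int_S F mel s P^: positive
   definiteness of F r^q says that int_S F k >= 0 whenever T_q k >= 0.
   For (i), take F = f^(p-1) and k = g - f; then Young's inequality
   p f^(p-1) (g - f) <= g^p - f^p concludes. For (ii), choose P >= 0 with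
   <g^(p-1) r^q, P^> < 0, put k = mel s P^ and f = g - e k with e > 0 small; then
   T_q f <= T_q g, and Young's inequality with f and g exchanged shows that the
   norm increases. *)
Require Import Defs.
From HB Require Import structures.
From mathcomp Require Import all_boot all_order all_algebra.
From mathcomp Require Import all_classical all_reals all_analysis.
From mathcomp Require Import measurable_realfun ring lra.
Import Order.TTheory GRing.Theory Num.Theory.
Import numFieldNormedType.Exports.
Set Implicit Arguments.
Unset Strict Implicit.
Unset Printing Implicit Defensive.
Local Open Scope classical_set_scope.
Local Open Scope ring_scope.

(** * Smooth functions *)

(** [intRn] iterates total one-dimensional integrals, so it is meaningful only on integrable
    functions. The measures [lebRn n] are therefore built by the same recursion on coordinates, and
    integrability is established before a pairing is evaluated against them; Fubini and dilations
    are then available. Fourier analysis stays real: cosine transforms with a phase form a family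
    stable under derivatives and under multiplication by coordinates, a quarter turn of the phase
    replacing the factor i. The inversion constant is never computed; c > 0 suffices, and a single
    bump function yields it. No surface measure occurs. Sphere integrals are integrals over the unit
    ball, and polar coordinates come from Fubini on R^n times the group of dilations e^u, whose
    orbit integrals are the Mellin integrals. The singularity at the origin is harmless: 0 to a
    nonzero power is 0 by convention, and the default value [normalize 0 = 0] concerns one null
    point. [Tq] is picked by [get] and is determined on the sphere only, so all comparisons are made
    there. *)

Section LittleO.
Variables (R : realType) (V W : normedModType R).
Implicit Types (f g : V -> W).

Lemma near0_norm_lt (d : R) : 0 < d -> \forall h \near nbhs (0 : V), `|h| < d.
Proof.
move=> d0; apply/nbhs_ballP; exists d => //= y.
by rewrite -ball_normE /= sub0r normrN.
Qed.

Lemma diff_littleo f (x : V) (L : {linear V -> W}) : continuous L ->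
  (forall e, 0 < e ->
     \forall h \near nbhs (0 : V), `|f (h + x) - f x - L h| <= e * `|h|) ->
  differentiable f x /\ 'd f x = L :> (V -> W).
Proof.
move=> Lc H.
have E : f \o shift x = cst (f x) + L +o_ 0 id.
  apply/eqaddoP => e e0; near=> h.
  rewrite !fctE /= opprD addrA.
  by near: h; exact: H.
have dE := diff_unique Lc E.
split=> //; apply/diff_locallyP; rewrite dE; split=> //.
Unshelve. all: by end_near. Qed.

Lemma near_eq_differentiable f g (x : V) :
  {near x, f =1 g} -> differentiable f x -> differentiable g x.
Proof.
move=> fg df; have [Lc Lo] := (diff_locallyP x f).1 df.
move: Lo => /eqaddoP Lo.
have [//|] := @diff_littleo g x ('d f x) Lc.
move=> e e0; have fgx := nbhs_singleton fg.
near=> h.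
have <- : f x = g x by [].
have <- : f (h + x) = g (h + x).
  near: h; rewrite near_simpl.
  have c : (h + x @[h --> (0 : V)]) --> x.
    by rewrite -[X in _ --> X]add0r; apply: cvgD; [exact: cvg_id | exact: cvg_cst].
  exact: (c _ fg).
have : `|(f \o shift x - (cst (f x) + 'd f x)) h| <= e * `|h|.
  by near: h; exact: Lo.
by rewrite !fctE /= opprD addrA.
Unshelve. all: by end_near. Qed.
End LittleO.

Section Smooth.
Variables (R : realType) (n : nat).
Local Notation V := 'rV[R]_n.
Implicit Types (U : set V) (f g : V -> R).

Lemma coord_le_norm (x : V) i : `|x ord0 i| <= `|x|.
Proof.
rewrite [leRHS]/Num.Def.normr /= mx_normrE.
exact: (le_bigmax _ (fun ij => `|x ij.1 ij.2|) (ord0, i)).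
Qed.

Lemma linear_formE (L : {linear V -> R}) (x : V) :
  L x = \sum_(i < n) x ord0 i * L (delta_mx 0 i).
Proof.
by rewrite {1}(row_sum_delta x) linear_sum; apply: eq_bigr => i _; rewrite linearZ.
Qed.

Lemma linear_form_continuous (L : {linear V -> R}) : continuous L.
Proof.
apply: bounded_linear_continuous; apply/ex_bound => /=.
exists (\sum_(i < n) `|L (delta_mx 0 i)|).
near=> x.
rewrite /=.
rewrite linear_formE.
apply: le_trans (ler_norm_sum _ _ _) _; apply: ler_sum => i _.
rewrite normrM ler_piMl //.
apply: le_trans (coord_le_norm _ _) _.
by apply: ltW; near: x; exact: near0_norm_lt.
Unshelve. all: by end_near. Qed.

Lemma pderivE f x i : differentiable f x -> pderiv i f x = 'd f x (delta_mx 0 i).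
Proof. exact: deriveE. Qed.

(** A quadratic remainder is little-o of the increment, and uniqueness of the differential
    identifies the gradient. Parameter integrals are differentiated this way: a Taylor bound is
    integrated, and no limit is taken under the integral sign. *)
Lemma diff_expand f (x : V) (c : 'I_n -> R) (M d : R) : 0 < d ->
  (forall h : V, `|h| < d ->
    `|f (x + h) - f x - \sum_(i < n) h ord0 i * c i| <= M * `|h| ^+ 2) ->
  differentiable f x /\ forall i, pderiv i f x = c i.
Proof.
move=> d0 Hf.
pose L (h : V) : R := \sum_(i < n) h ord0 i * c i.
have Ladd : linear L.
  move=> a u v; rewrite /L scaler_sumr -big_split /=; apply: eq_bigr => i _.
  by rewrite !mxE mulrDl -mulrA.
pose LL := GRing.isLinear.Build R V R _ L Ladd.
pose L' : {linear V -> R} := HB.pack L LL.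
have [df dL] : differentiable f x /\ 'd f x = L' :> (V -> R).
  apply: diff_littleo; first exact: linear_form_continuous.
  move=> e e0.
  have M1 : 0 < `|M| + 1 by rewrite ltr_wpDl.
  near=> h.
  rewrite (addrC h); apply: le_trans (Hf h _) _.
    by near: h; exact: near0_norm_lt.
  rewrite expr2 mulrA ler_wpM2r //.
  apply: (@le_trans _ _ ((`|M| + 1) * `|h|)).
    by rewrite ler_wpM2r // (le_trans (ler_norm _)) // lerDl.
  rewrite mulrC -ler_pdivlMr //.
  by apply: ltW; near: h; apply: near0_norm_lt; rewrite divr_gt0.
split=> // i; rewrite pderivE // dL /= /L (bigD1 i) //= mxE !eqxx mul1r.
by rewrite big1 ?addr0 // => j ji; rewrite mxE eqxx (negbTE ji) mul0r.
Unshelve. all: by end_near. Qed.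

(* Smoothness is coinductive: a class of functions differentiable on [U] and stable
   under partial derivatives, up to equality on [U], consists of smooth functions. *)
Definition smooth_class U (P : (V -> R) -> Prop) := forall f, P f ->
  (forall x, U x -> differentiable f x) /\
  (forall i, exists2 g, P g & forall x, U x -> pderiv i f x = g x).

Lemma pderiv_ext U f g i : open U -> (forall x, U x -> f x = g x) ->
  forall x, U x -> pderiv i f x = pderiv i g x.
Proof.
move=> oU fg x Ux; apply: near_eq_derive.
by apply: filterS (open_nbhs_nbhs (conj oU Ux)).
Qed.

Lemma differentiable_ext U f g : open U -> (forall x, U x -> f x = g x) ->
  forall x, U x -> differentiable f x -> differentiable g x.
Proof.
move=> oU fg x Ux; apply: near_eq_differentiable.
by apply: filterS (open_nbhs_nbhs (conj oU Ux)).
Qed.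

Lemma iderive_ext U f g s : open U -> (forall x, U x -> f x = g x) ->
  forall x, U x -> iderive s f x = iderive s g x.
Proof.
by move=> oU fg; elim: s => //= i s IH; exact: pderiv_ext IH.
Qed.

Lemma smooth_class_iderive U P f s : open U -> smooth_class U P -> P f ->
  exists2 g, P g & forall x, U x -> iderive s f x = g x.
Proof.
move=> oU cP Pf; elim: s => [|i s [g Pg sg]]; first by exists f.
have [_ /(_ i)[g' Pg' gg']] := cP _ Pg; exists g' => // x Ux.
by rewrite /= (pderiv_ext _ oU sg Ux) gg'.
Qed.

Lemma smooth_classP U P f : open U -> smooth_class U P -> P f -> smooth_on U f.
Proof.
move=> oU cP Pf s x Ux; have [g Pg sg] := smooth_class_iderive s oU cP Pf.
by apply: (differentiable_ext oU (fun y Uy => esym (sg y Uy)) Ux); apply: (cP _ Pg).1.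
Qed.

Lemma smooth_diff U f : smooth_on U f -> forall x, U x -> differentiable f x.
Proof. by move=> sf x Ux; exact: (sf [::]). Qed.

Lemma iderive_pderiv f s i : iderive s (pderiv i f) = iderive (rcons s i) f.
Proof. by elim: s => //= j s ->. Qed.

Lemma smooth_pderiv U f i : smooth_on U f -> smooth_on U (pderiv i f).
Proof. by move=> sf s; rewrite iderive_pderiv; exact: sf. Qed.

Lemma smooth_iderive U f s : smooth_on U f -> smooth_on U (iderive s f).
Proof. by move=> sf; elim: s => //= i s; exact: smooth_pderiv. Qed.

Lemma smooth_ext U f g : open U -> (forall x, U x -> f x = g x) ->
  smooth_on U f -> smooth_on U g.
Proof.
move=> oU fg sf s x Ux.
exact: (differentiable_ext oU (iderive_ext s oU fg) Ux (sf s x Ux)).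
Qed.

Lemma smooth_sub U U' f : U' `<=` U -> smooth_on U f -> smooth_on U' f.
Proof. by move=> UU sf s x /UU; exact: sf. Qed.

Lemma smooth_cont U f : smooth_on U f -> forall x, U x -> {for x, continuous f}.
Proof. by move=> sf x Ux; apply: differentiable_continuous; exact: smooth_diff Ux. Qed.

Lemma pderivD f g i x : differentiable f x -> differentiable g x ->
  pderiv i (f \+ g) x = pderiv i f x + pderiv i g x.
Proof. by move=> df dg; apply: deriveD; exact: diff_derivable. Qed.

Lemma pderivM f g i x : differentiable f x -> differentiable g x ->
  pderiv i (f \* g) x = pderiv i f x * g x + f x * pderiv i g x.
Proof.
move=> df dg; rewrite /pderiv (@deriveM _ _ f g); [|exact: diff_derivable..].
by rewrite addrC mulrC.
Qed.

Lemma smoothD U f g : open U -> smooth_on U f -> smooth_on U g ->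
  smooth_on U (f \+ g).
Proof.
move=> oU sf sg.
pose P h := exists f g, [/\ smooth_on U f, smooth_on U g & h = f \+ g].
apply: (@smooth_classP _ P) => //; last by exists f, g.
move=> _ [{sf}f [{sg}g [sf sg ->]]]; split=> [x Ux|i].
  by apply: (@differentiableD _ _ _ f g); exact: smooth_diff Ux.
exists (pderiv i f \+ pderiv i g).
  by exists (pderiv i f), (pderiv i g); split=> //; exact: smooth_pderiv.
by move=> x Ux; apply: pderivD; exact: smooth_diff Ux.
Qed.

(** The product and chain rules turn one product into a sum of products of the same shape; closing
    under sums makes that shape stable under partial derivatives. *)
Inductive sum_closure (P : (V -> R) -> Prop) : (V -> R) -> Prop :=
  | Sum_base f of P f : sum_closure P f
  | Sum_add f g of sum_closure P f & sum_closure P g : sum_closure P (f \+ g).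

Lemma sum_closure_class U (P : (V -> R) -> Prop) :
  (forall f, P f -> (forall x, U x -> differentiable f x) /\
    forall i, exists2 g, sum_closure P g & forall x, U x -> pderiv i f x = g x) ->
  smooth_class U (sum_closure P).
Proof.
move=> H f; elim=> {f} [f /H//|f g _ [df Df] _ [dg Dg]]; split=> [x Ux|i].
  by apply: (@differentiableD _ _ _ f g); [exact: df | exact: dg].
have [f' f1 f2] := Df i; have [g' g1 g2] := Dg i.
exists (f' \+ g'); first exact: Sum_add.
by move=> x Ux; rewrite pderivD ?f2 ?g2 //; [exact: df | exact: dg].
Qed.

Lemma smoothM U f g : open U -> smooth_on U f -> smooth_on U g ->
  smooth_on U (f \* g).
Proof.
move=> oU sf sg.
pose P h := exists f g, [/\ smooth_on U f, smooth_on U g & h = f \* g].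
apply: (@smooth_classP _ (sum_closure P)) => //; last first.
  by apply: Sum_base; exists f, g.
apply: sum_closure_class => _ [{sf}f [{sg}g [sf sg ->]]]; split=> [x Ux|i].
  by apply: (@differentiableM _ _ f g); exact: smooth_diff Ux.
exists ((pderiv i f \* g) \+ (f \* pderiv i g)).
  apply: Sum_add; apply: Sum_base.
    by exists (pderiv i f), g; split=> //; exact: smooth_pderiv.
  by exists f, (pderiv i g); split=> //; exact: smooth_pderiv.
by move=> x Ux; apply: pderivM; exact: smooth_diff Ux.
Qed.

Lemma smooth_cst U (a : R) : open U -> smooth_on U (fun=> a).
Proof.
move=> oU; pose P (h : V -> R) := exists a, h = fun=> a.
apply: (@smooth_classP _ P) => //; last by exists a.
move=> _ [b ->]; split=> [x _|i]; first exact: differentiable_cst.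
by exists (fun=> 0); [exists 0 | move=> x _; exact: derive_cst].
Qed.

Lemma pderiv_coord i j x : pderiv i (fun x : V => x ord0 j) x = (i == j)%:R.
Proof.
have [|_ ->//] := @diff_expand (fun x : V => x ord0 j) x (fun i => (i == j)%:R) 0 1 ltr01.
move=> h _; rewrite (bigD1 j) //= eqxx big1; last first.
  by move=> k /negbTE->; rewrite mulr0.
by rewrite mulr1 addr0 !mxE -addrA -opprD subrr normr0 mul0r.
Qed.

Lemma smooth_coord U j : open U -> smooth_on U (fun x : V => x ord0 j).
Proof.
move=> oU s x Ux.
case: (lastP s) => [|s' i]; first exact: differentiable_coord.
rewrite -iderive_pderiv.
have -> : pderiv i (fun x : V => x ord0 j) = fun=> (i == j)%:R.
  by apply/funext => y; exact: pderiv_coord.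
exact: (@smooth_cst U _ oU s' x Ux).
Qed.

Lemma smooth_sum U (I : Type) (r : seq I) (F : I -> V -> R) : open U ->
  (forall i, smooth_on U (F i)) -> smooth_on U (fun x => \sum_(i <- r) F i x).
Proof.
move=> oU sF; elim: r => [|i r IH].
  by under [X in smooth_on _ X]eq_fun do rewrite big_nil; exact: smooth_cst.
under [X in smooth_on _ X]eq_fun do rewrite big_cons.
exact: smoothD.
Qed.

(** One-variable form of [smooth_class]. The class is existential because the functions of interest
    lie in parametrised families, such as c t^a, whose parameters change under differentiation. *)
Definition smooth1 (I : set R) (phi : R -> R) := exists2 P : (R -> R) -> Prop,
  P phi & forall psi, P psi -> exists2 psi', P psi' &
    forall t, I t -> is_derive t (1:R) psi (psi' t).

Lemma pderiv_comp1 (Q : V -> R) (psi : R -> R) (d : R) i x : differentiable Q x ->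
  is_derive (Q x) (1:R) psi d ->
  differentiable (psi \o Q) x /\ pderiv i (psi \o Q) x = d * pderiv i Q x.
Proof.
move=> dQ [dpsi <-]; have dpsi' : differentiable psi (Q x) by exact/derivable1_diffP.
split; first exact: differentiable_comp.
rewrite /pderiv !deriveE //; last exact: differentiable_comp.
by rewrite diff_comp //= -[X in 'd psi _ X]mulr1 linearZ mulrC.
Qed.

(** The stable shape is f times psi(Q): the chain rule produces a factor [pderiv i Q], which is
    absorbed into f. The start is f = 1. *)
Lemma smooth_comp1 U (I : set R) (Q : V -> R) phi : open U ->
  (forall x, U x -> I (Q x)) -> smooth1 I phi -> smooth_on U Q ->
  smooth_on U (phi \o Q).
Proof.
move=> oU UI [P Pphi cP] sQ.
pose K h := exists f psi, [/\ smooth_on U f, P psi & h = f \* (psi \o Q)].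
apply: (@smooth_ext _ ((fun=> 1) \* (phi \o Q))) => //.
  by move=> x _ /=; rewrite mul1r.
apply: (@smooth_classP _ (sum_closure K)) => //; last first.
  by apply: Sum_base; exists (fun=> 1), phi; split => //; exact: smooth_cst.
apply: sum_closure_class => _ [f [psi [sf Ppsi ->]]].
have [psi' Ppsi' D] := cP _ Ppsi.
have dpsi x : U x -> differentiable (psi \o Q) x.
  move=> Ux; apply: differentiable_comp; first exact: smooth_diff Ux.
  by apply/derivable1_diffP; have [] := D _ (UI _ Ux).
split=> [x Ux|i].
  apply: (@differentiableM _ _ f (psi \o Q)); first exact: smooth_diff Ux.
  exact: dpsi.
exists ((pderiv i f \* (psi \o Q)) \+ ((f \* pderiv i Q) \* (psi' \o Q))).
  apply: Sum_add; apply: Sum_base.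
    by exists (pderiv i f), psi; split=> //; exact: smooth_pderiv.
  exists (f \* pderiv i Q), psi'; split=> //; apply: smoothM => //.
  exact: smooth_pderiv.
move=> x Ux; rewrite pderivM; [|exact: smooth_diff Ux|exact: dpsi].
have [_ ->] := pderiv_comp1 i (smooth_diff sQ Ux) (D _ (UI _ Ux)).
by rewrite /= [psi' _ * _]mulrC mulrA.
Qed.

End Smooth.

(** * Schwartz functions *)

Section Schwartz.
Variables (R : realType) (n : nat).
Local Notation V := 'rV[R]_n.
Implicit Types (f g : V -> R).

Lemma line_derive f (x h : V) (t : R) : differentiable f (x + t *: h) ->
  is_derive t (1:R) (fun t => f (x + t *: h))
    (\sum_(i < n) h ord0 i * pderiv i f (x + t *: h)).
Proof.
move=> df.
pose F t := f (x + t *: h).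
have E : (fun s => s^-1 *: ((F \o shift t) (s *: (1:R)) - F t)) =
    (fun s => s^-1 *: ((f \o shift (x + t *: h)) (s *: h) - f (x + t *: h))).
  apply/funext => s; rewrite /F /=; congr (_ *: (f _ - _)).
  by rewrite scalerDl [s *: 1]mulr1 addrCA.
have df' : derivable f (x + t *: h) h := diff_derivable df.
apply: DeriveDef; first by rewrite /derivable E.
rewrite /derive E -/(derive f (x + t *: h) h) deriveE //.
rewrite linear_formE.
by apply: eq_bigr => i _; rewrite pderivE.
Qed.

(** Mean value theorem twice along the segment; n^2 counts the second derivatives, and the factor
    1/2 is given up. The bound is asked on the segment only, so that decay at infinity can enter
    [M]. *)
Lemma taylor2 f (x h : V) (M : R) : smooth_on setT f ->
  (forall t, 0 <= t <= 1 -> forall i j, `|iderive [:: j; i] f (x + t *: h)| <= M) ->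
  `|f (x + h) - f x - \sum_(i < n) h ord0 i * pderiv i f x| <=
  (n ^ 2)%:R * M * `|h| ^+ 2.
Proof.
move=> sf bM.
pose F t := f (x + t *: h).
pose F' t := \sum_(i < n) h ord0 i * pderiv i f (x + t *: h).
pose F'' t := \sum_(i < n) h ord0 i * \sum_(j < n) h ord0 j * pderiv j (pderiv i f) (x + t *: h).
have dF t : is_derive t (1:R) F (F' t).
  by apply: line_derive; exact: (smooth_diff sf).
have dF' t : is_derive t (1:R) F' (F'' t).
  have -> : F' = \sum_(i < n) (h ord0 i *: (fun t => pderiv i f (x + t *: h))).
    by apply/funext => s; rewrite fct_sumE.
  apply: is_derive_sum => i; apply: is_deriveZ.
  by apply: line_derive; exact: (smooth_diff (smooth_pderiv i sf)).
have cont (G G' : R -> R) (dG : forall t, is_derive t (1:R) G (G' t)) (A : set R) :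
    {within A, continuous G}.
  apply: continuous_subspaceT => t; apply: differentiable_continuous.
  by apply/derivable1_diffP; have [] := dG t.
have [c] := @MVT_segment _ F F' 0 1 ler01 (fun t _ => dF t) (cont _ _ dF _).
rewrite in_itv /= => /andP[c0 c1].
rewrite subr0 mulr1 /F scale1r scale0r addr0 => ->.
have -> : \sum_(i < n) h ord0 i * pderiv i f x = F' 0.
  by apply: eq_bigr => i _; rewrite scale0r addr0.
have [d] := @MVT_segment _ F' F'' 0 c c0 (fun t _ => dF' t) (cont _ _ dF' _).
rewrite in_itv /= => /andP[d0 dc]; rewrite subr0 => ->.
rewrite normrM (ger0_norm c0).
have M0 : \sum_(i < n) \sum_(j < n) M * `|h| ^+ 2 = (n ^ 2)%:R * M * `|h| ^+ 2.
  by rewrite !sumr_const !card_ord -mulrnA mulnn -[LHS]mulr_natl mulrA.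
apply: (@le_trans _ _ `|F'' d|); first by rewrite ler_piMr.
rewrite -M0; apply: le_trans (ler_norm_sum _ _ _) _; apply: ler_sum => i _.
rewrite normrM; apply: (@le_trans _ _ (`|h ord0 i| * \sum_(j < n) `|h| * M)).
  apply: ler_wpM2l => //; apply: le_trans (ler_norm_sum _ _ _) _; apply: ler_sum => j _.
  rewrite normrM ler_pM //; first exact: coord_le_norm.
  by apply: bM; rewrite d0 (le_trans dc).
rewrite mulr_sumr; apply: ler_sum => j _.
have Mge : 0 <= M by apply: le_trans (bM 0 _ i j); rewrite ?lexx ?ler01.
rewrite mulrA expr2 mulrC; apply: ler_wpM2l => //.
by apply: ler_pM => //; exact: coord_le_norm.
Qed.


(* [schwartz] with sup-norm weights; equivalent by [schP]. *)
Definition sch f := smooth_on setT f /\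
  forall s k, exists C, forall x, (1 + `|x|) ^+ k * `|iderive s f x| <= C.

Lemma sch_smooth f : sch f -> smooth_on setT f. Proof. by case. Qed.

Lemma sch_diff f x : sch f -> differentiable f x.
Proof. by case=> sf _; exact: (smooth_diff sf). Qed.

Lemma sch_cont f : sch f -> continuous f.
Proof. by case=> sf _ x; exact: (smooth_cont sf). Qed.

Lemma wt_ge1 (x : V) : 1 <= 1 + `|x|. Proof. by rewrite lerDl. Qed.

Lemma wt_gt0 (x : V) : 0 < 1 + `|x|. Proof. exact: lt_le_trans ltr01 (wt_ge1 x). Qed.

Lemma enorm_ge0 (x : V) : 0 <= enorm x. Proof. exact: sqrtr_ge0. Qed.

Lemma norm_le_enorm (x : V) : `|x| <= enorm x.
Proof.
rewrite [leLHS]/Num.Def.normr /= mx_normrE.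
apply/bigmax_leP; split=> [|[i j] _ /=]; first exact: enorm_ge0.
rewrite -sqrtr_sqr ler_sqrt ?sumr_ge0 // => [|k _]; last exact: sqr_ge0.
rewrite (ord1 i) (bigD1 j) //= lerDl sumr_ge0 // => k _; exact: sqr_ge0.
Qed.

Lemma enorm_le_norm (x : V) : enorm x <= n.+1%:R * `|x|.
Proof.
have h0 : 0 <= n.+1%:R * `|x| by rewrite mulr_ge0.
rewrite -(ger0_norm h0) -sqrtr_sqr ler_sqrt ?sqr_ge0 //.
apply: (@le_trans _ _ (\sum_(i < n) `|x| ^+ 2)).
  apply: ler_sum => i _; rewrite -[x ord0 i ^+ 2]ger0_norm ?sqr_ge0 //.
  by rewrite normrX lerXn2r ?nnegrE //; exact: coord_le_norm.
rewrite sumr_const card_ord -[X in X <= _]mulr_natl exprMn ler_wpM2r ?sqr_ge0 //.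
by rewrite -natrX ler_nat (leq_trans (leqnSn n)) // -mulnn leq_pmulr.
Qed.

Lemma schP f : schwartz f <-> sch f.
Proof.
split=> -[sf H]; split=> // s k; have [C HC] := H s k.
  exists C => x; apply: le_trans (HC x); rewrite ler_wpM2r //.
  by rewrite lerXn2r ?nnegrE ?addr_ge0 ?enorm_ge0 // lerD2l norm_le_enorm.
exists (n.+1%:R ^+ k * C) => x.
apply: (@le_trans _ _ (n.+1%:R ^+ k * ((1 + `|x|) ^+ k * `|iderive s f x|))); last first.
  by rewrite ler_wpM2l // exprn_ge0.
rewrite mulrA ler_wpM2r // -exprMn lerXn2r ?nnegrE ?addr_ge0 ?enorm_ge0 //.
by rewrite mulrDr mulr1 lerD ?enorm_le_norm // ler1n.
Qed.

Lemma sch_bound f k : sch f -> exists2 C, 0 <= C & forall x, `|f x| <= C / (1 + `|x|) ^+ k.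
Proof.
case=> _ /(_ [::] k)[C HC]; exists C.
  by apply: le_trans (HC 0); rewrite mulr_ge0 // exprn_ge0 // addr_ge0.
by move=> x; rewrite ler_pdivlMr ?exprn_gt0 ?wt_gt0 // mulrC; exact: HC.
Qed.

(** Iterated derivatives never leave the closure, so decay has to be checked only on the generators
    themselves. *)
Lemma sch_sum_closure (P : (V -> R) -> Prop) :
  (forall f, P f -> (forall x, differentiable f x) /\
    forall i, exists2 g, sum_closure P g & forall x, pderiv i f x = g x) ->
  (forall f, P f -> forall k, exists C, forall x, (1 + `|x|) ^+ k * `|f x| <= C) ->
  forall f, sum_closure P f -> sch f.
Proof.
move=> dP bP f Pf.
have cP : smooth_class setT (sum_closure P).
  apply: sum_closure_class => g /dP[dg Dg]; split=> // i.
  by have [g' Pg' E] := Dg i; exists g'.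
split; first exact: (smooth_classP openT cP Pf).
move=> s; have [g Pg sg] := smooth_class_iderive s openT cP Pf.
move=> k; suff [C HC] : exists C, forall x, (1 + `|x|) ^+ k * `|g x| <= C.
  by exists C => x; rewrite sg.
elim: Pg {sg} => [h /bP//|h1 h2 _ [C1 H1] _ [C2 H2]].
exists (C1 + C2) => x; apply: le_trans (lerD (H1 x) (H2 x)).
by rewrite -mulrDr ler_wpM2l ?ler_normD // exprn_ge0 // addr_ge0.
Qed.

Lemma sch_bound_mul f k : sch f -> exists C, forall x, (1 + `|x|) ^+ k * `|f x| <= C.
Proof. by case=> _ /(_ [::] k). Qed.

Lemma sch_pderiv f i : sch f -> sch (pderiv i f).
Proof.
case=> sf Hf; split; first exact: smooth_pderiv.
by move=> s k; rewrite iderive_pderiv; exact: Hf.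
Qed.

Lemma sch_sum_closure_sch f : sum_closure sch f -> sch f.
Proof.
apply: sch_sum_closure => g sg; last by move=> k; exact: sch_bound_mul.
split=> [x|i]; first exact: sch_diff.
by exists (pderiv i g) => //; apply: Sum_base; exact: sch_pderiv.
Qed.

Lemma schD f g : sch f -> sch g -> sch (f \+ g).
Proof. by move=> sf sg; apply: sch_sum_closure_sch; apply: Sum_add; exact: Sum_base. Qed.

(** Differentiating x_j f leaves a term f, so multiplication by coordinates alone is not a stable
    shape; affine multipliers are. *)
Lemma sch_affM f j (a c : R) : sch f -> sch (fun x => (a * x ord0 j + c) * f x).
Proof.
move=> sf.
pose P h := exists a c g, sch g /\ h = (fun x : V => a * x ord0 j + c) \* g.
apply: (@sch_sum_closure P); last by apply: Sum_base; exists a, c, f.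
  move=> _ [{}a [{}c [g [sg ->]]]].
  have da x : differentiable (fun x : V => a * x ord0 j + c) x.
    apply: (@differentiableD _ _ _ (fun x : V => a * x ord0 j) (fun=> c)) => //.
    apply: (@differentiableM _ _ (fun=> a) (fun x : V => x ord0 j)) => //.
    exact: differentiable_coord.
  split=> [x|i]; first by apply: (@differentiableM _ _ _ g) => //; exact: sch_diff.
  exists (((fun x : V => 0 * x ord0 j + a * (i == j)%:R) \* g) \+
          ((fun x : V => a * x ord0 j + c) \* pderiv i g)).
    apply: Sum_add; apply: Sum_base; first by exists 0, (a * (i == j)%:R), g.
    by exists a, c, (pderiv i g); split=> //; exact: sch_pderiv.
  move=> x; rewrite pderivM //; last exact: sch_diff.
  congr (_ * _ + _).
  rewrite (@pderivD _ _ (fun x : V => a * x ord0 j) (fun=> c)) //; last first.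
    apply: (@differentiableM _ _ (fun=> a) (fun x : V => x ord0 j)) => //.
    exact: differentiable_coord.
  rewrite (@pderivM _ _ (fun=> a) (fun x : V => x ord0 j)) //; last exact: differentiable_coord.
  by rewrite pderiv_coord /pderiv !derive_cst !mul0r addr0 !add0r.
move=> _ [{}a [{}c [g [sg ->]]]] k.
have [C HC] := sch_bound_mul k.+1 sg.
exists ((`|a| + `|c|) * C) => x.
apply: (@le_trans _ _ ((`|a| + `|c|) * ((1 + `|x|) ^+ k.+1 * `|g x|))); last first.
  by rewrite ler_wpM2l // addr_ge0.
rewrite /= normrM exprSr [(`|a| + `|c|) * _]mulrCA -[leRHS]mulrA.
rewrite [leRHS](_ : _ = (1 + `|x|) ^+ k * (((1 + `|x|) * (`|a| + `|c|)) * `|g x|)); last by ring.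
apply: ler_wpM2l; first by rewrite exprn_ge0 // addr_ge0.
apply: ler_wpM2r => //.
apply: le_trans (ler_normD _ _) _; rewrite normrM mulrDr mulrC lerD //.
  by rewrite ler_wpM2r // (le_trans (coord_le_norm _ _)) // lerDr.
by rewrite ler_peMl // lerDl.
Qed.

Lemma sch_coordM f j : sch f -> sch (fun x => x ord0 j * f x).
Proof.
move=> sf; have := sch_affM j 1 0 sf.
by under eq_fun do rewrite mul1r addr0.
Qed.

Lemma schZ f (c : R) : sch f -> sch (fun x => c * f x).
Proof.
move=> sf; pose P h := exists2 g, sch g & h = (fun=> c) \* g.
apply: (@sch_sum_closure P); last by apply: Sum_base; exists f.
  move=> _ [g sg ->]; split=> [x|i].
    by apply: (@differentiableM _ _ (fun=> c) g) => //; exact: sch_diff.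
  exists ((fun=> c) \* pderiv i g).
    by apply: Sum_base; exists (pderiv i g) => //; exact: sch_pderiv.
  move=> x; rewrite (@pderivM _ _ (fun=> c) g) //; last exact: sch_diff.
  by rewrite /pderiv derive_cst mul0r add0r.
move=> _ [g sg ->] k; have [C HC] := sch_bound_mul k sg.
exists (`|c| * C) => x; rewrite /= normrM mulrCA.
by rewrite ler_wpM2l.
Qed.

Lemma pderiv_shift f i (a x : V) : pderiv i (fun y => f (y + a)) x = pderiv i f (x + a).
Proof.
pose d : V := delta_mx 0 i.
have E : (fun s : R => s^-1 *: (((fun y => f (y + a)) \o shift x) (s *: d) - f (x + a))) =
    (fun s => s^-1 *: ((f \o shift (x + a)) (s *: d) - f (x + a))).
  by apply/funext => s /=; rewrite addrA.
by rewrite /pderiv /derive -/d E.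
Qed.

Lemma differentiable_shift f (a x : V) : differentiable f (x + a) ->
  differentiable (fun y => f (y + a)) x.
Proof.
move=> df; apply: (@differentiable_comp _ _ _ _ (fun y : V => y + a) f) => //.
Qed.

Lemma sch_shift f (a : V) : sch f -> sch (fun x => f (x + a)).
Proof.
move=> sf; pose P h := exists2 g, sch g & h = fun x : V => g (x + a).
apply: (@sch_sum_closure P); last by apply: Sum_base; exists f.
  move=> _ [g sg ->]; split=> [x|i].
    by apply: differentiable_shift; exact: (sch_diff _ sg).
  exists (fun x => pderiv i g (x + a)); last exact: pderiv_shift.
  by apply: Sum_base; exists (pderiv i g) => //; exact: sch_pderiv.
move=> _ [g sg ->] k; have [C HC] := sch_bound_mul k sg.
exists ((1 + `|a|) ^+ k * C) => x.
apply: (@le_trans _ _ ((1 + `|a|) ^+ k * ((1 + `|x + a|) ^+ k * `|g (x + a)|))); last first.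
  by rewrite ler_wpM2l // exprn_ge0 // addr_ge0.
rewrite mulrA ler_wpM2r // -exprMn lerXn2r ?nnegrE ?mulr_ge0 ?addr_ge0 //.
have h1 : `|x| <= `|x + a| + `|a| by rewrite -{1}(addrK a x) ler_normB.
have h2 : 0 <= `|a| * `|x + a| by rewrite mulr_ge0.
lra.
Qed.

Lemma sch_deriv2_bound f k : sch f -> exists2 C, 0 <= C &
  forall i j x, `|iderive [:: j; i] f x| <= C / (1 + `|x|) ^+ k.
Proof.
move=> sf.
have H i j : exists C, 0 <= C /\ forall x, `|iderive [:: j; i] f x| <= C / (1 + `|x|) ^+ k.
  by have [C C0 HC] := sch_bound k (sch_pderiv j (sch_pderiv i sf)); exists C.
have H' i : exists C : 'I_n -> R, forall j, 0 <= C j /\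
    forall x, `|iderive [:: j; i] f x| <= C j / (1 + `|x|) ^+ k.
  by have [C HC] := choice (H i); exists C.
have [C HC] := choice H'.
exists (\sum_i \sum_j C i j).
  by apply: sumr_ge0 => i _; apply: sumr_ge0 => j _; have [] := HC i j.
move=> i j x; have [_ /(_ x)/le_trans->//] := HC i j.
rewrite ler_wpM2r // ?invr_ge0 ?exprn_ge0 ?addr_ge0 //.
rewrite (bigD1 i) //= (bigD1 j) //= -addrA lerDl addr_ge0 // sumr_ge0 // => a _.
  by have [] := HC i a.
by apply: sumr_ge0 => b _; have [] := HC a b.
Qed.

(** The lower bound r for the weight along the segment is left free: it is (1 + |x|)/2 for short
    steps, and 1 + e^u |x|/2 for the dilated steps of [mel_diff]. *)
Lemma sch_taylor f k : sch f -> exists2 C, 0 <= C & forall x h (r : R), 0 < r ->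
  (forall t, 0 <= t <= 1 -> r <= 1 + `|x + t *: h|) ->
  `|f (x + h) - f x - \sum_(i < n) h ord0 i * pderiv i f x| <=
    C / r ^+ k * `|h| ^+ 2.
Proof.
move=> sf; have [C C0 HC] := sch_deriv2_bound k sf.
exists ((n ^ 2)%:R * C); first by rewrite mulr_ge0.
move=> x h r r0 Hr; rewrite -[_ * C / _]mulrA; apply: taylor2; first exact: sch_smooth.
move=> t t01 i j; apply: le_trans (HC i j _) _.
rewrite ler_wpM2l // lef_pV2 ?posrE ?exprn_gt0 ?wt_gt0 //.
by rewrite lerXn2r ?nnegrE ?addr_ge0 ?(ltW r0) // Hr.
Qed.

Lemma sch_taylor1 f k : sch f -> exists2 C, 0 <= C & forall x h, `|h| <= 1 ->
  `|f (x + h) - f x - \sum_(i < n) h ord0 i * pderiv i f x| <=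
    C / (1 + `|x|) ^+ k * `|h| ^+ 2.
Proof.
move=> sf; have [C C0 HC] := sch_taylor k sf.
(* A step of norm at most 1 can at most halve the weight 1 + |x|, which is raised to the power k. *)
exists (C * 2 ^+ k); first by rewrite mulr_ge0 // exprn_ge0.
move=> x h h1; rewrite -[C * _ / _]mulrA.
have -> : 2 ^+ k / (1 + `|x|) ^+ k = ((1 + `|x|) / 2) ^- k.
  by rewrite exprMn invfM exprVn invrK mulrC.
apply: HC; first by rewrite divr_gt0 // wt_gt0.
move=> t /andP[t0 t1].
have h2 : `|x| <= `|x + t *: h| + `|t *: h| by rewrite -{1}(addrK (t *: h) x) ler_normB.
have h3 : `|t *: h| <= 1 by rewrite normrZ (ger0_norm t0) mulr_ile1.
have : 0 <= `|x + t *: h| by [].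
lra.
Qed.

(** Taylor handles |h| <= 1; for larger h, twice the sup bound is at most that constant times
    |h|. *)
Lemma sch_lip f : sch f -> exists2 L, 0 <= L & forall x h, `|f (x + h) - f x| <= L * `|h|.
Proof.
move=> sf; have [C C0 HC] := sch_taylor1 0 sf.
have [B B0 HB] := sch_bound 0 sf.
have HDi i : exists D, 0 <= D /\ forall x, `|pderiv i f x| <= D.
  have [D D0 HD] := sch_bound 0 (sch_pderiv i sf).
  by exists D; split=> // x; apply: le_trans (HD x) _; rewrite expr0 divr1.
have [D HD] := choice HDi.
have D0 : 0 <= \sum_i D i by apply: sumr_ge0 => i _; have [] := HD i.
exists (C + \sum_i D i + (B + B)); first by rewrite !addr_ge0.
move=> x h; have [h1|h1] := leP `|h| 1.
  have := HC x h h1; rewrite expr0 divr1 => T.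
  have S : `|\sum_(i < n) h ord0 i * pderiv i f x| <= (\sum_i D i) * `|h|.
    apply: le_trans (ler_norm_sum _ _ _) _; rewrite mulr_suml; apply: ler_sum => i _.
    by rewrite normrM mulrC ler_pM ?coord_le_norm //; have [_ ->] := HD i.
  rewrite -[X in `|X|](subrK (\sum_(i < n) h ord0 i * pderiv i f x)).
  apply: le_trans (ler_normD _ _) _; rewrite 2!mulrDl -[leLHS]addr0.
  apply: lerD; last by rewrite mulr_ge0 // addr_ge0.
  apply: lerD => //; apply: le_trans T _.
  by rewrite ler_wpM2l // expr2 ler_piMl.
apply: le_trans (ler_normB _ _) _; apply: (@le_trans _ _ (B + B)).
  by apply: lerD; apply: le_trans (HB _) _; rewrite expr0 divr1.
apply: (@le_trans _ _ ((B + B) * `|h|)); first by rewrite ler_peMr ?addr_ge0 // ltW.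
by rewrite ler_wpM2r // lerDr addr_ge0.
Qed.

End Schwartz.

(** * Lebesgue measure and integration *)

Section AeIntegral.
Context d (T : measurableType d) (R : realType) (mu : {measure set T -> \bar R}).
Local Open Scope ereal_scope.
Import HBNNSimple.

(** Neither function is assumed measurable, so the argument runs on simple functions below f:
    cutting one off [N] puts it below g and keeps its integral. *)
Lemma ge0_le_integral_offnull (N : set T) (f g : T -> \bar R) : measurable N ->
  mu N = 0 -> (forall x, 0 <= f x) -> (forall x, 0 <= g x) ->
  (forall x, ~ N x -> f x = g x) -> \int[mu]_x f x <= \int[mu]_x g x.
Proof.
move=> mN N0 f0 g0 fg; rewrite !ge0_integralTE //.
apply: ge_ereal_sup => _ [h /= hf <-].
pose h' := proj_nnsfun h (measurableC mN).
have h'1 x : ~ N x -> h' x = h x.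
  by move=> Nx; rewrite /h' -mrestrict patchE mem_set.
have h'0 x : N x -> h' x = 0%R.
  by move=> Nx; rewrite /h' -mrestrict patchE memNset //= => /(_ Nx).
clearbody h'; apply: ereal_sup_ubound; exists h'.
  by move=> x /=; have [Nx|Nx] := pselect (N x); [rewrite h'0|rewrite h'1 // -fg].
rewrite -!integralT_nnsfun; apply: ge0_ae_eq_integral => //.
- exact/measurable_EFinP.
- exact/measurable_EFinP.
- by move=> x _; rewrite lee_fin.
- by move=> x _; rewrite lee_fin.
exists N; split=> // x /= hx; apply: contrapT => Nx; apply: hx => _.
by rewrite h'1.
Qed.

Lemma eq_integral_offnull (N : set T) (f g : T -> \bar R) : measurable N ->
  mu N = 0 -> (forall x, ~ N x -> f x = g x) -> \int[mu]_x f x = \int[mu]_x g x.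
Proof.
move=> mN N0 fg; rewrite integralE [RHS]integralE; congr (_ - _);
  apply/eqP; rewrite eq_le; apply/andP; split;
  apply: (@ge0_le_integral_offnull N) => // x Nx; by rewrite ?funeposE ?funenegE fg.
Qed.

Lemma eq_Rintegral_ae (f g : T -> R) : {ae mu, forall x, f x = g x} ->
  (\int[mu]_x f x = \int[mu]_x g x)%R.
Proof.
move=> [N [mN N0 fg]]; rewrite /Rintegral; congr fine.
apply: (eq_integral_offnull mN N0) => x Nx; congr EFin.
by apply: contrapT => /fg.
Qed.
End AeIntegral.

Section Rfubini.
Context d1 d2 (T1 : measurableType d1) (T2 : measurableType d2) (R : realType).
Variables (m1 : {sigma_finite_measure set T1 -> \bar R})
  (m2 : {sigma_finite_measure set T2 -> \bar R}).
Variable F : T1 * T2 -> R.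
Hypothesis iF : (m1 \x m2)%E.-integrable setT (EFin \o F).

(** The real and the extended inner integrals can differ only on non-integrable sections, where
    [fine] may send an infinite value to 0; these sections form a null set. *)
Lemma Rfubini1 : \int[m1]_x (\int[m2]_y F (x, y)) = \int[(m1 \x m2)%E]_z F z.
Proof.
rewrite [RHS]/Rintegral -(integral12_prod_meas1 iF).
rewrite /Rintegral; congr fine.
have [N [mN N0 fg]] := ae_integrable1 iF.
apply: (eq_integral_offnull mN N0) => x Nx; rewrite fineK //.
apply: integrable_fin_num => //.
by apply: contrapT => /fg.
Qed.

Lemma Rfubini2 : \int[m2]_y (\int[m1]_x F (x, y)) = \int[(m1 \x m2)%E]_z F z.
Proof.
rewrite [RHS]/Rintegral -(integral21_prod_meas1 iF).
rewrite /Rintegral; congr fine.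
have [N [mN N0 fg]] := ae_integrable2 iF.
apply: (eq_integral_offnull mN N0) => x Nx; rewrite fineK //.
apply: integrable_fin_num => //.
by apply: contrapT => /fg.
Qed.

Lemma Rfubini : \int[m1]_x (\int[m2]_y F (x, y)) = \int[m2]_y (\int[m1]_x F (x, y)).
Proof. by rewrite Rfubini1 Rfubini2. Qed.
End Rfubini.

(** * Borel sets and product Lebesgue measure on row vectors *)

Section BorelRn.
Variable R : realType.


Definition borelRn n : measurableType _ := g_sigma_algebraType (@open 'rV[R]_n).

Definition rowm m (z : R * borelRn m) : borelRn m.+1 := row_mx (\row_(j < 1) z.1) z.2.
Definition unrow m (x : borelRn m.+1) : R * borelRn m :=
  ((x : 'rV[R]_m.+1) ord0 ord0, rsubmx (x : 'rV[R]_(1 + m))).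

Lemma open_measurableB n (U : set 'rV[R]_n) : open U -> measurable (U : set (borelRn n)).
Proof. by move=> oU; exact: sub_sigma_algebra. Qed.

Lemma continuous_measurableB n (f : 'rV[R]_n -> R) : continuous f ->
  measurable_fun setT (f : borelRn n -> R).
Proof.
move=> cf; apply: (measurability _ (RGenOpens.measurableE R)).
move=> _ [_ [a [b ->] <-]]; rewrite setTI; apply: open_measurableB.
exact: open_comp.
Qed.


Lemma rowmE m (z : R * borelRn m) (i : 'I_m.+1) :
  (rowm z : 'rV[R]_m.+1) ord0 i =
  if unlift ord0 i is Some j then (z.2 : 'rV[R]_m) ord0 j else z.1.
Proof.
rewrite /rowm; case: unliftP => [j ->|->].
  have -> : lift ord0 j = rshift 1 j by apply: val_inj.
  by rewrite (@row_mxEr _ 1 1 m).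
have -> : ord0 = lshift m (ord0 : 'I_1) by apply: val_inj.
by rewrite (@row_mxEl _ 1 1 m) mxE.
Qed.

Lemma rowm0 m (z : R * borelRn m) : (rowm z : 'rV[R]_m.+1) ord0 ord0 = z.1.
Proof. by rewrite rowmE; case: unliftP => // j /(congr1 val). Qed.

Lemma rowm_lift m (z : R * borelRn m) j :
  (rowm z : 'rV[R]_m.+1) ord0 (lift ord0 j) = (z.2 : 'rV[R]_m) ord0 j.
Proof. by rewrite rowmE liftK. Qed.

Lemma rowmK m : cancel (@rowm m) (@unrow m).
Proof.
move=> [t y]; rewrite /unrow rowm0 /=; congr pair.
by rewrite /rowm row_mxKr.
Qed.

Lemma unrowK m : cancel (@unrow m) (@rowm m).
Proof.
move=> x; apply/rowP => i; rewrite rowmE; case: unliftP => [j|] -> //=.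
rewrite mxE; congr (x _ _); exact: val_inj.
Qed.

Lemma norm_rowm m (z : R * borelRn m) :
  `|rowm z : 'rV[R]_m.+1| = Num.max `|z.1| `|z.2 : 'rV[R]_m|.
Proof.
apply/eqP; rewrite eq_le; apply/andP; split.
  rewrite [leLHS]/Num.Def.normr /= mx_normrE; apply/bigmax_leP; split => [|[a i] _ /=].
    by rewrite le_max normr_ge0.
  rewrite (ord1 a) rowmE le_max; case: unliftP => [j _|_]; last by rewrite lexx.
  by apply/orP; right; exact: coord_le_norm.
rewrite ge_max; apply/andP; split; first by rewrite -[z.1]rowm0 coord_le_norm.
rewrite [leLHS]/Num.Def.normr /= mx_normrE; apply/bigmax_leP; split => [|[a i] _ /=] //.
by rewrite (ord1 a) -rowm_lift coord_le_norm.
Qed.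

Lemma rowmB m (z w : R * borelRn m) :
  (rowm z : 'rV[R]_m.+1) - rowm w = rowm (z.1 - w.1, (z.2 : 'rV[R]_m) - w.2 : borelRn m).
Proof.
apply/rowP => i; rewrite mxE [X in _ + X = _]mxE !rowmE.
by case: unliftP => [j _|_] //=; rewrite !mxE.
Qed.

(** An open set pulls back to a countable union of boxes: a rational interval times the interior of
    the set of y for which the whole interval times y lies in U. Taking the interior makes the
    second factor open by construction. *)
Lemma measurable_rowm m : measurable_fun setT (@rowm m).
Proof.
apply: (@measurability _ _ _ (borelRn m.+1) setT (@rowm m) (@open 'rV[R]_m.+1) erefl) => _ [U oU <-]; rewrite setTI.
pose O p q : set 'rV[R]_m :=
  interior [set y | forall t, ratr p < t < ratr q -> U (rowm (t, y : borelRn m))].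
have -> : @rowm m @^-1` U =
    \bigcup_p \bigcup_q (`]ratr p, ratr q[%classic `*` (O p q : set (borelRn m))).
  apply/seteqP; split=> [[t y]|[t y] [p _ [q _ [/= tpq /interior_subset]]]] /=.
    move=> Uty; have : nbhs (rowm (t, y) : 'rV[R]_m.+1) U by exact: open_nbhs_nbhs.
    move=> /nbhs_ballP[e /= e0 eU].
    have [p pP] : exists p : rat, t - e < ratr p < t.
      have : t - e < t by rewrite ltrBlDr ltrDl.
      by move=> /rat_in_itvoo[p]; rewrite in_itv; exists p.
    have [q qP] : exists q : rat, t < ratr q < t + e.
      have : t < t + e by rewrite ltrDl.
      by move=> /rat_in_itvoo[q]; rewrite in_itv; exists q.
    exists p => //; exists q => //; split => /=.
      by rewrite in_itv /=; case/andP: pP => _ ->; case/andP: qP => ->.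
    apply/nbhs_ballP; exists e => //= y' yy' s spq; apply: eU.
    rewrite -ball_normE /= rowmB norm_rowm gt_max /=; apply/andP; split.
      rewrite ltr_norml; move: pP qP spq; lra.
    by move: yy'; rewrite -ball_normE.
  apply; by move: tpq; rewrite in_itv.
apply: bigcupT_measurable_rat => p; apply: bigcupT_measurable_rat => q.
apply: measurableX; first exact: measurable_itv.
by apply: open_measurableB; exact: open_interior.
Qed.

Lemma continuous_unrow2 m : continuous (fun x : 'rV[R]_m.+1 => (unrow x).2 : 'rV[R]_m).
Proof.
move=> x U /nbhs_ballP[e /= e0 eU]; apply/nbhs_ballP; exists e => //= y xy.
apply: eU; rewrite -ball_normE /=.
have -> : ((unrow x).2 : 'rV[R]_m) - (unrow y).2 = (unrow (x - y)).2.
  by apply/rowP => i; rewrite /unrow /= !mxE.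
apply: (@le_lt_trans _ _ `|x - y|).
  by rewrite -{2}[x - y]unrowK norm_rowm le_max lexx orbT.
by move: xy; rewrite -ball_normE.
Qed.

Lemma measurable_unrow m : measurable_fun setT (@unrow m).
Proof.
apply/measurable_fun_pairP; split.
  by apply: continuous_measurableB => x; exact: coord_continuous.
apply: (@measurability _ _ _ (borelRn m) setT (fun x => (unrow x).2) (@open 'rV[R]_m) erefl) => _ [U oU <-]; rewrite setTI.
apply: open_measurableB; move/continuousP: (@continuous_unrow2 m); exact.
Qed.

Section lebS.
Variables (m : nat) (mu : {sigma_finite_measure set (borelRn m) -> \bar R}).
Local Open Scope ereal_scope.

Definition lebS (A : set (borelRn m.+1)) : \bar R :=
  (@lebesgue_measure R \x mu) (@rowm m @^-1` A).

Let mpre (A : set (borelRn m.+1)) : measurable A -> measurable (@rowm m @^-1` A).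
Proof. by move=> mA; rewrite -[X in measurable X]setTI; exact: measurable_rowm. Qed.

Let muS0 : lebS set0 = 0. Proof. by rewrite /lebS preimage_set0 measure0. Qed.
Let muS_ge0 A : 0 <= lebS A. Proof. exact: measure_ge0. Qed.
Let muS_sigma_additive : semi_sigma_additive lebS.
Proof.
move=> F mF tF mUF; rewrite /lebS preimage_bigcup.
apply: measure_semi_sigma_additive.
- by move=> k; exact: mpre.
- apply/trivIsetP => /= i j _ _ ij; rewrite -preimage_setI.
  by move/trivIsetP : tF => /(_ _ _ _ _ ij) ->//; rewrite preimage_set0.
- by rewrite -preimage_bigcup; exact: mpre.
Qed.

HB.instance Definition _ := isMeasure.Build _ _ _ lebS
  muS0 muS_ge0 muS_sigma_additive.

Let muS_sigma_finite : sigma_finite setT lebS.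
Proof.
have /sigma_finiteP[F [TF ndF Foo]] := sigma_finiteT (@lebesgue_measure R).
have /sigma_finiteP[G [TG ndG Goo]] := sigma_finiteT mu.
exists (fun k => @unrow m @^-1` (F k `*` G k)).
  rewrite -preimage_bigcup (_ : \bigcup_i _ = setT) ?preimage_setT //.
  apply/seteqP; split=> // -[t y] _.
  have [i _ Ft] : (\bigcup_i F i) t by rewrite -TF.
  have [j _ Gy] : (\bigcup_i G i) y by rewrite -TG.
  exists (maxn i j) => //; split => /=.
    by move: t Ft; exact/subsetPset/ndF/leq_maxl.
  by move: y Gy; exact/subsetPset/ndG/leq_maxr.
move=> k; have [mF Fk] := Foo k; have [mG Gk] := Goo k; split.
  rewrite -[X in measurable X]setTI; apply: measurable_unrow => //.
  exact: measurableX.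
rewrite /lebS -comp_preimage (_ : _ \o _ = id) ?preimage_id.
  by rewrite product_measure1E // lte_mul_pinfty // ge0_fin_numE.
by apply/funext => x; exact: rowmK.
Qed.

HB.instance Definition _ := Measure_isSigmaFinite.Build _ _ _ lebS muS_sigma_finite.
End lebS.

(* Built one coordinate at a time so as to match the recursion of [intRn]. *)
Fixpoint lebRn n : {sigma_finite_measure set (borelRn n) -> \bar R} :=
  match n with
  | 0 => @dirac _ (borelRn 0) (0 : 'rV[R]_0) R
  | m.+1 => lebS (lebRn m)
  end.

End BorelRn.

(** * Affine changes of variables *)

Section Affine.
Variable R : realType.
Local Open Scope ereal_scope.
Local Notation leb := (@lebesgue_measure R).

(** By uniqueness of Lebesgue measure it is enough to compare both sides on half-open intervals. *)
Lemma lebesgue_affine_pos (r a : R) (A : set (measurableTypeR R)) : (0 < r)%R ->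
  measurable A ->
  leb A = r%:E * leb ((fun t => (r * t + a)%R) @^-1` A).
Proof.
move=> r0 mA.
have mphi : measurable_fun setT (fun t : measurableTypeR R => (r * t + a)%R : measurableTypeR R).
  by apply: measurable_funD => //; exact: measurable_funM.
pose pf : {measure set (measurableTypeR R) -> \bar R} :=
  pushforward leb (fun t : measurableTypeR R => (r * t + a)%R : measurableTypeR R).
pose r' : {nonneg R} := NngNum (ltW r0).
rewrite -[RHS]/(mscale r' (pf mphi) A).
apply: lebesgue_measure_unique => // _ [[x y] _ <-] /=.
rewrite /mscale /= /pushforward.
have -> : (fun t => (r * t + a)%R) @^-1` `]x, y]%classic = `]((x - a) / r)%R, ((y - a) / r)%R]%classic.
  apply/seteqP; split=> t /=; rewrite !in_itv /= ltr_pdivrMr // ler_pdivlMr //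
    ltrBlDr lerBrDr mulrC //.
rewrite !lebesgue_measure_itv /= !lte_fin ltr_pM2r ?invr_gt0 // ltrD2r.
case: ifP => _; last by rewrite mule0.
rewrite -!EFinB -EFinM; congr EFin; field; exact: lt0r_neq0.
Qed.

Lemma ge0_integral_affine_pos (r a : R) (f : R -> \bar R) : (0 < r)%R ->
  measurable_fun setT f -> (forall t, 0 <= f t) ->
  \int[leb]_t f (r * t + a)%R = (r^-1)%:E * \int[leb]_t f t.
Proof.
move=> r0 mf f0.
have mphi : measurable_fun setT (fun t : measurableTypeR R => (r * t + a)%R : measurableTypeR R).
  by apply: measurable_funD => //; exact: measurable_funM.
pose pf : {measure set (measurableTypeR R) -> \bar R} :=
  pushforward leb (fun t : measurableTypeR R => (r * t + a)%R : measurableTypeR R).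
pose r' : {nonneg R} := NngNum (ltW r0).
rewrite [in RHS](eq_measure_integral (mscale r' (pf mphi))); last first.
  by move=> A mA _; rewrite /mscale /= /pf (lebesgue_affine_pos a r0 mA).
rewrite ge0_integral_mscale //= muleA -EFinM mulVf ?mul1e; last exact: lt0r_neq0.
by rewrite ge0_integral_pushforward.
Qed.

Lemma ge0_integralN (f : R -> \bar R) :
  measurable_fun setT f -> (forall t, 0 <= f t) ->
  \int[leb]_t f (- t)%R = \int[leb]_t f t.
Proof.
move=> mf f0.
have -> : \int[leb]_t f t = \int[pushforward leb (-%R : _ -> measurableTypeR R)]_t f t.
  by apply: eq_measure_integral => A mA _; exact/esym/lebesgue_measureN.
by rewrite ge0_integral_pushforward.
Qed.

Lemma ge0_integral_affine (r a : R) (f : R -> \bar R) : r != 0%R ->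
  measurable_fun setT f -> (forall t, 0 <= f t) ->
  \int[leb]_t f (r * t + a)%R = (`|r|^-1)%:E * \int[leb]_t f t.
Proof.
move=> r0 mf f0; have [rp|rn|/eqP] := ltgtP r 0%R; last by rewrite (negbTE r0).
  have nr : (0 < - r)%R by rewrite oppr_gt0.
  rewrite (ltr0_norm rp) -(ge0_integral_affine_pos a nr mf f0).
  rewrite -[RHS]ge0_integralN //.
    by apply: eq_integral => t _; rewrite mulrNN.
  by apply: measurableT_comp => //; apply: measurable_funD => //; exact: measurable_funM.
by rewrite (gtr0_norm rn) (ge0_integral_affine_pos a rn mf f0).
Qed.

Lemma integrable_inv1sqr :
  leb.-integrable setT (EFin \o (fun t : R => (1 + t ^+ 2)^-1)%R).
Proof.
have m : measurable_fun setT (fun t : R => (1 + t ^+ 2)^-1)%R.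
  by apply: continuous_measurable_fun => t; exact: (@continuous_oneDsqrV R t).
apply/integrableP; split; first exact/measurable_EFinP.
under eq_integral => t _ do rewrite /= ger0_norm ?invr_ge0 ?addr_ge0 ?sqr_ge0 //.
rewrite ge0_symfun_integralT.
- have -> : [set x : R | (0 <= x)%R] = `[0%R, +oo[%classic by rewrite set_itvcy.
  by have := @integral0y_oneDsqr R; rewrite /oneDsqr => ->; rewrite -EFinM ltry.
- by move=> t; rewrite invr_ge0 addr_ge0 ?sqr_ge0.
- by move=> t; exact: (@continuous_oneDsqrV R t).
- by move=> t /=; rewrite sqrrN.
Qed.
End Affine.

Section LebesgueRn.
Variable R : realType.
Local Notation leb := (@lebesgue_measure R).
Local Notation mu := (lebRn R).
Local Open Scope ereal_scope.

Lemma measurable_rowm' m : measurable_fun setT (@rowm R m : (measurableTypeR R * borelRn R m)%type -> _).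
Proof. exact: measurable_rowm. Qed.

Lemma lebRn_prod m (f : borelRn R m.+1 -> \bar R) : measurable_fun setT f ->
  (forall x, 0 <= f x) ->
  \int[mu m.+1]_x f x = \int[leb \x mu m]_z f (rowm z).
Proof.
move=> mf f0.
have := @ge0_integral_pushforward _ _ _ _ R _ (@measurable_rowm' m)
  (leb \x mu m) setT f measurableT mf (fun y _ => f0 y).
by rewrite preimage_setT.
Qed.

Lemma lebRn_tonelli m (f : borelRn R m.+1 -> \bar R) : measurable_fun setT f ->
  (forall x, 0 <= f x) ->
  \int[mu m.+1]_x f x = \int[leb]_t \int[mu m]_y f (rowm (t, y)).
Proof.
move=> mf f0; rewrite lebRn_prod //.
have := @fubini_tonelli1 _ _ _ _ R leb (mu m) (f \o @rowm R m).
apply; last by move=> z; exact: f0.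
by apply: measurableT_comp => //; exact: measurable_rowm'.
Qed.

Lemma measurable_section m (f : borelRn R m.+1 -> \bar R) t : measurable_fun setT f ->
  measurable_fun setT (fun y : borelRn R m => f (rowm (t, y))).
Proof.
move=> mf; apply: measurableT_comp => //.
by apply: measurableT_comp; [exact: measurable_rowm' | exact: measurable_pair1].
Qed.

Definition affB n (r : R) (a : 'rV[R]_n) (x : borelRn R n) : borelRn R n := (r *: (x : 'rV[R]_n) + a)%R.

Lemma measurable_affB n r a : measurable_fun setT (@affB n r a).
Proof.
apply: (@measurability _ _ _ (borelRn R n) setT (affB r a) (@open 'rV[R]_n) erefl) => _ [U oU <-].
rewrite setTI; apply: open_measurableB.
have c : continuous (fun x : 'rV[R]_n => r *: x + a)%R.
  move=> x; apply: (@continuousD _ _ _ (fun x : 'rV[R]_n => r *: x)%R (fun=> a)).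
    by apply: (@continuousZ _ _ _ (fun=> r) (fun x : 'rV[R]_n => x)); [exact: cst_continuous|].
  exact: cst_continuous.
by move/continuousP: c; exact.
Qed.

Lemma affBE n r (a : 'rV[R]_n) (x : borelRn R n) i :
  (affB r a x : 'rV[R]_n) ord0 i = (r * (x : 'rV[R]_n) ord0 i + a ord0 i)%R.
Proof. by rewrite !mxE. Qed.

Lemma affB_rowm m r (a : 'rV[R]_m.+1) (t : R) (y : borelRn R m) :
  affB r a (rowm (t, y)) = rowm ((r * t + (unrow a).1)%R, affB r (unrow (a : borelRn R m.+1)).2 y).
Proof.
apply/rowP => i; rewrite affBE.
have -> : a ord0 i = (rowm (unrow (a : borelRn R m.+1)) : 'rV[R]_m.+1) ord0 i by rewrite unrowK.
by rewrite !rowmE; case: unliftP => [j _|_] //=; rewrite affBE.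
Qed.

(** Tonelli splits off the first coordinate, which contributes one factor 1/|r|; induction on the
    dimension supplies the others. *)
Lemma ge0_integral_affB n r a (f : borelRn R n -> \bar R) : r != 0%R ->
  measurable_fun setT f -> (forall x, 0 <= f x) ->
  \int[mu n]_x f (affB r a x) = (`|r| ^- n)%:E * \int[mu n]_x f x.
Proof.
move=> r0; elim: n a f => [|m IH] a f mf f0.
  rewrite expr0 invr1 mul1e; apply: eq_integral => x _; congr f.
  by apply/rowP; case.
rewrite lebRn_tonelli //; last by apply: measurableT_comp => //; exact: measurable_affB.
rewrite lebRn_tonelli //.
under eq_integral => t _ do under eq_integral => y _ do rewrite affB_rowm.
have msec t : measurable_fun setT (fun y : borelRn R m => f (rowm (t, y))) by exact: measurable_section.
under eq_integral => t _ do rewrite (IH _ (fun y => f (rowm ((r * t + (unrow a).1)%R, y)))) //.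
have mF : measurable_fun setT (fun t : measurableTypeR R => \int[mu m]_y f (rowm (t, y))).
  apply: (measurable_fun_fubini_tonelli_F (f \o @rowm R m)) => [|z]; last exact: f0.
  by apply: measurableT_comp => //; exact: measurable_rowm'.
have F0 t : 0 <= \int[mu m]_y f (rowm (t, y)) by exact: integral_ge0.
have c0 : 0 <= (`|r| ^- m)%:E :> \bar R by rewrite lee_fin invr_ge0 exprn_ge0.
pose G (t : R) := (`|r| ^- m)%:E * \int[mu m]_y f (rowm (t, y)).
rewrite -[LHS]/(\int[leb]_t G (r * t + (unrow (a : borelRn R m.+1)).1)%R).
rewrite ge0_integral_affine //.
- rewrite /G ge0_integralZl //.
  by rewrite muleA -EFinM exprS invfM.
- exact: measurable_funeM.
- by move=> t; rewrite mule_ge0.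
Qed.

End LebesgueRn.

(** * Integrals of real-valued functions *)

Section RealIntegral.
Context d (T : measurableType d) (R : realType) (mu : {measure set T -> \bar R}).
Implicit Types f g : T -> R.

Definition itg f := mu.-integrable setT (EFin \o f).

Lemma itg_meas f : itg f -> measurable_fun setT f.
Proof. by move=> /integrableP[/measurable_EFinP]. Qed.

Lemma itg_le g f : itg g -> measurable_fun setT f -> (forall x, `|f x| <= g x) -> itg f.
Proof.
move=> ig mf fg; apply: (le_integrable measurableT _ _ ig); first exact/measurable_EFinP.
by move=> x _; rewrite /= lee_fin (le_trans (fg x)) // ler_norm.
Qed.

Lemma itg_norm f : itg f -> itg (fun x => `|f x|).
Proof.
move=> fi; apply: (le_integrable measurableT _ _ fi).
  by apply/measurable_EFinP; apply: measurableT_comp => //; exact: itg_meas.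
by move=> x _ /=; rewrite normr_id.
Qed.

Lemma itgD f g : itg f -> itg g -> itg (fun x => f x + g x).
Proof. by move=> fi gi; exact: (integrableD measurableT fi gi). Qed.

Lemma itgB f g : itg f -> itg g -> itg (fun x => f x - g x).
Proof. by move=> fi gi; exact: (integrableB measurableT fi gi). Qed.

Lemma itgZ f (c : R) : itg f -> itg (fun x => c * f x).
Proof. by move=> fi; exact: (integrableZl measurableT c fi). Qed.

Lemma itg0 : itg (fun=> 0).
Proof. exact: integrable0. Qed.

Lemma itg_sum (I : Type) (r : seq I) (F : I -> T -> R) : (forall i, itg (F i)) ->
  itg (fun x => \sum_(i <- r) F i x).
Proof.
move=> iF; elim: r => [|i r IH].
  by under [X in itg X]eq_fun do rewrite big_nil; exact: itg0.
by under [X in itg X]eq_fun do rewrite big_cons; exact: itgD.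
Qed.

Lemma Rint_sum (I : Type) (r : seq I) (F : I -> T -> R) : (forall i, itg (F i)) ->
  \int[mu]_x (\sum_(i <- r) F i x) = \sum_(i <- r) \int[mu]_x F i x.
Proof.
move=> iF; elim: r => [|i r IH].
  rewrite big_nil; under eq_Rintegral => x _ do rewrite big_nil.
  by rewrite /Rintegral integral0.
rewrite big_cons -IH -(RintegralD measurableT (iF i)); last exact: itg_sum.
by apply: eq_Rintegral => x _; rewrite big_cons.
Qed.

Lemma RintZ f (c : R) : itg f -> \int[mu]_x (c * f x) = c * \int[mu]_x f x.
Proof. by move=> fi; rewrite RintegralZl. Qed.

Lemma RintD f g : itg f -> itg g ->
  \int[mu]_x (f x + g x) = \int[mu]_x f x + \int[mu]_x g x.
Proof. by move=> fi gi; rewrite RintegralD. Qed.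

Lemma RintB f g : itg f -> itg g ->
  \int[mu]_x (f x - g x) = \int[mu]_x f x - \int[mu]_x g x.
Proof. by move=> fi gi; rewrite RintegralB. Qed.

(** A change of variables known for nonnegative functions passes to integrable ones through positive
    and negative parts. *)
Lemma transport (phi : T -> T) (c : R) f : measurable_fun setT phi -> 0 <= c ->
  (forall g : T -> \bar R, measurable_fun setT g -> (forall x, 0 <= g x)%E ->
     \int[mu]_x g (phi x) = c%:E * \int[mu]_x g x)%E ->
  itg f -> itg (fun x => f (phi x)) /\ \int[mu]_x f (phi x) = c * \int[mu]_x f x.
Proof.
move=> mphi c0 E fi.
have mf : measurable_fun setT (EFin \o f) by exact: measurable_int fi.
split.
  apply/integrableP; split; first exact: (measurableT_comp mf).
  have /integrableP[_ fo] := fi.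
  have := E (fun x => `|(f x)%:E|)%E; move=> -> //; first by rewrite lte_mul_pinfty.
  exact: (measurableT_comp _ mf).
have H1 := E _ (measurable_funepos mf) (funepos_ge0 (EFin \o f)).
have H2 := E _ (measurable_funeneg mf) (funeneg_ge0 (EFin \o f)).
rewrite /Rintegral integralE [in RHS]integralE.
have -> : (\int[mu]_x (fun x => (f (phi x))%:E)^\+ x =
           c%:E * \int[mu]_x (EFin \o f)^\+ x)%E.
  by rewrite -H1; apply: eq_integral => z _; rewrite !funeposE.
have -> : (\int[mu]_x (fun x => (f (phi x))%:E)^\- x =
           c%:E * \int[mu]_x (EFin \o f)^\- x)%E.
  by rewrite -H2; apply: eq_integral => z _; rewrite !funenegE.
have fp : (\int[mu]_x (EFin \o f)^\+ x)%E \is a fin_num.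
  by apply: integrable_fin_num => //; exact: integrable_funepos.
have fn : (\int[mu]_x (EFin \o f)^\- x)%E \is a fin_num.
  by apply: integrable_fin_num => //; exact: integrable_funeneg.
by rewrite -(fineK fp) -(fineK fn) -!EFinM -!EFinB /= mulrBr.
Qed.

Lemma itg_mulb f g (C : R) : itg f -> measurable_fun setT g -> (forall x, `|g x| <= C) ->
  itg (fun x => f x * g x).
Proof.
move=> fi mg gC; apply: (@itg_le (fun x => C * `|f x|)).
- exact/itgZ/itg_norm.
- by apply: measurable_funM => //; exact: itg_meas.
- by move=> x; rewrite normrM mulrC ler_wpM2r.
Qed.

Lemma Rint_le f g : itg f -> itg g -> (forall x, f x <= g x) ->
  \int[mu]_x f x <= \int[mu]_x g x.
Proof. by move=> fi gi fg; apply: le_Rintegral. Qed.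

Lemma Rint_norm_le f g : itg f -> itg g -> (forall x, `|f x| <= g x) ->
  `|\int[mu]_x f x| <= \int[mu]_x g x.
Proof.
move=> fi gi fg; apply: le_trans (le_normr_Rintegral measurableT fi) _.
by apply: Rint_le => //; exact: itg_norm.
Qed.

Lemma Rint_eq0 f : (forall x, 0 <= f x) -> itg f -> \int[mu]_x f x = 0 ->
  {ae mu, forall x, f x = 0}.
Proof.
move=> f0 fi I0.
have mf : measurable_fun setT (EFin \o f) by apply/measurable_EFinP; exact: itg_meas.
have : (\int[mu]_(x in setT) `|(EFin \o f) x| = 0)%E.
  under eq_integral => x _ do rewrite gee0_abs ?lee_fin //.
  move: I0; rewrite /Rintegral => /eqP; rewrite fine_eq0; last exact: integrable_fin_num.
  by move=> /eqP.
move=> /(ae_eq_integral_abs _ measurableT mf) [N [mN N0 H]].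
exists N; split=> // x /= fx; apply: H => /= H'; apply: fx.
by have := H' I => -[].
Qed.
End RealIntegral.

Section RealIntegralRn.
Variable R : realType.
Local Notation mu := (lebRn R).
Local Notation leb := (@lebesgue_measure R).

(** The induction hypothesis applies only to integrable sections, that is, for almost every first
    coordinate. On the remaining null set [intRn] may take any value, and [eq_Rintegral_ae] discards
    it. *)
Lemma intRnE n (f : 'rV[R]_n -> R) : itg (mu n) f -> intRn f = \int[mu n]_x f x.
Proof.
elim: n f => [|m IH] f fi.
  rewrite /= /Rintegral integral_dirac //.
    by rewrite diracE in_setT mul1e.
  exact: measurable_int fi.
have mf : measurable_fun setT (EFin \o f : borelRn R m.+1 -> _) by exact: measurable_int fi.
have fi' : (leb \x mu m)%E.-integrable setT (EFin \o (f \o @rowm R m)).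
  apply/integrableP; split.
    apply: (measurableT_comp (f := EFin \o f : borelRn R m.+1 -> _)) => //; exact: measurable_rowm'.
  have /integrableP[_] := fi; rewrite lebRn_prod //.
  exact: measurableT_comp.
have -> : \int[mu m.+1]_x f x = \int[(leb \x mu m)%E]_z (f \o @rowm R m) z.
  rewrite /Rintegral [in RHS]integralE [in LHS]integralE; congr (fine (_ - _)).
    rewrite (lebRn_prod (measurable_funepos mf) (fun x => funepos_ge0 (EFin \o f) x)).
    by apply: eq_integral => z _; rewrite !funeposE.
  rewrite (lebRn_prod (measurable_funeneg mf) (fun x => funeneg_ge0 (EFin \o f) x)).
  by apply: eq_integral => z _; rewrite !funenegE.
rewrite -(Rfubini1 fi') /=; apply: eq_Rintegral_ae.
apply: filterS (ae_integrable1 fi') => t /= ti.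
by rewrite IH.
Qed.


Lemma affB_transport n r a (f : 'rV[R]_n -> R) : r != 0 -> itg (mu n) f ->
  itg (mu n) (fun x : borelRn R n => f (r *: x + a)) /\
  \int[mu n]_x f (r *: (x : 'rV[R]_n) + a) = `|r| ^- n * \int[mu n]_x f x.
Proof.
move=> r0; apply: (@transport _ _ _ _ (affB r a : borelRn R n -> borelRn R n)).
- exact: measurable_affB.
- by rewrite invr_ge0 exprn_ge0.
- by move=> g mg g0; exact: ge0_integral_affB.
Qed.

Lemma affB_itg n r a (f : 'rV[R]_n -> R) : r != 0 -> itg (mu n) f ->
  itg (mu n) (fun x : borelRn R n => f (r *: x + a)).
Proof. by move=> r0 /(affB_transport a r0)[]. Qed.

Lemma Rint_affB n r a (f : 'rV[R]_n -> R) : r != 0 -> itg (mu n) f ->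
  \int[mu n]_x f (r *: (x : 'rV[R]_n) + a) = `|r| ^- n * \int[mu n]_x f x.
Proof. by move=> r0 /(affB_transport a r0)[]. Qed.

Lemma leb_transport r a (f : R -> R) : r != 0 -> itg leb f ->
  itg leb (fun u => f (r * u + a)) /\
  \int[leb]_u f (r * u + a) = `|r|^-1 * \int[leb]_u f u.
Proof.
move=> r0; apply: (@transport _ _ _ leb (fun u : measurableTypeR R => r * u + a : measurableTypeR R)).
- by apply: measurable_funD => //; exact: measurable_funM.
- by rewrite invr_ge0.
- by move=> g mg g0; exact: ge0_integral_affine.
Qed.

Lemma Rint_scale n r (f : 'rV[R]_n -> R) : 0 < r -> itg (mu n) f ->
  \int[mu n]_x f (r *: (x : 'rV[R]_n)) = r ^- n * \int[mu n]_x f x.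
Proof.
move=> r0 fi; rewrite -(gtr0_norm r0) -(Rint_affB 0 _ fi); last exact: lt0r_neq0.
by apply: eq_Rintegral => x _; rewrite addr0 gtr0_norm.
Qed.

Lemma itg_scale n r (f : 'rV[R]_n -> R) : 0 < r -> itg (mu n) f ->
  itg (mu n) (fun x : borelRn R n => f (r *: (x : 'rV[R]_n))).
Proof.
move=> r0 fi; have := affB_itg 0 (lt0r_neq0 r0) fi.
by under [X in itg _ X -> _]eq_fun do rewrite addr0.
Qed.

Lemma Rint_shift n a (f : 'rV[R]_n -> R) : itg (mu n) f ->
  \int[mu n]_x f ((x : 'rV[R]_n) + a) = \int[mu n]_x f x.
Proof.
move=> fi; rewrite -[RHS]mul1r -[X in X * _]invr1 -(expr1n _ n) -normr1.
rewrite -(Rint_affB a _ fi) ?oner_eq0 //.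
by apply: eq_Rintegral => x _; rewrite scale1r.
Qed.

Lemma itg_shift n a (f : 'rV[R]_n -> R) : itg (mu n) f ->
  itg (mu n) (fun x : borelRn R n => f ((x : 'rV[R]_n) + a)).
Proof.
move=> fi; have := affB_itg a (oner_neq0 _) fi.
by under [X in itg _ X -> _]eq_fun do rewrite scale1r.
Qed.

Lemma Rint_opp n (f : 'rV[R]_n -> R) : itg (mu n) f ->
  \int[mu n]_x f (- (x : 'rV[R]_n)) = \int[mu n]_x f x.
Proof.
move=> fi; rewrite -[RHS]mul1r -[X in X * _]invr1 -(expr1n _ n) -(normrN1 R).
rewrite -(Rint_affB 0 _ fi) ?oppr_eq0 ?oner_eq0 //.
by apply: eq_Rintegral => x _; rewrite scaleN1r addr0.
Qed.

Lemma open_neq0 n : open [set x : 'rV[R]_n | x != 0].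
Proof.
have -> : [set x : 'rV[R]_n | x != 0] = ~` [set 0].
  by apply/seteqP; split => y /= /eqP.
apply: closed_openC; apply: accessible_closed_set1.
by apply: hausdorff_accessible; exact: norm_hausdorff.
Qed.

Lemma measurable_set0B n : measurable ([set 0 : 'rV[R]_n] : set (borelRn R n)).
Proof.
have -> : [set 0 : 'rV[R]_n] = ~` [set x : 'rV[R]_n | x != 0].
  by apply/seteqP; split => y /=; [move=> ->; rewrite eqxx | move/negP/negPn/eqP].
by apply: (@measurableC _ (borelRn R n)); apply: open_measurableB; exact: open_neq0.
Qed.

(** Homogeneous functions are continuous only off the origin. A preimage is open there, up to the
    closed point 0, which is added or not according to the value [f 0]. *)
Lemma measurable_off0 n (f : 'rV[R]_n -> R) :
  (forall x, x != 0 -> {for x, continuous f}) -> measurable_fun setT (f : borelRn R n -> R).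
Proof.
move=> cf; apply: (measurability _ (RGenOpens.measurableE R)).
move=> _ [_ [a [b ->] <-]]; rewrite setTI.
have m0 := @measurable_set0B n.
have -> : (f @^-1` `]a, b[ : set (borelRn R n)) =
    (f @^-1` `]a, b[ `&` [set x : 'rV[R]_n | x != 0]) `|`
    (if a < f 0 < b then [set 0] else set0).
  apply/seteqP; split=> x /=.
    have [->|x0] := eqVneq x 0; last by left.
    by rewrite in_itv /= => ->; right.
  by case=> [[]//|]; case: ifP => // + ->; rewrite in_itv.
apply: measurableU; last by case: ifP.
apply: open_measurableB; rewrite openE => x [/= fx x0].
have h1 : nbhs x (f @^-1` `]a, b[).
  by apply: (cf _ x0); apply: open_nbhs_nbhs; split => //; exact: itv_open.
have h2 : nbhs x [set x : 'rV[R]_n | x != 0].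
  by apply: open_nbhs_nbhs; split => //; exact: open_neq0.
exact: filterI h1 h2.
Qed.

Lemma lebRn_ball_gt0 n (x : 'rV[R]_n) (e : R) : 0 < e ->
  (0 < mu n ([set y | `|x - y| < e]%R : set (borelRn R n)))%E.
Proof.
move=> e0; elim: n x => [|m IH] x.
  rewrite /= diracE mem_set /= ?lte_fin ?ltr01 //.
  by rewrite (_ : x - 0 = 0) ?normr0 //; apply/rowP; case.
have E t (y : borelRn R m) : `|x - (rowm (t, y) : 'rV[R]_m.+1)| =
    Num.max `|(unrow (x : borelRn R m.+1)).1 - t| `|((unrow (x : borelRn R m.+1)).2 : 'rV[R]_m) - y|.
  have -> : x - (rowm (t, y) : 'rV[R]_m.+1) = rowm (unrow (x : borelRn R m.+1)) - rowm (t, y).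
    by rewrite unrowK.
  by rewrite rowmB norm_rowm.
have -> : mu m.+1 ([set y : 'rV[R]_m.+1 | `|x - y| < e] : set (borelRn R m.+1)) =
   (leb \x mu m)%E (ball (unrow (x : borelRn R m.+1)).1 e `*`
     [set y : 'rV[R]_m | `|((unrow (x : borelRn R m.+1)).2 : 'rV[R]_m) - y| < e]%R).
  rewrite /= /lebS; congr ((leb \x mu m)%E _); apply/seteqP; split=> -[t y] /=;
    by rewrite E gt_max -ball_normE /= => /andP.
rewrite product_measure1E; last 2 first.
- exact: measurable_ball.
- apply: open_measurableB.
  by have := ball_open ((unrow (x : borelRn R m.+1)).2 : 'rV[R]_m) e; rewrite -ball_normE.
apply: mule_gt0; last exact: IH.
apply: (@lt_le_trans _ _ (e *+ 2)%:E); first by rewrite lte_fin pmulrn_lgt0.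
by rewrite -(lebesgue_measure_ball (unrow (x : borelRn R m.+1)).1 (ltW e0)).
Qed.

Lemma lebRn_set0 n : (0 < n)%N -> mu n ([set 0 : 'rV[R]_n] : set (borelRn R n)) = 0%E.
Proof.
case: n => // m _.
have -> : mu m.+1 ([set 0 : 'rV[R]_m.+1] : set (borelRn R m.+1)) =
    (leb \x mu m)%E ([set (0 : measurableTypeR R)] `*` [set (0 : 'rV[R]_m)]).
  rewrite /= /lebS; congr ((leb \x mu m)%E _); apply/seteqP; split=> -[t y] /=.
    move=> E; have := rowmK (t, y : borelRn R m); rewrite E /unrow /= mxE => -[<- <-].
    by split=> //; apply/rowP => i; rewrite !mxE.
  by move=> [-> ->]; apply/rowP => i; rewrite rowmE /= mxE; case: unlift => [j|] //; rewrite mxE.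
rewrite product_measure1E; last 2 first.
- exact: measurable_set1.
- exact: measurable_set0B.
by rewrite [X in (X * _)%E](lebesgue_measure_set1 (0 : R)) mul0e.
Qed.

(** A product weight, whose integral factors by Tonelli; it serves as the majorant for the isotropic
    weights. *)
Definition prodwt n (x : 'rV[R]_n) : R := \prod_(i < n) (1 + x ord0 i ^+ 2)^-1.

Lemma prodwt_ge0 n (x : 'rV[R]_n) : 0 <= prodwt x.
Proof. by apply: prodr_ge0 => i _; rewrite invr_ge0 addr_ge0 ?sqr_ge0. Qed.

Lemma measurable_prodwt n : measurable_fun setT (@prodwt n : borelRn R n -> R).
Proof.
elim: n => [|m IH].
  rewrite (_ : @prodwt 0 = fun=> 1); first exact: measurable_cst.
  by apply/funext => x; rewrite /prodwt big_ord0.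
have -> : @prodwt m.+1 = (fun x : borelRn R m.+1 =>
    (1 + (unrow x).1 ^+ 2)^-1 * prodwt ((unrow x).2 : 'rV[R]_m)).
  apply/funext => x; rewrite /prodwt big_ord_recl; congr (_ * _); apply: eq_bigr => i _.
  rewrite -[in LHS](unrowK (x : borelRn R m.+1)) rowm_lift //.
apply: measurable_funM.
  apply: (measurableT_comp (f := fun t : R => (1 + t ^+ 2)^-1) (g := fun x => (unrow x).1)).
    by apply: continuous_measurable_fun => t; exact: (@continuous_oneDsqrV R t).
  by apply: (measurableT_comp (f := fst)) => //; exact: measurable_unrow.
apply: (measurableT_comp (f := @prodwt m : borelRn R m -> R) (g := fun x => (unrow x).2)) => //.
by apply: (measurableT_comp (f := snd)) => //; exact: measurable_unrow.
Qed.

Lemma itg_prodwt n : itg (mu n) (@prodwt n).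
Proof.
have mp k : measurable_fun setT (EFin \o @prodwt k : borelRn R k -> _).
  by apply/measurable_EFinP; exact: measurable_prodwt.
have ma k : measurable_fun setT (fun x : borelRn R k => `|(EFin \o @prodwt k) x|%E).
  exact: (measurableT_comp (f := abse) _ (mp k)).
elim: n => [|m IH]; apply/integrableP; (split; first exact: mp).
  rewrite /= integral_dirac //; last exact: ma.
  by rewrite diracE in_setT mul1e ltry.
rewrite lebRn_tonelli //.
have I1 := @integrable_inv1sqr R.
have Efin : (\int[mu m]_y (prodwt y)%:E)%E \is a fin_num by exact: integrable_fin_num.
have w0 t : 0 <= (1 + t ^+ 2)^-1 :> R by rewrite invr_ge0 addr_ge0 ?sqr_ge0.
have E t (y : borelRn R m) : (`|(EFin \o @prodwt m.+1) (rowm (t, y))| =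
    ((1 + t ^+ 2)^-1)%:E * (prodwt (y : 'rV[R]_m))%:E)%E.
  rewrite /= ger0_norm ?prodwt_ge0 // -EFinM /prodwt big_ord_recl rowm0 /=.
  by congr ((_ * _)%:E); apply: eq_bigr => i _; rewrite rowm_lift.
under eq_integral => t _.
  under eq_integral => y _ do rewrite E.
  rewrite ge0_integralZl //; first over.
  - by move=> y _; rewrite lee_fin prodwt_ge0.
  - by rewrite lee_fin.
rewrite ge0_integralZr //=.
- apply: lte_mul_pinfty.
  + by apply: integral_ge0 => t _; rewrite lee_fin.
  + exact: (integrable_fin_num measurableT I1).
  + by move: Efin; rewrite ge0_fin_numE //; apply: integral_ge0 => y _; rewrite lee_fin prodwt_ge0.
- by move/integrableP: I1 => [].
- by move=> t _; rewrite lee_fin.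
- by apply: integral_ge0 => y _; rewrite lee_fin prodwt_ge0.
Qed.

(** Each factor 1 + x_i^2 is at most (1 + |x|)^2, hence the exponent 2n. *)
Lemma wt_le_prodwt n (x : 'rV[R]_n) k : (n.*2 <= k)%N -> (1 + `|x|) ^- k <= prodwt x.
Proof.
move=> nk; rewrite /prodwt prodfV lef_pV2 ?posrE; last 2 first.
- by rewrite exprn_gt0 // wt_gt0.
- by apply: prodr_gt0 => i _; rewrite ltr_pwDl // sqr_ge0.
apply: (@le_trans _ _ ((1 + `|x|) ^+ n.*2)); last by rewrite ler_weXn2l // lerDl.
rewrite -mul2n exprM -[X in _ <= _ ^+ X]card_ord -prodr_const; apply: ler_prod => i _.
rewrite addr_ge0 ?sqr_ge0 //= sqrrD expr1n mul1r -addrA lerD2l.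
rewrite -[X in X <= _]add0r lerD ?mulrn_wge0 //.
by rewrite -real_normK ?num_real // lerXn2r ?nnegrE // coord_le_norm.
Qed.

Lemma measurable_norm n : measurable_fun setT (fun x : borelRn R n => `|x : 'rV[R]_n|).
Proof. by apply: continuous_measurableB => x; exact: norm_continuous. Qed.

Lemma measurable_wt n k : measurable_fun setT (fun x : borelRn R n => (1 + `|x : 'rV[R]_n|) ^- k).
Proof.
have -> : (fun x : borelRn R n => (1 + `|x : 'rV[R]_n|) ^- k) =
    (fun t : R => Num.max t 1 ^- k) \o (fun x : borelRn R n => 1 + `|x : 'rV[R]_n|).
  by apply/funext => x /=; rewrite max_l // wt_ge1.
apply: measurableT_comp; last by apply: measurable_funD => //; exact: measurable_norm.
apply: continuous_measurable_fun => t.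
have m0 : Num.max t 1 != 0 :> R by rewrite gt_eqF // lt_max ltr01 orbT.
apply: (@continuousV _ _ (fun t : R => Num.max t 1 ^+ k)); first by rewrite expf_neq0.
apply: (@continuous_comp _ _ _ (fun t : R => Num.max t 1) (fun t : R => t ^+ k)).
  by apply: (@continuous_max _ _ id (fun=> 1)); [by move=> ?; exact: cvg_id | exact: cst_continuous].
exact: exprn_continuous.
Qed.

Lemma itg_wt n k : (n.*2 <= k)%N -> itg (mu n) (fun x : borelRn R n => (1 + `|x : 'rV[R]_n|) ^- k).
Proof.
move=> nk; apply: (itg_le (itg_prodwt n)); first exact: measurable_wt.
by move=> x; rewrite ger0_norm ?wt_le_prodwt // invr_ge0 exprn_ge0 // addr_ge0.
Qed.

Lemma itg_sch n (f : 'rV[R]_n -> R) : sch f -> itg (mu n) f.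
Proof.
move=> sf; have [C C0 HC] := sch_bound n.*2 sf.
apply: (itg_le (itgZ C (itg_wt (leqnn _)))) => //.
by apply: continuous_measurableB; exact: sch_cont.
Qed.

Lemma itg_sch_mul n (f : 'rV[R]_n -> R) (g : 'rV[R]_n -> R) C : sch f ->
  measurable_fun setT (g : borelRn R n -> R) -> (forall x, `|g x| <= C) ->
  itg (mu n) (fun x => f x * g x).
Proof. by move=> sf mg gC; exact: (itg_mulb (itg_sch sf) mg gC). Qed.

(** Otherwise f would be positive on a ball around x, which has positive measure, while f vanishes
    almost everywhere. *)
Lemma Rint_pos_eq0 n (f : 'rV[R]_n -> R) (x : 'rV[R]_n) : (forall x, 0 <= f x) ->
  itg (mu n) f -> {for x, continuous f} -> \int[mu n]_x f x = 0 -> f x = 0.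
Proof.
move=> f0 fi fc I0; apply: contrapT => /eqP fx.
have fx0 : 0 < f x by rewrite lt_def fx f0.
have [N [mN N0 sN]] := @Rint_eq0 _ (borelRn R n) R _ _ f0 fi I0.
have : nbhs x [set y | 0 < f y] by exact: (cvgr_gt _ fc).
move=> /nbhs_ballP[e /= e0 eP].
have := lebRn_ball_gt0 x e0; rewrite ltNge => /negP; apply.
rewrite -N0; apply: le_measure; rewrite ?inE //.
  by apply: open_measurableB; have := ball_open x e; rewrite -ball_normE.
move=> y /= xy; apply: sN => /= fy.
by have := eP y; rewrite -ball_normE /= fy ltxx => /(_ xy).
Qed.

End RealIntegralRn.

(** * The Fourier transform on Schwartz functions *)

Section Cosine.
Variable R : realType.
Implicit Types u v : R.

Lemma lip_of_derive (f f' : R -> R) (K : R) : (forall t, is_derive t (1:R) f (f' t)) ->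
  (forall t, `|f' t| <= K) -> forall u v, `|f u - f v| <= K * `|u - v|.
Proof.
move=> df bf; have cf (A : set R) : {within A, continuous f}.
  apply: continuous_subspaceT => t; apply: differentiable_continuous.
  by apply/derivable1_diffP; have [] := df t.
move=> u v; wlog uv : u v / v <= u => [H|].
  by have [/H//|/ltW/H] := leP v u; rewrite distrC [`|u - v|]distrC.
have [c _ ->] := @MVT_segment _ f f' v u uv (fun t _ => df t) (cf _).
by rewrite normrM ler_wpM2r.
Qed.

Lemma sin_lip u v : `|sin u - sin v| <= `|u - v|.
Proof.
rewrite -[leRHS]mul1r; apply: (@lip_of_derive _ cos) => // t.
by rewrite ler_norml cos_geN1 cos_le1.
Qed.

(** Mean value theorem for cos, then the Lipschitz bound for sin at the intermediate point; this
    costs the factor 1/2. *)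
Lemma cos_taylor u v : `|cos (u + v) - cos u + v * sin u| <= v ^+ 2.
Proof.
have cf (A : set R) : {within A, continuous (@cos R)}.
  by apply: continuous_subspaceT; exact: continuous_cos.
have [c cuv E] : exists2 c, `|u - c| <= `|v| & cos (u + v) - cos u = - sin c * v.
  have [v0|v0] := leP 0 v.
    have uv : u <= u + v by rewrite lerDl.
    have [c] := @MVT_segment _ cos _ u (u + v) uv (fun t _ => is_derive_cos t) (cf _).
    rewrite in_itv /= => /andP[c1 c2] ->; exists c; last by congr (_ * _); ring.
    rewrite ler_norml (ger0_norm v0); apply/andP; split; lra.
  have uv : u + v <= u by rewrite gerDl ltW.
  have [c] := @MVT_segment _ cos _ (u + v) u uv (fun t _ => is_derive_cos t) (cf _).
  rewrite in_itv /= => /andP[c1 c2] E; exists c; last by rewrite -opprB E; ring.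
  rewrite ler_norml (ltr0_norm v0); apply/andP; split; lra.
have -> : cos (u + v) - cos u + v * sin u = v * (sin u - sin c) by rewrite E; ring.
rewrite normrM -real_normK ?num_real // expr2 ler_wpM2l //.
exact: le_trans (sin_lip _ _) cuv.
Qed.
End Cosine.

Section CosineTransform.
Variables (R : realType) (n : nat).
Local Notation V := 'rV[R]_n.
Local Notation mu := (lebRn R n).
Local Notation B := (borelRn R n).
Implicit Types (f g : V -> R) (x y z : V) (a : R).

Lemma dotpC x y : dotp x y = dotp y x.
Proof. by apply: eq_bigr => i _; rewrite mulrC. Qed.

Lemma dotpDl x y z : dotp (x + y) z = dotp x z + dotp y z.
Proof. by rewrite /dotp -big_split; apply: eq_bigr => i _; rewrite !mxE mulrDl. Qed.

Lemma dotpZl (c : R) x z : dotp (c *: x) z = c * dotp x z.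
Proof. by rewrite /dotp mulr_sumr; apply: eq_bigr => i _; rewrite !mxE mulrA. Qed.

Lemma dotpNl x z : dotp (- x) z = - dotp x z.
Proof. by rewrite -scaleN1r dotpZl mulN1r. Qed.

Lemma dotp0l x : dotp 0 x = 0.
Proof. by rewrite -(scale0r x) dotpZl mul0r. Qed.

Lemma dotp_le x y : `|dotp x y| <= n%:R * (`|x| * `|y|).
Proof.
apply: le_trans (ler_norm_sum _ _ _) _.
apply: (@le_trans _ _ (\sum_(i < n) `|x| * `|y|)).
  by apply: ler_sum => i _; rewrite normrM ler_pM // coord_le_norm.
by rewrite sumr_const card_ord -[X in X <= _]mulr_natl.
Qed.

Lemma dotp_cont x : continuous (dotp x).
Proof.
move=> y; apply: (@smooth_cont _ _ setT) => //.
apply: (smooth_sum _ openT) => i.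
apply: (@smoothM _ _ _ (fun=> x ord0 i) (fun y : V => y ord0 i)).
- exact: openT.
- exact: (smooth_cst _ openT).
- exact: (smooth_coord _ openT).
Qed.

Lemma measurable_coord i : measurable_fun setT (fun x : B => (x : V) ord0 i).
Proof. by apply: continuous_measurableB => x; exact: coord_continuous. Qed.

Lemma measurable_dotp2 :
  measurable_fun setT (fun z : B * B => dotp (z.1 : V) (z.2 : V)).
Proof.
apply: measurable_sum => i; apply: measurable_funM.
  by apply: (measurableT_comp (measurable_coord i)); exact: measurable_fst.
by apply: (measurableT_comp (measurable_coord i)); exact: measurable_snd.
Qed.

Lemma measurable_cosR : measurable_fun setT (@cos R).
Proof. by apply: continuous_measurable_fun; exact: continuous_cos. Qed.

Lemma measurable_cosdot x a : measurable_fun setT (fun y : B => cos (dotp x (y : V) + a)).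
Proof.
apply: (measurableT_comp measurable_cosR); apply: measurable_funD => //.
by apply: continuous_measurableB; exact: dotp_cont.
Qed.

Lemma norm_cos_le1 (t : R) : `|cos t| <= 1.
Proof. by rewrite ler_norml cos_geN1 cos_le1. Qed.

(* The real and imaginary parts of the Fourier transform are [ct 0] and [ct (pi / 2)]. *)
Definition ct a f x : R := \int[mu]_y (f y * cos (dotp x y + a)).

Lemma itg_cos a f x : itg mu f -> itg mu (fun y : B => f y * cos (dotp x (y : V) + a)).
Proof. by move=> fi; apply: (itg_mulb fi (measurable_cosdot x a)) => y; exact: norm_cos_le1. Qed.

Lemma ct_le a f x : itg mu f -> `|ct a f x| <= \int[mu]_y `|f y|.
Proof.
move=> fi; apply: Rint_norm_le; first exact: itg_cos.
  exact: itg_norm.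
by move=> y; rewrite normrM ler_piMr // norm_cos_le1.
Qed.

Lemma itg_moment f k : sch f -> itg mu (fun y : B => `|f y| * `|y : V| ^+ k).
Proof.
move=> sf; have [C C0 HC] := sch_bound (n.*2 + k) sf.
apply: (itg_le (itgZ C (itg_wt R (leqnn n.*2)))).
  apply: measurable_funM.
    by apply: measurableT_comp => //; apply: continuous_measurableB; exact: sch_cont.
  by apply: measurable_funX; exact: measurable_norm.
move=> y; rewrite ger0_norm ?mulr_ge0 ?exprn_ge0 //.
apply: (@le_trans _ _ (C / (1 + `|y : V|) ^+ (n.*2 + k) * (1 + `|y : V|) ^+ k)).
  apply: ler_pM; [by []|by rewrite exprn_ge0|exact: HC|].
  by rewrite lerXn2r ?nnegrE ?addr_ge0 // lerDr.
rewrite exprD invfM mulrA -[leLHS]mulrA mulVf ?mulr1 //.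
Qed.

(** Since -sin is cos advanced by pi/2, a derivative multiplies the input by a coordinate and turns
    the phase. The remainder is [cos_taylor] integrated against |f|. *)
Lemma ct_diff a f x : sch f -> differentiable (ct a f) x /\
  forall i, pderiv i (ct a f) x = ct (a + pi / 2) (fun y => y ord0 i * f y) x.
Proof.
move=> sf; have fi := itg_sch sf.
(* The increment of the phase is the scalar product of h and y, at most n |h| |y| in the sup norm;
   its square gives n^2 and the second moment. *)
apply: (@diff_expand _ _ (ct a f) x _ (n%:R ^+ 2 * \int[mu]_y (`|f y| * `|y : V| ^+ 2)) 1 ltr01).
move=> h _.
have si i : itg mu (fun y : B => (y : V) ord0 i * f y) by exact/itg_sch/sch_coordM.
have ii i : itg mu (fun y : B => h ord0 i * ((y : V) ord0 i * f y * cos (dotp x (y : V) + (a + pi / 2)))).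
  exact/itgZ/itg_cos.
have -> : \sum_(i < n) h ord0 i * ct (a + pi / 2) (fun y => y ord0 i * f y) x =
    \int[mu]_y (f y * (- (dotp h y * sin (dotp x y + a)))).
  under eq_bigr => i _ do rewrite -(RintegralZl _ measurableT (itg_cos (a + pi / 2) x (si i))).
  rewrite -Rint_sum //; apply: eq_Rintegral => y _.
  under eq_bigr => i _ do rewrite addrA cosDpihalf.
  rewrite /dotp mulr_suml -sumrN mulr_sumr; apply: eq_bigr => i _; ring.
have i3 : itg mu (fun y : B => f y * (- (dotp h (y : V) * sin (dotp x (y : V) + a)))).
  have := itg_sum (index_enum 'I_n) ii.
  congr (itg _ _); apply/funext => y.
  under eq_bigr => i _ do rewrite addrA cosDpihalf.
  rewrite /dotp mulr_suml -sumrN mulr_sumr; apply: eq_bigr => i _; ring.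
rewrite /ct -RintegralB //; [|exact: itg_cos|exact: itg_cos].
rewrite -RintegralB //; last by apply: itgB; exact: itg_cos.
have mi := itg_moment 2 sf.
rewrite -mulrA [_ * `|h| ^+ 2]mulrC mulrA -RintegralZl //.
apply: Rint_norm_le.
- apply: itgB => //; apply: itgB; exact: itg_cos.
- exact: itgZ.
move=> y; rewrite -!mulrBr normrM dotpDl opprK.
have -> : dotp x y + dotp h y + a = (dotp x y + a) + dotp h y by ring.
rewrite [leRHS]mulrCA ler_wpM2l //.
apply: le_trans (cos_taylor _ _) _.
rewrite -[dotp h y ^+ 2]real_normK ?num_real // -!exprMn lerXn2r ?nnegrE ?mulr_ge0 //.
by rewrite -mulrA dotp_le.
Qed.


Lemma itg_sch_cos a f x : sch f -> itg mu (fun y : B => f y * cos (dotp x (y : V) + a)).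
Proof. by move=> sf; exact/itg_cos/itg_sch. Qed.

(** Replaces a limit t -> 0: a linear quantity with a quadratic bound vanishes. If A were nonzero, t
    = |A| / (2 (|M| + 1)), capped at 1, would contradict the bound. *)
Lemma small_quad (A M : R) : (forall t, 0 < t <= 1 -> t * `|A| <= M * t ^+ 2) -> A = 0.
Proof.
move=> H; apply/eqP; rewrite -normr_le0 leNgt; apply/negP => A0.
have M0 : 0 < `|M| + 1 by rewrite ltr_wpDl.
pose t := Num.min 1 (`|A| / 2 / (`|M| + 1)).
have t0 : 0 < t by rewrite /t lt_min ltr01 !divr_gt0.
have t1 : t <= 1 by rewrite /t ge_min lexx.
have t2 : t <= `|A| / 2 / (`|M| + 1) by rewrite /t ge_min lexx orbT.
have : t * `|A| <= M * t ^+ 2 by apply: H; rewrite t0.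
have -> : M * t ^+ 2 = t * (M * t) by ring.
rewrite ler_pM2l //.
have h1 : M * t <= (`|M| + 1) * t by rewrite ler_pM2r // (le_trans (ler_norm M)) // lerDl.
have h2 : (`|M| + 1) * t <= `|A| / 2 by rewrite mulrC -ler_pdivlMr.
lra.
Qed.

(* Translating [f] by [t e_i] changes the phase by [-t x_i]; comparing the two
   first-order expansions in [t] is the integration by parts. *)
Lemma ct_pderiv a f x i : sch f ->
  ct a (pderiv i f) x = - (x ord0 i * ct (a + pi / 2) f x).
Proof.
move=> sf; have fi := itg_sch sf; pose e : V := delta_mx 0 i.
have [C C0 HC] := sch_taylor1 n.*2 sf.
have ne : `|e| <= 1.
  rewrite [leLHS]/Num.Def.normr /= mx_normrE; apply/bigmax_leP; split => // -[k j] _ /=.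
  by rewrite mxE; case: (_ && _); rewrite ?normr1 ?normr0.
have wi := itg_wt R (leqnn n.*2).
pose M1 := \int[mu]_y (C * (1 + `|y : V|) ^- n.*2).
pose M2 := x ord0 i ^+ 2 * \int[mu]_y `|f y|.
pose S := \int[mu]_y (f y * (x ord0 i * sin (dotp x y + a))).
have iS : itg mu (fun y : B => f y * (x ord0 i * sin (dotp x (y : V) + a))).
  have := itgZ (- x ord0 i) (itg_cos (a + pi / 2) x fi).
  by congr (itg _ _); apply/funext => y; rewrite addrA cosDpihalf; ring.
have -> : - (x ord0 i * ct (a + pi / 2) f x) = S.
  rewrite -mulNr /ct -(RintZ _ (itg_cos _ x fi)).
  by apply: eq_Rintegral => y _; rewrite addrA cosDpihalf; ring.
apply/eqP; rewrite -subr_eq0; apply/eqP; apply: (@small_quad _ (M1 + M2)).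
move=> t /andP[t0 t1].
pose D := ct (a - t * x ord0 i) f x - ct a f x.
have shiftE : ct (a - t * x ord0 i) f x =
    \int[mu]_y (f ((y : V) + t *: e) * cos (dotp x y + a)).
  rewrite -(Rint_shift (- (t *: e)) (f := fun y => f (y + t *: e) * cos (dotp x y + a))).
    apply: eq_Rintegral => y _; rewrite subrK; congr (_ * cos _).
    rewrite [dotp x (_ - _)]dotpC dotpDl dotpNl dotpZl [dotp y x]dotpC.
    have -> : dotp e x = x ord0 i.
      rewrite /dotp (bigD1 i) //= mxE !eqxx mul1r big1 ?addr0 // => j ji.
      by rewrite mxE eqxx (negbTE ji) mul0r.
    ring.
  by apply: itg_cos; exact: itg_shift.
have d1 : `|D - t * ct a (pderiv i f) x| <= M1 * t ^+ 2.
  have ish : itg mu (fun y : B => f ((y : V) + t *: e) * cos (dotp x (y : V) + a)).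
    by apply: itg_cos; exact: itg_shift.
  have ip : itg mu (fun y : B => pderiv i f y * cos (dotp x (y : V) + a)).
    by apply: itg_sch_cos; exact: sch_pderiv.
  have i0 := itg_cos a x fi.
  rewrite /D shiftE /ct -(RintB ish i0) -(RintZ _ ip) -(RintB (itgB ish i0) (itgZ t ip)).
  rewrite mulrC -(RintZ _ (itgZ C wi)).
  apply: Rint_norm_le.
  - by apply: itgB; [apply: itgB => //; exact: itg_cos | exact: itgZ].
  - by apply: itgZ; exact: itgZ.
  move=> y; rewrite mulrA -!mulrBl normrM.
  apply: (@le_trans _ _ (`|f (y + t *: e) - f y - t * pderiv i f y| * 1)).
    by rewrite ler_wpM2l // norm_cos_le1.
  have te : `|t *: e| <= t by rewrite normrZ (gtr0_norm t0) ler_piMr // ltW.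
  have := HC y (t *: e) (le_trans te t1).
  have -> : \sum_(j < n) (t *: e) ord0 j * pderiv j f y = t * pderiv i f y.
    rewrite (bigD1 i) //= big1 ?addr0; first by rewrite !mxE !eqxx mulr1.
    by move=> j ji; rewrite !mxE eqxx (negbTE ji) mulr0 mul0r.
  rewrite mulr1 => /le_trans; apply.
  rewrite [leRHS]mulrC ler_wpM2l //; first by rewrite divr_ge0 // exprn_ge0 // addr_ge0.
  by rewrite lerXn2r ?nnegrE // ltW.
have d2 : `|D - t * S| <= M2 * t ^+ 2.
  have i0 := itg_cos a x fi; have i1 := itg_cos (a - t * x ord0 i) x fi.
  rewrite /D /ct /S -(RintB i1 i0) -(RintZ _ iS) -(RintB (itgB i1 i0) (itgZ t iS)).
  have ia : itg mu (fun y : B => `|f y|) by exact: itg_norm.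
  rewrite /M2 mulrAC -(RintZ _ ia).
  apply: Rint_norm_le.
  - by apply: itgB; [apply: itgB; exact: itg_cos | exact: itgZ].
  - exact: itgZ.
  move=> y; rewrite [X in `|_ - X|]mulrCA -!mulrBr normrM mulrC ler_wpM2r //.
  have := cos_taylor (dotp x y + a) (- (t * x ord0 i)).
  rewrite sqrrN exprMn mulrC; congr (`|_| <= _); last by ring.
  by rewrite addrA; ring.
have -> : t * `|ct a (pderiv i f) x - S| = `|t * ct a (pderiv i f) x - t * S|.
  by rewrite -mulrBr normrM (gtr0_norm t0).
have -> : t * ct a (pderiv i f) x - t * S = (D - t * S) - (D - t * ct a (pderiv i f) x) by ring.
apply: le_trans (ler_normB _ _) _; rewrite addrC mulrDl; exact: lerD.
Qed.

Lemma ct_coordM a f x i : sch f -> x ord0 i * ct a f x = - ct (a - pi / 2) (pderiv i f) x.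
Proof. by move=> sf; rewrite ct_pderiv // subrK opprK. Qed.

Lemma norm_le_sum x : `|x| <= \sum_(i < n) `|x ord0 i|.
Proof.
rewrite [leLHS]/Num.Def.normr /= mx_normrE; apply/bigmax_leP; split=> [|[k i] _ /=].
  exact: sumr_ge0.
by rewrite (ord1 k) (bigD1 i) //= lerDl sumr_ge0.
Qed.

(** Each power of the weight is traded for coordinates, and each coordinate for a derivative of f
    with a turned phase; hence the induction over all [a] and [f]. *)
Lemma ct_decay k : forall a f, sch f ->
  exists C, forall x, (1 + `|x|) ^+ k * `|ct a f x| <= C.
Proof.
elim: k => [|k IH] a f sf.
  by exists (\int[mu]_y `|f y|) => x; rewrite expr0 mul1r ct_le //; exact: itg_sch.
have [C HC] := IH a f sf.
have [D HD] := choice (fun i => IH (a - pi / 2) _ (sch_pderiv i sf)).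
exists (C + \sum_(i < n) D i) => x.
rewrite exprSr -mulrA mulrDl mul1r mulrDr lerD //.
apply: (@le_trans _ _ (\sum_(i < n) (1 + `|x|) ^+ k * `|ct (a - pi / 2) (pderiv i f) x|)); last first.
  by apply: ler_sum => i _; exact: HD.
rewrite -mulr_sumr ler_wpM2l ?exprn_ge0 ?addr_ge0 //.
apply: (@le_trans _ _ ((\sum_(i < n) `|x ord0 i|) * `|ct a f x|)).
  by rewrite ler_wpM2r // norm_le_sum.
rewrite mulr_suml; apply: ler_sum => i _.
by rewrite -normrM ct_coordM // normrN.
Qed.

Lemma sch_ct a f : sch f -> sch (ct a f).
Proof.
move=> sf; pose P h := exists a f, sch f /\ h = ct a f.
apply: (@sch_sum_closure _ _ P); last by apply: Sum_base; exists a, f.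
  move=> _ [{}a [{sf}f [sf ->]]]; split=> [x|i]; first exact: (ct_diff a x sf).1.
  exists (ct (a + pi / 2) (fun y => y ord0 i * f y)); last by move=> x; rewrite (ct_diff a x sf).2.
  by apply: Sum_base; exists (a + pi / 2), (fun y => y ord0 i * f y); split=> //; exact: sch_coordM.
by move=> _ [{}a [{sf}f [sf ->]]] k; exact: ct_decay.
Qed.

Lemma itg_schM f g : sch f -> sch g -> itg mu (fun x : B => f x * g x).
Proof.
move=> sf sg; have [C _ HC] := sch_bound 0 sg; apply: (@itg_sch_mul _ _ f g C) => //.
  by apply: continuous_measurableB; exact: sch_cont.
by move=> x; apply: le_trans (HC x) _; rewrite expr0 divr1.
Qed.

End CosineTransform.

Section ProductIntegrable.
Context d1 d2 (T1 : measurableType d1) (T2 : measurableType d2) (R : realType).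
Variables (m1 : {sigma_finite_measure set T1 -> \bar R})
  (m2 : {sigma_finite_measure set T2 -> \bar R}).

Lemma itg_prodM (f : T1 -> R) (g : T2 -> R) (K : T1 * T2 -> R) (C : R) :
  itg m1 f -> itg m2 g -> measurable_fun setT K -> (forall z, `|K z| <= C) ->
  itg (m1 \x m2)%E (fun z => f z.1 * g z.2 * K z).
Proof.
move=> fi gi mK bK; apply: (itg_mulb _ mK bK).
have mf := itg_meas fi; have mg := itg_meas gi.
have mfg : measurable_fun setT (fun z : T1 * T2 => (f z.1 * g z.2)%:E).
  apply/measurable_EFinP; apply: measurable_funM.
    exact: (measurableT_comp mf measurable_fst).
  exact: (measurableT_comp mg measurable_snd).
apply/(integrable12ltyP m1 m2 mfg).
have /integrableP[_ fo] := fi; have /integrableP[_ go] := gi.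
under eq_integral => x _.
  under eq_integral => y _ do rewrite /= normrM EFinM.
  rewrite ge0_integralZl //; first over.
  by apply/measurable_EFinP; apply: measurableT_comp.
rewrite ge0_integralZr //; last 2 first.
- by apply/measurable_EFinP; apply: measurableT_comp.
- exact: integral_ge0.
apply: lte_mul_pinfty => //; first exact: integral_ge0.
by rewrite ge0_fin_numE //; exact: integral_ge0.
Qed.
End ProductIntegrable.

(** * Fourier inversion for even functions *)

Section Inversion.
Variables (R : realType) (n : nat).
Local Notation V := 'rV[R]_n.
Local Notation mu := (lebRn R n).
Local Notation B := (borelRn R n).
Implicit Types (f g : V -> R) (x y z : V) (a : R).

Lemma dotpZr (c : R) x z : dotp x (c *: z) = c * dotp x z.
Proof. by rewrite dotpC dotpZl dotpC. Qed.

Lemma ct_sym a f g : itg mu f -> itg mu g ->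
  \int[mu]_x (ct a f x * g x) = \int[mu]_x (f x * ct a g x).
Proof.
move=> fi gi.
pose K (z : B * B) := cos (dotp (z.1 : V) (z.2 : V) + a).
have mK : measurable_fun setT K.
  apply: (measurableT_comp (@measurable_cosR R)); apply: measurable_funD => //.
  exact: measurable_dotp2.
have iF := @itg_prodM _ _ B B R mu mu g f K 1 gi fi mK (fun w => norm_cos_le1 _).
have := Rfubini iF; rewrite /K /= => E.
transitivity (\int[mu]_x \int[mu]_y (g x * f y * cos (dotp x y + a))).
  apply: eq_Rintegral => x _; rewrite mulrC /ct -(RintZ _ (itg_cos a x fi)).
  by apply: eq_Rintegral => y _; rewrite mulrA.
rewrite E; apply: eq_Rintegral => y _; rewrite /ct -(RintZ _ (itg_cos a y gi)).
by apply: eq_Rintegral => x _; rewrite dotpC mulrA [g x * _]mulrC.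
Qed.

Lemma ct_scale a f (r : R) x : 0 < r -> itg mu f ->
  ct a (fun y => f (r *: y)) x = r ^- n * ct a f (r^-1 *: x).
Proof.
move=> r0 fi; rewrite /ct -(Rint_scale r0 (f := fun y => f y * cos (dotp (r^-1 *: x) y + a))).
  apply: eq_Rintegral => y _; rewrite dotpZl dotpZr mulrA mulVf ?mul1r //.
  exact: lt0r_neq0.
exact: itg_cos.
Qed.

(** Approximate identity with a rate: the Lipschitz bound gives |g(e y) - g(0)| <= L e |y|, and f
    has a finite first moment. *)
Lemma scale_approx f g : sch f -> sch g -> exists2 M, 0 <= M & forall e, 0 < e ->
  `|\int[mu]_y (f y * g (e *: y)) - g 0 * \int[mu]_y f y| <= M * e.
Proof.
move=> sf sg; have [L L0 HL] := sch_lip sg.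
have mi := itg_moment 1 sf.
exists (L * \int[mu]_y (`|f y| * `|y : V| ^+ 1)).
  by rewrite mulr_ge0 //; apply: Rintegral_ge0 => y _; rewrite mulr_ge0.
move=> e e0; have fi := itg_sch sf.
have [C _ HC] := sch_bound 0 sg.
have i1 : itg mu (fun y : B => f y * g (e *: (y : V))).
  apply: (@itg_sch_mul _ _ f (fun y => g (e *: y)) C) => //.
    exact: (itg_meas (itg_scale e0 (itg_sch sg))).
  by move=> x; apply: le_trans (HC _) _; rewrite expr0 divr1.
rewrite -(RintZ _ fi) -(RintB i1 (itgZ _ fi)) [leRHS]mulrAC.
rewrite -(RintZ _ mi); apply: Rint_norm_le.
- exact: (itgB i1 (itgZ _ fi)).
- exact: itgZ.
move=> y; rewrite expr1 [g 0 * _]mulrC -mulrBr normrM.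
rewrite [leRHS](_ : _ = `|f y| * (L * (e * `|y|))); last by ring.
rewrite ler_wpM2l //; have := HL 0 (e *: y).
by rewrite add0r normrZ (gtr0_norm e0).
Qed.

(** Symmetry of the transform and a dilation show that f^(x) g(t x) and g^(x) f(t x) have the same
    integral for every t > 0; as t -> 0 the two sides tend to the two members. *)
Lemma ct_swap0 f g : sch f -> sch g ->
  g 0 * \int[mu]_x ct 0 f x = f 0 * \int[mu]_x ct 0 g x.
Proof.
move=> sf sg.
have [M1 M10 H1] := scale_approx (sch_ct 0 sf) sg.
have [M2 M20 H2] := scale_approx (sch_ct 0 sg) sf.
apply/eqP; rewrite -subr_eq0; apply/eqP; apply: (@small_quad R _ (M1 + M2)).
move=> t /andP[t0 _]; rewrite expr2 mulrCA ler_pM2l //.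
have E : \int[mu]_x (ct 0 f x * g (t *: x)) = \int[mu]_x (ct 0 g x * f (t *: x)).
  have fi := itg_sch sf; have gi := itg_sch sg; have tg := itg_scale t0 gi.
  rewrite (ct_sym 0 fi tg).
  transitivity (t ^- n * \int[mu]_x (f x * ct 0 g (t^-1 *: x))).
    have sc : sch (ct 0 g) by exact: sch_ct.
    have [C _ HC] := sch_bound 0 sc.
    have i1 : itg mu (fun x : B => f x * ct 0 g (t^-1 *: (x : V))).
      apply: (@itg_sch_mul _ _ f (fun x => ct 0 g (t^-1 *: x)) C) => //.
        by apply: (itg_meas (itg_scale _ (itg_sch sc))); rewrite invr_gt0.
      by move=> x; apply: le_trans (HC _) _; rewrite expr0 divr1.
    rewrite -(RintZ _ i1); apply: eq_Rintegral => x _.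
    by rewrite ct_scale // mulrCA.
  have sc : sch (ct 0 g) by exact: sch_ct.
  have [C _ HC] := sch_bound 0 sc.
  have i1 : itg mu (fun x : B => f x * ct 0 g (t^-1 *: (x : V))).
    apply: (@itg_sch_mul _ _ f (fun x => ct 0 g (t^-1 *: x)) C) => //.
      by apply: (itg_meas (itg_scale _ (itg_sch sc))); rewrite invr_gt0.
    by move=> x; apply: le_trans (HC _) _; rewrite expr0 divr1.
  rewrite -(Rint_scale t0 i1); apply: eq_Rintegral => x _.
  by rewrite mulrC scalerA mulVf ?scale1r // lt0r_neq0.
have -> : g 0 * \int[mu]_x ct 0 f x - f 0 * \int[mu]_x ct 0 g x =
   (\int[mu]_x (ct 0 g x * f (t *: x)) - f 0 * \int[mu]_x ct 0 g x) -
   (\int[mu]_x (ct 0 f x * g (t *: x)) - g 0 * \int[mu]_x ct 0 f x) by rewrite E; ring.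
apply: le_trans (ler_normB _ _) _; rewrite mulrDl addrC; apply: lerD; first exact: H1.
exact: H2.
Qed.

(** [ct_swap0] is applied to the mean h of the two translates of f by x and -x: then h(0) = f(x)
    because f is even, and the averaging cancels the sines, leaving h^(y) = f^(y) cos(x.y). *)
Lemma ct_inv f g x : sch f -> even_fun f -> sch g ->
  g 0 * ct 0 (ct 0 f) x = f x * \int[mu]_y ct 0 g y.
Proof.
move=> sf ef sg.
pose h (y : V) := 2^-1 * f (y + x) + 2^-1 * f (y - x).
have sp : sch (fun y => f (y + x)) by exact: sch_shift.
have sm : sch (fun y => f (y - x)) by exact: sch_shift.
have sh : sch h by apply: (schD (f := fun y => 2^-1 * f (y + x))); exact: schZ.
have h0 : h 0 = f x by rewrite /h add0r sub0r ef; field.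
have E y : ct 0 h y = ct 0 f y * cos (dotp x y + 0).
  have fi := itg_sch sf.
  have S1 z : ct 0 (fun y => f (y + z)) y = ct (- dotp y z) f y.
    rewrite /ct -(Rint_shift z (f := fun w => f w * cos (dotp y w + - dotp y z))).
      apply: eq_Rintegral => w _; congr (_ * cos _).
      rewrite [dotp y (_ + _)]dotpC dotpDl [dotp z y]dotpC [dotp w y]dotpC; ring.
    exact: itg_cos.
  have ip := itg_sch sp; have im := itg_sch sm.
  rewrite {1}/ct /h.
  have -> : \int[mu]_w ((2^-1 * f (w + x) + 2^-1 * f (w - x)) * cos (dotp y w + 0)) =
     2^-1 * ct 0 (fun w => f (w + x)) y + 2^-1 * ct 0 (fun w => f (w - x)) y.
    have jp := itg_cos 0 y ip; have jm := itg_cos 0 y im.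
    rewrite -(RintZ _ jp) -(RintZ _ jm) -(RintD (itgZ _ jp) (itgZ _ jm)).
    by apply: eq_Rintegral => w _; ring.
  rewrite !S1 /ct.
  have j1 := itg_cos (- dotp y x) y fi; have j2 := itg_cos (- dotp y (- x)) y fi.
  rewrite -(RintZ _ j1) -(RintZ _ j2) -(RintD (itgZ _ j1) (itgZ _ j2)).
  rewrite mulrC -(RintZ _ (itg_cos 0 y fi)); apply: eq_Rintegral => w _.
  rewrite [dotp y (- x)]dotpC dotpNl [dotp x y]dotpC opprK !addr0 cosB cosD.
  by field.
have := ct_swap0 sh sg; rewrite h0 => <-; congr (_ * _).
by rewrite {1}/ct; apply: eq_Rintegral => y _; rewrite E.
Qed.

(** The constant is the integral of g^ divided by g(0). Parseval for g expresses the integral of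
    (g^)^2 as c times that of g^2, so c >= 0. *)
Lemma Fourier_inversion : (exists g, [/\ sch g, even_fun g, forall x, 0 <= g x & 0 < g 0]) ->
  exists2 c : R, 0 < c & forall f x, sch f -> even_fun f -> ct 0 (ct 0 f) x = c * f x.
Proof.
move=> [g [sg eg g_ge0 g0]].
pose c := (\int[mu]_y ct 0 g y) / g 0.
have inv f x : sch f -> even_fun f -> ct 0 (ct 0 f) x = c * f x.
  move=> sf ef; have := ct_inv x sf ef sg => H.
  apply: (mulfI (lt0r_neq0 g0)); rewrite H /c mulrA [g 0 * _]mulrC mulfVK ?lt0r_neq0 //.
  by rewrite mulrC.
exists c => //.
have sc : sch (ct 0 g) by exact: sch_ct.
have E : \int[mu]_x (ct 0 g x * ct 0 g x) = c * \int[mu]_x (g x * g x).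
  rewrite (ct_sym 0 (itg_sch sg) (itg_sch sc)) -(RintZ _ (itg_schM sg sg)).
  by apply: eq_Rintegral => x _; rewrite inv // mulrCA.
have sq0 (u : V -> R) : sch u -> forall x, \int[mu]_x (u x * u x) = 0 -> u x = 0.
  move=> su x I0; have : u x * u x = 0.
    apply: (@Rint_pos_eq0 _ _ (fun x => u x * u x)) I0.
    - by move=> y; rewrite -expr2 sqr_ge0.
    - exact: itg_schM.
    - by apply: (@continuousM _ _ u u); exact: sch_cont.
  by move=> /eqP; rewrite mulf_eq0 orbb => /eqP.
have P : 0 < \int[mu]_x (g x * g x).
  rewrite lt_def; apply/andP; split.
    by apply/eqP => /(sq0 _ sg 0) E0; move: g0; rewrite E0 ltxx.
  by apply: Rintegral_ge0 => x _; rewrite -expr2 sqr_ge0.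
have c0 : 0 <= c.
  rewrite -(pmulr_lge0 _ P) -E; apply: Rintegral_ge0 => x _.
  by rewrite -expr2 sqr_ge0.
rewrite lt_def c0 andbT; apply/eqP => cE.
(* If c were 0, then g^ would vanish, in particular at 0, where it is the integral of g; but g is
   nonnegative with g(0) > 0. *)
have := sq0 _ sc 0; rewrite E cE mul0r => /(_ erefl).
rewrite /ct => I0.
have : g 0 = 0.
  apply: (Rint_pos_eq0 g_ge0 (itg_sch sg)); first exact: sch_cont.
  rewrite -[RHS]I0; apply: eq_Rintegral => y _.
  by rewrite dotp0l addr0 cos0 mulr1.
by move=> E0; move: g0; rewrite E0 ltxx.
Qed.

End Inversion.

(** * Bump functions *)

Section ExpInv.
Variable R : realType.
Implicit Types (t y : R) (p : {poly R}).

(** The flat function e^(-1/t), carried with a polynomial in 1/t so that the family is closed under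
    differentiation: p becomes X^2 (p - p'). *)
Definition expinv p t : R := if 0 < t then p.[t^-1] * expR (- t^-1) else 0.

(** Horner induction with k general: the factor X raises k by one, and the constant term leaves y^k
    e^(-y). *)
Lemma poly_expR_bound p (k : nat) :
  exists2 C : R, 0 <= C & forall y, 0 < y -> `|p.[y]| * y ^+ k * expR (- y) <= C.
Proof.
elim/poly_ind: p k => [|p c IH] k.
  by exists 0 => // y _; rewrite horner0 normr0 !mul0r.
have [C C0 HC] := IH k.+1.
have m0 : (0 : R) < k.+1%:R by [].
exists (C + `|c| * (1 + k.+1%:R ^+ k.+1)).
  by rewrite addr_ge0 // mulr_ge0 // addr_ge0 // exprn_ge0.
move=> y y0; rewrite hornerMXaddC.
have E1 : 0 < expR (- y) by exact: expR_gt0.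
have yk : 0 <= y ^+ k by rewrite exprn_ge0 // ltW.
apply: (@le_trans _ _ ((`|p.[y]| * y + `|c|) * y ^+ k * expR (- y))).
  apply: ler_wpM2r; first exact: ltW.
  apply: ler_wpM2r => //; apply: le_trans (ler_normD _ _) _.
  by rewrite normrM (gtr0_norm y0).
rewrite !mulrDl; apply: lerD.
  by have := HC y y0; rewrite exprS mulrA.
rewrite -mulrA; apply: ler_wpM2l => //.
(* From y/(k+1) <= e^(y/(k+1)), raised to the power k+1. Using k+1 instead of k keeps the divisor
   nonzero; y^k is at most y^(k+1) for y > 1, and y <= 1 is treated apart with the bound 1. *)
have B : y ^+ k.+1 * expR (- y) <= k.+1%:R ^+ k.+1.
  have h : y / k.+1%:R <= expR (y / k.+1%:R).
    by apply: le_trans (expR_ge1Dx _); rewrite lerDr.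
  have h2 : (y / k.+1%:R) ^+ k.+1 <= expR y.
    have -> : expR y = expR (y / k.+1%:R) ^+ k.+1.
      by rewrite -expRM_natl mulrC divfK // gt_eqF.
    by rewrite lerXn2r ?nnegrE ?expR_ge0 // divr_ge0 // ltW.
  rewrite expRN ler_pdivrMr ?expR_gt0 //.
  move: h2; rewrite exprMn exprVn ler_pdivrMr ?exprn_gt0 //.
  by rewrite [expR y * _]mulrC.
have [y1|y1] := leP y 1.
  apply: (@le_trans _ _ 1); last by rewrite lerDl exprn_ge0.
  rewrite mulr_ile1 ?expR_ge0 //.
    by rewrite exprn_ile1 // ltW.
  by rewrite -expR0 ler_expR oppr_le0 ltW.
apply: (@le_trans _ _ (y ^+ k.+1 * expR (- y))).
  by rewrite ler_wpM2r ?expR_ge0 // ler_weXn2l // ltW.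
by apply: le_trans B _; rewrite lerDr.
Qed.

Lemma is_derive_quad (f : R -> R) (x c M : R) :
  (forall h, `|f (x + h) - f x - h * c| <= M * h ^+ 2) -> is_derive x (1:R) f c.
Proof.
move=> H.
have L : (fun h => h^-1 *: ((f \o shift x) (h *: (1:R)) - f x)) @ 0^' --> c.
  apply/cvgrPdist_le => e e0; near=> h.
  have h0 : h != 0 by near: h; exact: nbhs_dnbhs_neq.
  rewrite /= [h *: 1]mulr1 [h + x]addrC.
  have -> : c - h^-1 *: (f (x + h) - f x) = - h^-1 * (f (x + h) - f x - h * c).
    rewrite -[h^-1 *: _]/(h^-1 * (f (x + h) - f x)); field; exact: h0.
  rewrite normrM normrN normfV mulrC ler_pdivrMr ?normr_gt0 //.
  apply: le_trans (H h) _.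
  have M1 : 0 < `|M| + 1 by rewrite ltr_wpDl.
  rewrite -real_normK ?num_real // expr2 mulrA ler_wpM2r //.
  apply: (@le_trans _ _ ((`|M| + 1) * `|h|)).
    by rewrite ler_wpM2r // (le_trans (ler_norm _)) // lerDl.
  rewrite mulrC -ler_pdivlMr //; near: h.
  by apply: dnbhs0_le; rewrite divr_gt0.
apply: DeriveDef; first by apply/cvg_ex; exists c.
exact: cvg_lim L.
Unshelve. all: by end_near. Qed.

Lemma expinv_derive p t : is_derive t (1:R) (expinv p) (expinv ('X ^+ 2 * (p - p^`())) t).
Proof.
have [t0|t0|->] := ltgtP t 0.
- apply: (@near_eq_is_derive _ _ _ (fun=> 0)).
    near=> s; rewrite /expinv ifF //; apply/negbTE; rewrite -leNgt ltW //.
    by near: s; exact: lt_nbhsl.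
  by rewrite /expinv ltNge (ltW t0) /=; exact: is_derive_cst.
- apply: (@near_eq_is_derive _ _ _ ((fun y => p.[y] * expR (- y)) \o (fun s => s^-1))).
    near=> s; rewrite /expinv /= ifT //.
    by near: s; exact: lt_nbhsr.
  have D1 : is_derive t (1:R) (fun s : R => s^-1) (- t ^- 2 *: 1).
    by apply: (@is_deriveV _ id); rewrite ?gt_eqF.
  have D2 : is_derive (t^-1) (1:R) (fun y => p.[y] * expR (- y))
     (p^`().[t^-1] * expR (- t^-1) - p.[t^-1] * expR (- t^-1)).
    have DN : is_derive (t^-1) (1:R) (expR \o (fun y : R => - y)) (expR (- t^-1) * - 1).
      by apply: is_derive1_comp; exact: is_deriveN.
    apply: (@is_derive_eq _ _ _ _ _ _ _ _ (is_deriveM (is_derive_poly p t^-1) DN)) => /=.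
    rewrite /GRing.scale /=; ring.
  have D := is_derive1_comp D2 D1; apply: (is_derive_eq D).
  rewrite /expinv t0 !hornerE /GRing.scale /= exprVn; ring.
(* With k = 2 and y = 1/h the bound reads |expinv p h| <= C h^2, so the derivative at the gluing
   point 0 is 0. *)
have [C C0 HC] := poly_expR_bound p 2.
rewrite /expinv ltxx; apply: (@is_derive_quad _ _ _ C) => h.
rewrite add0r /expinv ltxx subr0 mulr0 subr0; case: ifP => h0; last first.
  by rewrite normr0 mulr_ge0 // sqr_ge0.
have hi : 0 < h^-1 by rewrite invr_gt0.
have := HC _ hi; rewrite normrM (gtr0_norm (expR_gt0 _)).
by rewrite mulrAC exprVn ler_pdivrMr ?exprn_gt0.
Unshelve. all: by end_near. Qed.

Lemma smooth1_expinv : smooth1 setT (expinv 1).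
Proof.
exists (fun f => exists p, f = expinv p); first by exists 1.
move=> _ [p ->]; exists (expinv ('X ^+ 2 * (p - p^`()))); first by eexists.
by move=> t _; exact: expinv_derive.
Qed.

Lemma expinv1_gt0 t : 0 < t -> 0 < expinv 1 t.
Proof. by move=> t0; rewrite /expinv t0 hornerE mul1r expR_gt0. Qed.

Lemma expinv1_le0 t : t <= 0 -> expinv 1 t = 0.
Proof. by rewrite /expinv ltNge => ->. Qed.

Lemma expinv1_ge0 t : 0 <= expinv 1 t.
Proof. by have [/expinv1_le0->|/expinv1_gt0/ltW] := leP t 0. Qed.

Lemma smooth1_powR (a : R) : smooth1 [set t | 0 < t] (powR (R:=R) ^~ a).
Proof.
exists (fun f => exists c a, f = fun t : R => c * t `^ a).
  by exists 1, a; apply/funext => t; rewrite mul1r.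
move=> _ [c [{}a ->]]; exists (fun t => (c * a) * t `^ (a - 1)); first by eexists; eexists.
move=> t t0; have := @is_deriveZ _ _ _ _ c _ _ _ (is_derive1_powR a t0).
by rewrite -mulrA.
Qed.
End ExpInv.

Section Bumps.
Variables (R : realType) (n : nat).
Local Notation V := 'rV[R]_n.
Implicit Types (f g : V -> R) (x y z : V).

Lemma iderive_cst0 s : iderive s (fun _ : V => 0) = (fun=> 0 : R).
Proof.
elim: s => //= i s ->; apply/funext => x; exact: derive_cst.
Qed.

(** All derivatives vanish on the open exterior of the ball, and on the compact ball they attain a
    maximum. *)
Lemma sch_compact f (r : R) : smooth_on setT f -> (forall x, r < `|x| -> f x = 0) -> sch f.
Proof.
move=> sf f0; split=> // s k.
have oU : open [set x : V | r < `|x|].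
  have -> : [set x : V | r < `|x|] = (fun x => `|x|) @^-1` [set t | r < t] by [].
  by apply: open_comp => [x _|]; [exact: norm_continuous | exact: open_gt].
have d0 x : r < `|x| -> iderive s f x = 0.
  move=> rx; rewrite (@iderive_ext _ _ _ f (fun=> 0) s oU) //.
  by rewrite iderive_cst0.
have [r0|r0] := ltP r 0.
  exists 0 => x; rewrite d0 ?normr0 ?mulr0 //.
  exact: lt_le_trans r0 (normr_ge0 x).
pose K := [set x : V | `|x| <= r].
have cK : compact K.
  apply: bounded_closed_compact.
    exists r; split; first exact: num_real.
    by move=> M rM x /= Kx; exact: le_trans Kx (ltW rM).
  have -> : K = (fun x => `|x|) @^-1` [set t | t <= r] by [].
  by apply: closed_comp => [x _|]; [exact: norm_continuous | exact: closed_le].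
have ci : continuous (fun x => `|iderive s f x|).
  move=> x; apply: (@continuous_comp _ _ _ (iderive s f) (fun t : R => `|t|)).
    exact: (smooth_cont (smooth_iderive s sf)).
  exact: norm_continuous.
have K0 : K !=set0 by exists 0; rewrite /K /= normr0.
have [c _ Hc] := EVT_max_rV K0 cK (continuous_subspaceT ci).
exists ((1 + r) ^+ k * `|iderive s f c|) => x.
have [Kx|rx] := leP `|x| r; last first.
  by rewrite d0 // normr0 mulr0; apply: mulr_ge0 => //; apply: exprn_ge0; exact: addr_ge0.
apply: ler_pM => //.
  by rewrite lerXn2r ?nnegrE ?addr_ge0 // lerD2l.
by apply: Hc; rewrite inE.
Qed.

Definition qf x : R := \sum_(i < n) x ord0 i ^+ 2.

Lemma smooth_qf U : open U -> smooth_on U qf.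
Proof.
move=> oU; apply: (smooth_sum _ oU) => i.
apply: (@smoothM _ _ _ (fun x : V => x ord0 i) (fun x : V => x ord0 i)) => //;
  exact: smooth_coord.
Qed.

Lemma qf_ge0 x : 0 <= qf x. Proof. by apply: sumr_ge0 => i _; exact: sqr_ge0. Qed.

Lemma enorm_sqr x : enorm x ^+ 2 = qf x. Proof. by rewrite sqr_sqrtr // qf_ge0. Qed.

Lemma qfZ (c : R) x : qf (c *: x) = c ^+ 2 * qf x.
Proof. by rewrite /qf mulr_sumr; apply: eq_bigr => i _; rewrite mxE exprMn. Qed.

Lemma enormZ (c : R) x : enorm (c *: x) = `|c| * enorm x.
Proof. by rewrite /enorm -/(qf _) qfZ sqrtrM ?sqr_ge0 // sqrtr_sqr. Qed.

Lemma enormN x : enorm (- x) = enorm x.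
Proof. by rewrite -scaleN1r enormZ normrN normr1 mul1r. Qed.

Lemma enorm_eq0 x : (enorm x == 0) = (x == 0).
Proof.
apply/eqP/eqP => [E|->]; last by rewrite /enorm big1 ?sqrtr0 // => i _; rewrite mxE expr0n.
by apply/eqP; rewrite -normr_le0 -E norm_le_enorm.
Qed.

Lemma enorm_gt0 x : (0 < enorm x) = (x != 0).
Proof. by rewrite lt_def enorm_ge0 andbT enorm_eq0. Qed.

Lemma qf_gt0 x : x != 0 -> 0 < qf x.
Proof. by move=> x0; rewrite -enorm_sqr exprn_gt0 // enorm_gt0. Qed.

Lemma sphere_neq0 x : sphere x -> x != 0.
Proof. by rewrite /sphere /= => E; rewrite -enorm_gt0 E. Qed.

Lemma sphere_normalize x : x != 0 -> sphere (normalize x).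
Proof.
move=> x0; rewrite /sphere /normalize /= enormZ gtr0_norm ?invr_gt0 ?enorm_gt0 //.
by rewrite mulVf // gt_eqF // enorm_gt0.
Qed.

Lemma normalize_sphere x : sphere x -> normalize x = x.
Proof. by rewrite /sphere /normalize /= => ->; rewrite invr1 scale1r. Qed.

Lemma normalizeZ (c : R) x : 0 < c -> normalize (c *: x) = normalize x.
Proof.
move=> c0; have [->|x0] := eqVneq x 0; first by rewrite scaler0.
rewrite /normalize enormZ gtr0_norm // scalerA; congr (_ *: _).
by field; rewrite !gt_eqF // enorm_gt0.
Qed.

Lemma normalizeN x : normalize (- x) = - normalize x.
Proof. by rewrite /normalize enormN scalerN. Qed.

Lemma normalizeE x : enorm x *: normalize x = x.
Proof.
have [->|x0] := eqVneq x 0; first by rewrite /normalize !scaler0.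
by rewrite scalerA mulfV ?scale1r // gt_eqF // enorm_gt0.
Qed.

Lemma smooth_comp_qf U I (phi : R -> R) (a b : R) : open U -> smooth1 I phi ->
  (forall x, U x -> I (a * qf x + b)) -> smooth_on U (fun x => phi (a * qf x + b)).
Proof.
move=> oU sphi UI; apply: (@smooth_comp1 _ _ _ I (fun x => a * qf x + b)) => //.
apply: smoothD => //; last exact: smooth_cst.
by apply: (smoothM (f := fun=> a)) => //; [exact: smooth_cst | exact: smooth_qf].
Qed.

(** Writing |x|^s as (|x|^2)^(s/2) composes a power on t > 0 with a polynomial, and no square root
    is differentiated. *)
Lemma smooth_powR_enorm (s : R) : smooth_on [set x : V | x != 0] (fun x => enorm x `^ s).
Proof.
have oU := @open_neq0 R n.
apply: (@smooth_ext _ _ _ (fun x => (1 * qf x + 0) `^ (s / 2))) => //.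
  move=> x x0; rewrite mul1r addr0 -enorm_sqr -powR_mulrn ?enorm_ge0 // -powRrM.
  by congr (_ `^ _); field.
apply: (@smooth_comp_qf _ [set t | 0 < t] (fun t => t `^ (s / 2))) => //.
  exact: smooth1_powR.
by move=> x x0 /=; rewrite mul1r addr0 qf_gt0.
Qed.

(* Supported in the annulus 1/2 <= |x| <= 2. *)
Definition shell x : R := expinv 1 (4 * qf x + - 1) * expinv 1 (- 1 * qf x + 4).

(** Unlike [shell], positive at the origin: this is the bump from which the inversion constant is
    derived. *)
Definition ballbump x : R := expinv 1 (- 1 * qf x + 4).

Lemma smooth_ballbump : smooth_on setT ballbump.
Proof. by apply: (smooth_comp_qf openT (smooth1_expinv R)). Qed.

Lemma smooth_shell : smooth_on setT shell.
Proof.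
apply: (smoothM (f := fun x => expinv 1 (4 * qf x + - 1))); first exact: openT.
  by apply: (smooth_comp_qf openT (smooth1_expinv R)).
exact: smooth_ballbump.
Qed.

Lemma ballbump_out x : 2 < `|x| -> ballbump x = 0.
Proof.
move=> x2; apply: expinv1_le0; rewrite -enorm_sqr.
have := norm_le_enorm x; nra.
Qed.

Lemma shell_out x : 2 < `|x| -> shell x = 0.
Proof. by move=> /ballbump_out; rewrite /shell /ballbump => ->; rewrite mulr0. Qed.

Lemma shell_in x : qf x < 4^-1 -> shell x = 0.
Proof. by move=> qx; rewrite /shell (@expinv1_le0 _ (4 * qf x + - 1)) ?mul0r //; lra. Qed.

Lemma shell_ge0 x : 0 <= shell x.
Proof. by rewrite mulr_ge0 // expinv1_ge0. Qed.

Lemma shell_sphere x : sphere x -> 0 < shell x.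
Proof.
move=> sx; rewrite /shell -enorm_sqr sx expr1n.
by rewrite mulr_gt0 // expinv1_gt0 //; lra.
Qed.

Lemma qfN x : qf (- x) = qf x.
Proof. by rewrite -scaleN1r qfZ sqrrN expr1n mul1r. Qed.

Lemma shellN x : shell (- x) = shell x. Proof. by rewrite /shell qfN. Qed.

Lemma sch_ballbump : sch ballbump.
Proof. exact: sch_compact smooth_ballbump ballbump_out. Qed.

Lemma bump_gaussian : exists g, [/\ sch g, even_fun g, forall x, 0 <= g x & 0 < g 0].
Proof.
exists ballbump; split.
- exact: sch_ballbump.
- by move=> x; rewrite /ballbump qfN.
- by move=> x; exact: expinv1_ge0.
- apply: expinv1_gt0; rewrite /qf big1 ?mulr0 ?add0r // => i _.
  by rewrite mxE expr0n.
Qed.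

(** Near the origin the shell is identically 0, so the singularity of f there is invisible. *)
Lemma smooth_mul_shell f : smooth_on [set x : V | x != 0] f ->
  smooth_on setT (fun x => f x * shell x).
Proof.
move=> sf s x _.
have [->|x0] := eqVneq x 0; last first.
  apply: (smoothM (@open_neq0 R n) sf) => //.
  exact: smooth_sub smooth_shell.
have oU : open [set x : V | qf x < 4^-1].
  have -> : [set x : V | qf x < 4^-1] = qf @^-1` [set t | t < 4^-1] by [].
  apply: open_comp => [y _|]; last exact: open_lt.
  exact: (smooth_cont (smooth_qf openT)).
have U0 : [set x : V | qf x < 4^-1] 0.
  by rewrite /= /qf big1 ?invr_gt0 // => i _; rewrite mxE expr0n.
apply: (@smooth_ext _ _ [set x : V | qf x < 4^-1] (fun=> 0)) => //.
  by move=> y /= qy; rewrite shell_in ?mulr0.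
exact: smooth_cst.
Qed.

Lemma sch_mul_shell f : smooth_on [set x : V | x != 0] f -> sch (fun x => f x * shell x).
Proof.
move=> sf; apply: (sch_compact (r := 2) (smooth_mul_shell sf)) => x x2.
by rewrite shell_out ?mulr0.
Qed.

Lemma Ce_inf_sch f : Ce_inf f -> sch (fun x => f (normalize x) * shell x).
Proof. by case=> sf _; exact: sch_mul_shell. Qed.

Lemma sphere_compact : compact (@sphere R n).
Proof.
apply: bounded_closed_compact.
  exists 1; split; first exact: num_real.
  by move=> M rM x /= Kx; rewrite (le_trans (norm_le_enorm x)) // Kx ltW.
have -> : @sphere R n = qf @^-1` [set 1].
  apply/seteqP; split=> x; rewrite /sphere /= -enorm_sqr.
    by move=> ->; rewrite expr1n.
  move=> /eqP; rewrite sqrf_eq1 => /orP[/eqP//|/eqP E].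
  by have := enorm_ge0 x; rewrite E; lra.
apply: closed_comp => [x _|]; last by apply: accessible_closed_set1; apply: hausdorff_accessible; exact: norm_hausdorff.
exact: (smooth_cont (smooth_qf openT)).
Qed.

Lemma Ce_inf_cont f : Ce_inf f -> forall x, x != 0 -> {for x, continuous (fun x => f (normalize x))}.
Proof. by case=> sf _ x x0; exact: (smooth_cont sf). Qed.

Lemma Ce_inf_bound f : Ce_inf f -> exists2 M, 0 <= M & forall x, `|f (normalize x)| <= M.
Proof.
move=> Cf; have [E0|/set0P[x0 sx0]] := eqVneq (@sphere R n) set0; last first.
  have S0 : @sphere R n !=set0 by exists x0.
  have cw : {within @sphere R n, continuous (fun x => `|f (normalize x)|)}.
    apply: continuous_in_subspaceT => x; rewrite inE => sx.
    apply: (@continuous_comp _ _ _ (fun x => f (normalize x)) (fun t : R => `|t|)).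
      by apply: Ce_inf_cont => //; exact: sphere_neq0.
    exact: norm_continuous.
  have [c _ Hc] := EVT_max_rV S0 sphere_compact cw.
  (* The term [|f 0|] pays for x = 0, where [normalize] returns 0, a point off the sphere. *)
  exists (`|f (normalize c)| + `|f 0|); first by rewrite addr_ge0.
  move=> x; have [->|xn0] := eqVneq x 0.
    by rewrite /normalize scaler0 lerDr.
  have sx := sphere_normalize xn0.
  have := Hc (normalize x); rewrite inE => /(_ sx).
  by rewrite normalize_sphere // => /le_trans; apply; rewrite lerDl.
exists `|f 0| => // x; have [->|xn0] := eqVneq x 0.
  by rewrite /normalize scaler0.
by have := sphere_normalize xn0; rewrite E0.
Qed.

End Bumps.

(** * Mellin integrals and homogeneous distributions *)

Section Mellin.
Variables (R : realType) (n : nat).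
Local Notation V := 'rV[R]_n.
Local Notation mu := (lebRn R n).
Local Notation B := (borelRn R n).
Local Notation leb := (@lebesgue_measure R).
Implicit Types (f g Phi Psi : V -> R) (x y : V) (s u : R).

Lemma itg_leb_shift a (f : R -> R) : itg leb f -> itg leb (fun u => f (u + a)).
Proof.
move=> /(leb_transport a (oner_neq0 R))[+ _].
by under [X in itg _ X -> _]eq_fun do rewrite mul1r.
Qed.

Lemma Rint_leb_shift a (f : R -> R) : itg leb f -> \int[leb]_u f (u + a) = \int[leb]_u f u.
Proof.
move=> /(leb_transport a (oner_neq0 R))[_]; rewrite normr1 invr1 mul1r => <-.
by apply: eq_Rintegral => u _; rewrite mul1r.
Qed.

Lemma Rint_lebN (f : R -> R) : itg leb f -> \int[leb]_u f (- u) = \int[leb]_u f u.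
Proof.
have N1 : (-1 : R) != 0 by rewrite oppr_eq0 oner_eq0.
move=> /(leb_transport 0 N1)[_]; rewrite normrN1 invr1 mul1r => <-.
by apply: eq_Rintegral => u _; rewrite mulN1r addr0.
Qed.

(** Comparison with 1/(1 + u^2): squaring e^v >= 1 + v at v = c|u|/2 gives e^(c|u|) >= 1 + c^2
    u^2/4, whence the constant 1 + 4/c^2. *)
Lemma itg_expabs (c : R) : 0 < c -> itg leb (fun u => expR (- (c * `|u|))).
Proof.
move=> c0; apply: (itg_le (itgZ (1 + 4 / c ^+ 2) (@integrable_inv1sqr R))).
  apply: continuous_measurable_fun => u.
  apply: (@continuous_comp _ _ _ (fun u : R => - (c * `|u|)) expR); last exact: continuous_expR.
  apply: (@continuousN _ _ _ (fun u : R => c * `|u|)).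
  apply: (@continuousM _ _ (fun=> c) (fun u : R => `|u|)); first exact: cst_continuous.
  exact: norm_continuous.
move=> u; rewrite ger0_norm ?expR_ge0 // expRN ler_pdivlMr; last by rewrite ltr_pwDl // sqr_ge0.
have h0 : 0 <= c * `|u| / 2 by rewrite divr_ge0 // mulr_ge0 // ltW.
have h1 : (1 + c * `|u| / 2) ^+ 2 <= expR (c * `|u|).
  have -> : expR (c * `|u|) = expR (c * `|u| / 2) ^+ 2.
    by rewrite -expRM_natl; congr expR; field.
  by rewrite lerXn2r ?nnegrE ?addr_ge0 ?expR_ge0 // expR_ge1Dx.
have h2 : 1 + (c * `|u| / 2) ^+ 2 <= expR (c * `|u|).
  apply: le_trans h1; rewrite sqrrD expr1n mul1r -addrA lerD2l lerDr.
  by rewrite mulrn_wge0.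
rewrite mulrC ler_pdivrMr ?expR_gt0 //.
have c2 : 0 < c ^+ 2 by rewrite exprn_gt0.
apply: (@le_trans _ _ ((1 + 4 / c ^+ 2) * (1 + (c * `|u| / 2) ^+ 2))); last first.
  by rewrite ler_wpM2l // addr_ge0 // divr_ge0 // ltW.
have -> : (1 + 4 / c ^+ 2) * (1 + (c * `|u| / 2) ^+ 2) =
   1 + `|u| ^+ 2 + (4 / c ^+ 2 + (c * `|u| / 2) ^+ 2) by field; rewrite gt_eqF.
rewrite real_normK ?num_real // lerDl; apply: addr_ge0; last exact: sqr_ge0.
by apply: divr_ge0 => //; exact: ltW.
Qed.

(** For u <= 0 the factor e^(su) decays by itself; for u > 0 the weight contributes rho^(-k)
    e^(-ku). The two constants 1 and rho^(-k) are added, and the smaller of the two rates is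
    kept. *)
Lemma mel_dom s (k : nat) (rho : R) u : 0 < s < k%:R -> 0 < rho ->
  expR (s * u) * (1 + expR u * rho) ^- k <=
  (1 + rho ^- k) * expR (- (Num.min s (k%:R - s) * `|u|)).
Proof.
move=> /andP[s0 sk] r0; set c := Num.min _ _.
have e0 : 0 < expR u * rho by rewrite mulr_gt0 // expR_gt0.
have w0 : 0 < 1 + expR u * rho by rewrite addr_gt0.
have cs : c <= s by rewrite ge_min lexx.
have ck : c <= k%:R - s by rewrite ge_min lexx orbT.
have rk0 : 0 <= rho ^- k by rewrite invr_ge0 exprn_ge0 // ltW.
rewrite mulrDl mul1r; have [u0|u0] := leP u 0.
  rewrite -[leLHS]addr0 lerD //; last by rewrite mulr_ge0 // expR_ge0.
  apply: (@le_trans _ _ (expR (s * u))).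
    rewrite ler_piMr ?expR_ge0 // invf_le1 ?exprn_gt0 //.
    by rewrite exprn_ege1 // lerDl ltW.
  rewrite ler_expR (ler0_norm u0) mulrN opprK.
  by rewrite ler_wnM2r.
rewrite -[leLHS]add0r lerD ?expR_ge0 //.
apply: (@le_trans _ _ (expR (s * u) * (expR u * rho) ^- k)).
  rewrite ler_wpM2l ?expR_ge0 // lef_pV2 ?posrE ?exprn_gt0 //.
  by rewrite lerXn2r ?nnegrE ?ltW // ltrDr.
rewrite exprMn invfM mulrA mulrC ler_wpM2l //.
rewrite -expRM_natl -expRN -expRD ler_expR (gtr0_norm u0).
have : c * u <= (k%:R - s) * u by rewrite ler_wpM2r // ltW.
lra.
Qed.

(** With r = e^u this is the integral of Phi(r x) r^(s-1) dr over r > 0. In the logarithmic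
    variable, dilating x is a translation and inverting r is u -> -u. *)
Definition mel s Phi x := \int[leb]_u (Phi (expR u *: x) * expR (s * u)).

Lemma dil_cont x : continuous (fun u : R => expR u *: x).
Proof.
move=> u; apply: (@continuousZ _ _ _ (@expR R) (fun=> x)); last exact: cst_continuous.
exact: continuous_expR.
Qed.

Lemma measurable_expM s : measurable_fun setT (fun u : measurableTypeR R => expR (s * u)).
Proof. by apply: measurableT_comp => //; exact: measurable_funM. Qed.

Lemma measurable_dil Phi x : continuous Phi ->
  measurable_fun setT (fun u : measurableTypeR R => Phi (expR u *: x)).
Proof.
move=> cP; apply: continuous_measurable_fun => u.
by apply: (@continuous_comp _ _ _ (fun u : R => expR u *: x) Phi); [exact: dil_cont | exact: cP].
Qed.

Lemma exists_nat_gt s : exists k : nat, s < k%:R.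
Proof.
exists (Num.truncn `|s|).+1; apply: le_lt_trans (ler_norm s) _.
exact: truncnS_gt.
Qed.

Lemma min_gt0 s (k : nat) : 0 < s < k%:R -> 0 < Num.min s (k%:R - s).
Proof. by move=> /andP[s0 sk]; rewrite lt_min s0 subr_gt0. Qed.

Lemma itg_mel s Phi x : 0 < s -> sch Phi -> x != 0 ->
  itg leb (fun u => Phi (expR u *: x) * expR (s * u)).
Proof.
move=> s0 sP x0; have [k sk] := exists_nat_gt s.
have ssk : 0 < s < k%:R by rewrite s0.
have [C C0 HC] := sch_bound k sP.
apply: (itg_le (itgZ (C * (1 + `|x| ^- k)) (itg_expabs (min_gt0 ssk)))).
  by apply: measurable_funM; [apply: measurable_dil; exact: sch_cont | exact: measurable_expM].
move=> u; rewrite normrM (gtr0_norm (expR_gt0 _)).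
apply: (@le_trans _ _ (C * (expR (s * u) * (1 + expR u * `|x|) ^- k))).
  rewrite [expR (s * u) * _]mulrC mulrA ler_wpM2r ?expR_ge0 //.
  by apply: le_trans (HC _) _; rewrite normrZ (gtr0_norm (expR_gt0 _)).
by rewrite -mulrA ler_wpM2l // mel_dom // normr_gt0.
Qed.

(** At e^u x the step is e^u h: the linear term raises s to s + 1, and the quadratic remainder
    brings e^(2u), which is why the order of decay k must exceed s + 2. *)
Lemma mel_diff s Phi x : 0 < s -> sch Phi -> x != 0 ->
  differentiable (mel s Phi) x /\ forall i, pderiv i (mel s Phi) x = mel (s + 1) (pderiv i Phi) x.
Proof.
(* For |h| < |x|/2 the segment from x to x + h stays at distance at least |x|/2 from the origin. *)
move=> s0 sP x0; have x1 : 0 < `|x| / 2 by rewrite divr_gt0 // normr_gt0.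
have s1 : 0 < s + 1 by rewrite addr_gt0.
have s2 : 0 < s + 2 by rewrite addr_gt0.
have [k sk] := exists_nat_gt (s + 2).
have ssk : 0 < s + 2 < k%:R by rewrite s2.
have [C C0 HC] := sch_taylor k sP.
have iE := itg_expabs (min_gt0 ssk).
pose M := \int[leb]_u ((C * (1 + (`|x| / 2) ^- k)) * expR (- (Num.min (s + 2) (k%:R - (s + 2)) * `|u|))).
apply: (@diff_expand _ _ (mel s Phi) x _ M _ x1) => h hx.
have xh0 : x + h != 0.
  apply/eqP => E; move: hx; rewrite ltNge => /negP; apply.
  have -> : h = - x by apply/eqP; rewrite -addr_eq0 addrC E.
  by rewrite normrN ler_piMr // invf_le1 // ler1n.
have i0 := itg_mel s0 sP x0; have ih := itg_mel s0 sP xh0.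
have ii i := itg_mel s1 (sch_pderiv i sP) x0.
have -> : \sum_(i < n) h ord0 i * mel (s + 1) (pderiv i Phi) x =
    \int[leb]_u \sum_(i < n) h ord0 i * (pderiv i Phi (expR u *: x) * expR ((s + 1) * u)).
  rewrite Rint_sum; last by move=> i; exact: itgZ.
  by apply: eq_bigr => i _; rewrite RintZ.
have iS : itg leb (fun u => \sum_(i < n) h ord0 i * (pderiv i Phi (expR u *: x) * expR ((s + 1) * u))).
  by apply: itg_sum => i; exact: itgZ.
rewrite /mel -(RintB ih i0) -(RintB (itgB ih i0) iS) /M mulrC -(RintZ _ (itgZ _ iE)).
apply: Rint_norm_le.
- exact: (itgB (itgB ih i0) iS).
- exact: itgZ (itgZ _ iE).
move=> u; have eu := expR_gt0 u; pose e := expR u.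
have := HC (e *: x) (e *: h) (1 + e * (`|x| / 2)).
have r0 : 0 < 1 + e * (`|x| / 2) by rewrite addr_gt0 // mulr_gt0.
move=> /(_ r0) H.
have seg t : 0 <= t <= 1 -> 1 + e * (`|x| / 2) <= 1 + `|e *: x + t *: (e *: h)|.
  move=> /andP[t0 t1]; rewrite lerD2l.
  have -> : e *: x + t *: (e *: h) = e *: (x + t *: h).
    by rewrite scalerDr !scalerA [t * e]mulrC.
  rewrite normrZ (gtr0_norm eu) ler_wpM2l ?ltW //.
  have n1 : `|x| <= `|x + t *: h| + `|t *: h| by rewrite -{1}(addrK (t *: h) x) ler_normB.
  have n2 : `|t *: h| <= `|h| by rewrite normrZ (ger0_norm t0) ler_piMl.
  lra.
have {}H := H seg.
have -> : Phi (expR u *: (x + h)) * expR (s * u) - Phi (expR u *: x) * expR (s * u) -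
   \sum_(i < n) h ord0 i * (pderiv i Phi (expR u *: x) * expR ((s + 1) * u)) =
   expR (s * u) * (Phi (e *: x + e *: h) - Phi (e *: x) -
     \sum_(i < n) (e *: h) ord0 i * pderiv i Phi (e *: x)).
  rewrite scalerDr !mulrBr mulr_sumr [expR (s * u) * Phi _]mulrC [expR (s * u) * Phi _]mulrC.
  congr (_ - _ - _); apply: eq_bigr => i _.
  have -> : expR ((s + 1) * u) = expR (s * u) * expR u by rewrite mulrDl mul1r expRD.
  have -> : (e *: h) ord0 i = expR u * h ord0 i by rewrite mxE.
  by rewrite -/e; ring.
rewrite normrM (gtr0_norm (expR_gt0 _)).
apply: (@le_trans _ _ (expR (s * u) * (C / (1 + e * (`|x| / 2)) ^+ k * `|e *: h| ^+ 2))).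
  by rewrite ler_wpM2l ?expR_ge0.
rewrite normrZ (gtr0_norm eu) exprMn.
have E2 : expR (s * u) * e ^+ 2 = expR ((s + 2) * u) by rewrite mulrDl expRD expRM_natl.
rewrite [leLHS](_ : _ = `|h| ^+ 2 * (C * (expR ((s + 2) * u) * (1 + e * (`|x| / 2)) ^- k))); last first.
  by rewrite -E2 /e; ring.
rewrite ler_wpM2l ?sqr_ge0 // -mulrA ler_wpM2l // mel_dom //.
Qed.

End Mellin.

Section MellinHomogeneous.
Variables (R : realType) (n : nat).
Local Notation V := 'rV[R]_n.
Local Notation mu := (lebRn R n).
Local Notation B := (borelRn R n).
Local Notation leb := (@lebesgue_measure R).
Implicit Types (f g Phi Psi : V -> R) (x y : V) (s u : R).

Lemma mel_smooth s Phi : 0 < s -> sch Phi -> smooth_on [set x : V | x != 0] (mel s Phi).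
Proof.
move=> s0 sP; pose P h := exists s Phi, [/\ 0 < s, sch Phi & h = @mel R n s Phi].
apply: (@smooth_classP _ _ _ P _ (@open_neq0 R n)); last by exists s, Phi.
move=> _ [{s0}s [{sP}Phi [s0 sP ->]]]; split=> [x x0|i]; first exact: (mel_diff s0 sP x0).1.
exists (mel (s + 1) (pderiv i Phi)).
  by exists (s + 1), (pderiv i Phi); split; [rewrite addr_gt0|exact: sch_pderiv|].
by move=> x x0; exact: (mel_diff s0 sP x0).2.
Qed.

(** Dilation by r is the translation of u by ln r. *)
Lemma mel_homog s Phi (r : R) x : 0 < s -> sch Phi -> x != 0 -> 0 < r ->
  mel s Phi (r *: x) = r `^ (- s) * mel s Phi x.
Proof.
move=> s0 sP x0 r0; have ix := itg_mel s0 sP x0.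
rewrite /mel -(Rint_leb_shift (ln r) ix) -(RintZ _ (itg_leb_shift (ln r) ix)).
apply: eq_Rintegral => u _.
rewrite scalerA expRD lnK ?posrE // mulrCA; congr (_ * _).
rewrite /powR gt_eqF // -expRD; congr expR; ring.
Qed.

Lemma mel_normalize s Phi x : 0 < s -> sch Phi -> x != 0 ->
  mel s Phi x = enorm x `^ (- s) * mel s Phi (normalize x).
Proof.
move=> s0 sP x0; rewrite -{1}(normalizeE x) mel_homog // ?enorm_gt0 //.
exact/sphere_neq0/sphere_normalize.
Qed.

Lemma mel_normalize' s Phi x : 0 < s -> sch Phi -> x != 0 ->
  mel s Phi (normalize x) = enorm x `^ s * mel s Phi x.
Proof.
move=> s0 sP x0; rewrite (mel_normalize s0 sP x0) mulrA -powRD; last first.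
  by apply/implyP => _; rewrite enorm_eq0.
by rewrite subrr powRr0 mul1r.
Qed.

Lemma mel_even s Phi x : even_fun Phi -> mel s Phi (- x) = mel s Phi x.
Proof. by move=> eP; apply: eq_Rintegral => u _; rewrite scalerN eP. Qed.

Lemma Ce_inf_mel s Phi : 0 < s -> sch Phi -> even_fun Phi -> Ce_inf (mel s Phi).
Proof.
move=> s0 sP eP; split; last by move=> x _; exact: mel_even.
have oU := @open_neq0 R n.
apply: (@smooth_ext _ _ _ ((fun x => enorm x `^ s) \* mel s Phi)) => //.
  by move=> x x0 /=; rewrite mel_normalize'.
by apply: smoothM => //; [exact: smooth_powR_enorm | exact: mel_smooth].
Qed.

Lemma mel_ge0 s Phi x : (forall y, 0 <= Phi y) -> 0 <= mel s Phi x.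
Proof.
by move=> P0; apply: Rintegral_ge0 => u _; rewrite mulr_ge0 // expR_ge0.
Qed.

(** Joint continuity gives Borel measurability on R^(n+1), and the measurable map [rowm] carries it
    to the product sigma-algebra on which Fubini operates. *)
Lemma measurable_dil2 :
  measurable_fun setT (fun z : B * measurableTypeR R => expR z.2 *: (z.1 : V) : B).
Proof.
pose D (w : 'rV[R]_n.+1) : V := expR (unrow (w : borelRn R n.+1)).1 *: (unrow (w : borelRn R n.+1)).2.
have cD : continuous D.
  move=> w; apply: (@continuousZ _ _ _ (fun w : 'rV[R]_n.+1 => expR (w ord0 ord0))
    (fun w : 'rV[R]_n.+1 => (unrow (w : borelRn R n.+1)).2 : V)); last exact: continuous_unrow2.
  apply: (@continuous_comp _ _ _ (fun w : 'rV[R]_n.+1 => w ord0 ord0) (@expR R)).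
    exact: coord_continuous.
  exact: continuous_expR.
have mD : measurable_fun setT (D : borelRn R n.+1 -> B).
  apply: (@measurability _ _ (borelRn R n.+1) B setT D (@open 'rV[R]_n) erefl) => _ [U oU <-].
  rewrite setTI; apply: open_measurableB.
  by move/continuousP: cD; exact.
have -> : (fun z : B * measurableTypeR R => expR z.2 *: (z.1 : V) : B) =
    (D : borelRn R n.+1 -> B) \o @rowm R n \o (fun z => (z.2, z.1)).
  by apply/funext => z; rewrite /D /comp (rowmK (z.2, z.1)).
apply: measurableT_comp; last exact: measurable_swap.
by apply: (measurableT_comp mD); exact: measurable_rowm'.
Qed.

Lemma measurable_dilM (H W : V -> R) s : measurable_fun setT (H : B -> R) ->
  measurable_fun setT (W : B -> R) ->
  measurable_fun setT (fun z : B * measurableTypeR R =>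
    H (expR z.2 *: (z.1 : V)) * W z.1 * expR (s * z.2)).
Proof.
move=> mH mW; apply: measurable_funM; last first.
  by apply: (measurableT_comp (measurable_expM s)); exact: measurable_snd.
apply: measurable_funM; first exact: (measurableT_comp mH measurable_dil2).
exact: (measurableT_comp mW measurable_fst).
Qed.

Lemma measurable_sch Phi : sch Phi -> measurable_fun setT (Phi : B -> R).
Proof. by move=> sP; apply: continuous_measurableB; exact: sch_cont. Qed.

(** Two bounds for the integral over x: bounded Phi against integrable Psi gives e^(su), good for u
    <= 0; bounded Psi against the dilated Phi gives e^((s-n)u), good for u > 0. This is where 0 < s
    < n enters. *)
Lemma itg_mel_prod s Phi Psi (C : R) : 0 < s < n%:R -> sch Phi -> itg mu Psi ->
  (forall x, `|Psi x| <= C) ->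
  itg (mu \x leb)%E (fun z : B * measurableTypeR R =>
    Phi (expR z.2 *: (z.1 : V)) * Psi z.1 * expR (s * z.2)).
Proof.
move=> sn sP iPsi PC.
have mPsi := itg_meas iPsi.
have mF := measurable_dilM s (measurable_sch sP) mPsi.
apply/(integrable21ltyP mu leb).
  exact/measurable_EFinP.
have [D D0 HD] := sch_bound 0 sP.
have iPhi := itg_sch sP.
pose A := \int[mu]_x `|Phi x|; pose A' := \int[mu]_x `|Psi x|.
have A0 : 0 <= A by exact: Rintegral_ge0.
have A'0 : 0 <= A' by exact: Rintegral_ge0.
have C0 : 0 <= C by apply: le_trans (PC 0).
pose c := Num.min s (n%:R - s).
have iE := itg_expabs (min_gt0 sn).
have iE2 := itgZ (D * A' + C * A) iE.
have /integrableP[_] := iE2; apply: le_lt_trans.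
apply: ge0_le_integral => //.
- by move=> u _; exact: integral_ge0.
- apply: (measurable_fun_fubini_tonelli_G (fun z : B * measurableTypeR R =>
    `|(Phi (expR z.2 *: (z.1 : V)) * Psi z.1 * expR (s * z.2))%:E|)%E) => //.
  by apply: (measurableT_comp (f := abse)) => //; exact/measurable_EFinP.
- by apply: (measurableT_comp (f := abse)) => //; apply/measurable_EFinP; exact: itg_meas iE2.
move=> u _ /=; have eu := expR_gt0 u.
have K0 : 0 <= D * A' + C * A by rewrite addr_ge0 // mulr_ge0.
rewrite [X in (_ <= X%:E)%E]ger0_norm; last by rewrite mulr_ge0 ?expR_ge0.
have iPu : itg mu (fun x : B => Phi (expR u *: (x : V))) by exact: itg_scale.
have iu : itg mu (fun x : B => Phi (expR u *: (x : V)) * Psi x * expR (s * u)).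
  have := itgZ (expR (s * u)) (itg_mulb iPu mPsi PC).
  by congr (itg _ _); apply/funext => x; rewrite mulrC.
have -> : (\int[mu]_x `|Phi (expR u *: (x : V)) * Psi x * expR (s * u)|%:E =
   (\int[mu]_x `|Phi (expR u *: (x : V)) * Psi x * expR (s * u)|)%:E)%E.
  rewrite /Rintegral fineK //; apply: integrable_fin_num => //.
  exact: (itg_norm iu).
rewrite lee_fin.
have b1 : \int[mu]_x `|Phi (expR u *: (x : V)) * Psi x * expR (s * u)| <= D * A' * expR (s * u).
  have iB := itgZ (D * expR (s * u)) (itg_norm iPsi).
  rewrite mulrAC /A' -(RintZ _ (itg_norm iPsi)).
  apply: Rint_le => //; first exact: itg_norm.
  move=> x; rewrite !normrM (gtr0_norm (expR_gt0 _)) mulrAC ler_wpM2r //.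
  by rewrite ler_wpM2r ?expR_ge0 // (le_trans (HD _)) // expr0 divr1.
have b2 : \int[mu]_x `|Phi (expR u *: (x : V)) * Psi x * expR (s * u)| <=
    C * A * expR ((s - n%:R) * u).
  have iN : itg mu (fun x : B => `|Phi (expR u *: (x : V))|) by exact: itg_norm.
  have E : A * expR ((s - n%:R) * u) = expR (s * u) * \int[mu]_x `|Phi (expR u *: (x : V))|.
    rewrite (Rint_scale eu (f := fun x => `|Phi x|)); last exact: itg_norm.
    rewrite mulrA mulrC -/A; congr (_ * _).
    by rewrite mulrBl expRD expRN expRM_natl.
  rewrite -mulrA E mulrA -(RintZ _ iN).
  apply: Rint_le => //; first exact: itg_norm.
    exact: itgZ.
  move=> x; rewrite !normrM (gtr0_norm (expR_gt0 _)).
  rewrite [leRHS](_ : _ = `|Phi (expR u *: (x : V))| * C * expR (s * u)); last by ring.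
  by rewrite ler_wpM2r ?expR_ge0 // ler_wpM2l.
case/andP: sn => s0 sn.
have cs : c <= s by rewrite ge_min lexx.
have ck : c <= n%:R - s by rewrite ge_min lexx orbT.
have [u0|u0] := leP u 0.
  apply: le_trans b1 _; rewrite mulrDl -[leLHS]addr0 lerD //; last first.
    by rewrite mulr_ge0 ?expR_ge0 // mulr_ge0.
  rewrite ler_wpM2l ?mulr_ge0 // ler_expR (ler0_norm u0) mulrN opprK.
  by rewrite ler_wnM2r.
apply: le_trans b2 _; rewrite [leRHS]mulrDl -[leLHS]add0r lerD //.
  by rewrite mulr_ge0 ?expR_ge0 // mulr_ge0.
rewrite ler_wpM2l ?mulr_ge0 // ler_expR (gtr0_norm u0).
have : c * u <= (n%:R - s) * u by rewrite ler_wpM2r // ltW.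
rewrite /c; lra.
Qed.

End MellinHomogeneous.

Section FubiniIntegrable.
Context d1 d2 (T1 : measurableType d1) (T2 : measurableType d2) (R : realType).
Variables (m1 : {sigma_finite_measure set T1 -> \bar R})
  (m2 : {sigma_finite_measure set T2 -> \bar R}).

Lemma itg_fine d (T : measurableType d) (m : {measure set T -> \bar R}) (g : T -> \bar R) :
  m.-integrable setT g -> itg m (fun x => fine (g x)).
Proof.
move=> gi; apply: (le_integrable measurableT _ _ gi).
  apply/measurable_EFinP; apply: measurableT_comp => //; exact: measurable_int gi.
by move=> x _ /=; case: (g x) => //= *; rewrite leey.
Qed.

Lemma itg_fubini1 (F : T1 * T2 -> R) : itg (m1 \x m2)%E F ->
  itg m1 (fun x => \int[m2]_y F (x, y)).
Proof. by move=> iF; apply: itg_fine; exact: (integrable_fubini_F iF). Qed.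

Lemma itg_fubini2 (F : T1 * T2 -> R) : itg (m1 \x m2)%E F ->
  itg m2 (fun y => \int[m1]_x F (x, y)).
Proof.
move=> iF; apply: itg_fine; have mF := measurable_int _ iF.
apply/integrableP; split; first exact: (measurable_fubini_G iF).
apply: le_lt_trans ((integrable21ltyP m1 m2 mF).1 iF).
apply: ge0_le_integral => //.
- by apply: measurableT_comp => //; exact: (measurable_fubini_G iF).
- apply: (measurable_fun_fubini_tonelli_G (fun z => `|(F z)%:E|)%E) => //.
  exact: (measurableT_comp (f := abse) _ mF).
- move=> y _; apply: le_abse_integral => //.
  exact: (measurableT_comp mF (measurable_pair2 y)).
Qed.
End FubiniIntegrable.

(** * Pairing homogeneous functions with test functions *)

Section HomogeneousPairing.
Variables (R : realType) (n : nat).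
Local Notation V := 'rV[R]_n.
Local Notation mu := (lebRn R n).
Local Notation B := (borelRn R n).
Local Notation leb := (@lebesgue_measure R).
Implicit Types (f g h Phi Psi : V -> R) (x y : V) (s u : R).

Lemma Rint1_pos_eq0 (f : R -> R) (u : R) : (forall t, 0 <= f t) ->
  itg leb f -> {for u, continuous f} -> \int[leb]_t f t = 0 -> f u = 0.
Proof.
move=> f0 fi fc I0; apply: contrapT => /eqP fx.
have fx0 : 0 < f u by rewrite lt_def fx f0.
have [N [mN N0 sN]] := @Rint_eq0 _ (measurableTypeR R) R leb f f0 fi I0.
have : nbhs u [set y | 0 < f y] by exact: (cvgr_gt _ fc).
move=> /nbhs_ballP[e /= e0 eP].
have : (leb (ball u e) <= 0)%E.
  rewrite -N0; apply: le_measure; rewrite ?inE //; first exact: measurable_ball.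
  move=> y /= uy; apply: sN => /= fy.
  by have := eP y uy; rewrite /= fy ltxx.
move=> H; suff : ((e *+ 2)%:E <= 0 :> \bar R)%E by rewrite lee_fin leNgt pmulrn_lgt0 // e0.
by rewrite -(lebesgue_measure_ball u (ltW e0)).
Qed.

Lemma shell_radial x y : enorm x = enorm y -> shell x = shell y.
Proof. by move=> E; rewrite /shell -!enorm_sqr E. Qed.

Lemma sch_shell : sch (@shell R n).
Proof. exact: sch_compact (@smooth_shell R n) (@shell_out R n). Qed.

Lemma mel_shell_sphere s x y : sphere x -> sphere y -> mel s (@shell R n) x = mel s (@shell R n) y.
Proof.
move=> sx sy; apply: eq_Rintegral => u _; congr (_ * _); apply: shell_radial.
by rewrite !enormZ sx sy.
Qed.

Lemma mel_shell_gt0 s x : 0 < s -> sphere x -> 0 < mel s (@shell R n) x.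
Proof.
move=> s0 sx; have x0 := sphere_neq0 sx.
have ix := itg_mel s0 sch_shell x0.
rewrite lt_def mel_ge0 ?andbT; last by move=> y; exact: shell_ge0.
apply/eqP => I0.
have : shell (expR 0 *: x) * expR (s * 0) = 0.
  apply: (Rint1_pos_eq0 _ ix _ I0).
    by move=> t; rewrite mulr_ge0 ?shell_ge0 ?expR_ge0.
  apply: (@continuousM _ _ (fun u : R => shell (expR u *: x)) (fun u => expR (s * u))).
    apply: (@continuous_comp _ _ _ (fun u : R => expR u *: x) (@shell R n)).
      exact: dil_cont.
    exact: sch_cont sch_shell _.
  apply: (@continuous_comp _ _ _ (fun u : R => s * u) expR); last exact: continuous_expR.
  by apply: (@continuousM _ _ (fun=> s) id); [exact: cst_continuous | exact: cvg_id].
rewrite expR0 scale1r mulr0 expR0 mulr1 => E.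
by have := shell_sphere sx; rewrite E ltxx.
Qed.

(** Default value of the power: the singular factor is 0 at the origin, so the value of h at
    [normalize 0] never contributes. *)
Lemma powR0_neg s : 0 < s -> 0 `^ (- s) = 0 :> R.
Proof. by move=> s0; rewrite powR0 // oppr_eq0 gt_eqF. Qed.

Lemma enorm0 : enorm (0 : V) = 0.
Proof. by apply/eqP; rewrite enorm_eq0. Qed.

(** Local integrability of the singularity without polar coordinates: off 0 the Mellin integral of
    the radial [shell] is b |x|^(-s), b > 0 being its value on the sphere. Fubini makes its product
    with Psi integrable, and b is divided out. *)
Lemma hom_itg s Psi (C : R) : 0 < s < n%:R -> itg mu Psi -> (forall x, `|Psi x| <= C) ->
  itg mu (fun x : B => enorm (x : V) `^ (- s) * Psi x).
Proof.
move=> sn iPsi PC; have s0 : 0 < s by case/andP: sn.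
have := itg_fubini1 (itg_mel_prod sn sch_shell iPsi PC).
have [E0|/set0P[z sz]] := eqVneq (@sphere R n) set0.
  move=> _; have -> : (fun x : B => enorm (x : V) `^ (- s) * Psi x) = fun=> 0.
    apply/funext => x; have [->|x0] := eqVneq (x : V) 0.
      by rewrite enorm0 powR0_neg // mul0r.
    by have := sphere_normalize x0; rewrite E0.
  exact: itg0.
have b0 := mel_shell_gt0 s0 sz; set b := mel _ _ _ in b0.
move=> /(itgZ b^-1); congr (itg _ _); apply/funext => x /=.
have [->|x0] := eqVneq (x : V) 0.
  rewrite enorm0 powR0_neg // mul0r.
  rewrite (@eq_Rintegral _ _ _ leb _ (fun=> 0)) ?/Rintegral ?integral0 ?mulr0 // => u _.
  by rewrite scaler0 shell_in ?mul0r // /qf big1 ?invr_gt0 // => i _; rewrite mxE expr0n.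
rewrite (@eq_Rintegral _ _ _ leb _ (fun u => Psi x * (shell (expR u *: (x : V)) * expR (s * u)))); last first.
  by move=> u _; rewrite mulrAC mulrC.
rewrite RintZ; last exact: (itg_mel s0 sch_shell x0).
rewrite -/(mel s (@shell R n) x) (mel_normalize s0 sch_shell x0).
rewrite (mel_shell_sphere s (sphere_normalize x0) sz) -/b.
by field; rewrite gt_eqF.
Qed.

Lemma dim_gt0 s : 0 < s < n%:R -> (0 < n)%N.
Proof. by move=> /andP[s0 sn]; rewrite -(ltr_nat R); exact: lt_trans s0 sn. Qed.

Lemma off0_ae s (f g : V -> R) : 0 < s < n%:R -> (forall x, x != 0 -> f x = g x) ->
  \int[mu]_x f x = \int[mu]_x g x.
Proof.
move=> sn fg; apply: eq_Rintegral_ae; exists [set 0 : V]; split.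
- exact: measurable_set0B.
- exact: (lebRn_set0 R (dim_gt0 sn)).
- by move=> x /= H; apply/eqP/negPn/negP => /fg.
Qed.

Lemma mel_pair s Phi Psi (C : R) : 0 < s < n%:R -> sch Phi -> itg mu Psi ->
  (forall x, `|Psi x| <= C) ->
  \int[mu]_x (mel s Phi x * Psi x) =
  \int[leb]_u (expR (s * u) * \int[mu]_x (Phi (expR u *: x) * Psi x)).
Proof.
move=> sn sP iPsi PC; have s0 : 0 < s by case/andP: sn.
have iF := itg_mel_prod sn sP iPsi PC.
transitivity (\int[mu]_x \int[leb]_u (Phi (expR u *: x) * Psi x * expR (s * u))).
  apply: (off0_ae sn) => x x0; rewrite mulrC /mel -(RintZ _ (itg_mel s0 sP x0)).
  by apply: eq_Rintegral => u _; ring.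
rewrite (Rfubini iF); apply: eq_Rintegral => u _ /=.
have iu : itg mu (fun x : B => Phi (expR u *: (x : V)) * Psi x).
  apply: (itg_mulb _ (itg_meas iPsi) PC).
  by apply: itg_scale; [exact: expR_gt0 | exact: itg_sch].
rewrite -(RintZ _ iu); apply: eq_Rintegral => x _; exact: mulrC.
Qed.

(* Only values at points [normalize x] matter; these include the junk point
   [normalize 0 = 0]. *)
Definition bm h := measurable_fun setT (fun x : B => h (normalize (x : V))) /\
  exists M, forall x, `|h (normalize x)| <= M.

Lemma Ce_inf_bm h : Ce_inf h -> bm h.
Proof.
move=> Ch; split; last by have [M _ HM] := Ce_inf_bound Ch; exists M.
by apply: measurable_off0 => x x0; exact: (Ce_inf_cont Ch).
Qed.

Lemma hom_itg_bm s h Psi : 0 < s < n%:R -> bm h -> sch Psi ->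
  itg mu (fun x : B => enorm (x : V) `^ (- s) * h (normalize (x : V)) * Psi x).
Proof.
move=> sn [mh [M HM]] sP.
have [C C0 HC] := sch_bound 0 sP.
have i1 : itg mu (fun x : B => Psi x * h (normalize (x : V))).
  exact: (itg_sch_mul sP mh HM).
have := @hom_itg s (fun x => Psi x * h (normalize x)) (C * M) sn i1 _.
have b x : `|Psi x * h (normalize x)| <= C * M.
  by rewrite normrM ler_pM // (le_trans (HC x)) // expr0 divr1.
move=> /(_ b); congr (itg _ _); apply/funext => x; ring.
Qed.

Lemma hom_pairE s h Psi : 0 < s < n%:R -> bm h -> sch Psi ->
  hom_pair (- s) h Psi = \int[mu]_x (enorm x `^ (- s) * h (normalize x) * Psi x).
Proof. by move=> sn bh sP; rewrite /hom_pair intRnE //; exact: hom_itg_bm. Qed.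

Lemma hom_pair_mel s Phi Psi : 0 < s < n%:R -> sch Phi -> even_fun Phi -> sch Psi ->
  hom_pair (- s) (mel s Phi) Psi = \int[mu]_x (mel s Phi x * Psi x).
Proof.
move=> sn sP eP sPsi; have s0 : 0 < s by case/andP: sn.
rewrite (hom_pairE sn (Ce_inf_bm (Ce_inf_mel s0 sP eP)) sPsi).
by apply: (off0_ae sn) => x x0; rewrite -(mel_normalize s0 sP x0).
Qed.

(** The two integrands agree at every point, the origin included since both vanish there, so
    integrability does not come in. *)
Lemma hom_pair_ext s h1 h2 Psi : 0 < s -> (forall x, sphere x -> h1 x = h2 x) ->
  hom_pair (- s) h1 Psi = hom_pair (- s) h2 Psi.
Proof.
move=> s0 hh; rewrite /hom_pair; congr (intRn _); apply/funext => x.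
have [->|x0] := eqVneq x 0; last by rewrite hh //; exact: sphere_normalize.
by rewrite enorm0 powR0_neg // !mul0r.
Qed.

End HomogeneousPairing.

(** * Polar coordinates *)

Section Polar.
Variables (R : realType) (n : nat).
Local Notation V := 'rV[R]_n.
Local Notation mu := (lebRn R n).
Local Notation B := (borelRn R n).
Local Notation leb := (@lebesgue_measure R).
Implicit Types (f g h Phi Psi : V -> R) (x y : V) (s u : R).

(** The profile of [cone] along a ray, in the logarithmic variable; see [cone_dil]. *)
Definition halfexp (t : R) : R := if 0 < t then expR (- (n%:R * t)) else 0.

Lemma halfexp_ge0 t : 0 <= halfexp t.
Proof. by rewrite /halfexp; case: ifP => // _; exact: expR_ge0. Qed.

Lemma itg_halfexp : (0 < n)%N -> itg leb halfexp.
Proof.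
move=> n0; apply: (itg_le (@itg_expabs R n%:R _)); first by rewrite ltr0n.
  apply: measurable_fun_ifT => //; first exact: measurable_fun_ltr.
  apply: continuous_measurable_fun => u.
  apply: (@continuous_comp _ _ _ (fun u : R => - (n%:R * u)) expR); last exact: continuous_expR.
  apply: (@continuousN _ _ _ (fun u : R => n%:R * u)).
  by apply: (@continuousM _ _ (fun=> n%:R) id); [exact: cst_continuous | exact: cvg_id].
move=> u; rewrite ger0_norm ?halfexp_ge0 // /halfexp; case: ifP => [u0|_]; last exact: expR_ge0.
by rewrite gtr0_norm.
Qed.

Lemma halfexp_int_gt0 : (0 < n)%N -> 0 < \int[leb]_t halfexp t.
Proof.
move=> n0; rewrite lt_def Rintegral_ge0 ?andbT; last by move=> t _; exact: halfexp_ge0.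
apply/eqP => I0.
have c1 : {for 1, continuous halfexp}.
  rewrite /prop_for /continuous_at {2}/halfexp ltr01.
  apply: (@cvg_trans _ ((fun t => expR (- (n%:R * t))) @ (1 : R))).
    apply: near_eq_cvg; near=> t; rewrite /halfexp; case: ifP => // /negP[].
    by near: t; apply: lt_nbhsr.
  apply: (@continuous_comp _ _ _ (fun u : R => - (n%:R * u)) expR); last exact: continuous_expR.
  apply: (@continuousN _ _ _ (fun u : R => n%:R * u)).
  by apply: (@continuousM _ _ (fun=> n%:R) id); [exact: cst_continuous | exact: cvg_id].
have := Rint1_pos_eq0 halfexp_ge0 (itg_halfexp n0) c1 I0.
by rewrite /halfexp ltr01 => /eqP; rewrite gt_eqF ?expR_gt0.
Unshelve. all: by end_near.
Qed.

(** Its integral over a dilation orbit is the same for all x != 0. The power n is the one that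
    cancels the degrees -s and -(n - s) in [polar], leaving the indicator of the unit ball, as in
    [sphere_int]. *)
Definition cone x : R := if enorm x < 1 then enorm x ^+ n else 0.

Lemma cone_ge0 x : 0 <= cone x.
Proof. by rewrite /cone; case: ifP => // _; rewrite exprn_ge0 // enorm_ge0. Qed.

Lemma cone_le1 x : `|cone x| <= 1.
Proof.
rewrite ger0_norm ?cone_ge0 // /cone; case: ifP => // x1.
by rewrite exprn_ile1 ?enorm_ge0 // ltW.
Qed.

Lemma measurable_enorm : measurable_fun setT (fun x : B => enorm (x : V)).
Proof.
apply: measurable_off0 => x x0.
have E : (fun y => enorm y `^ 1) = @enorm R n.
  by apply/funext => y; rewrite powRr1 // enorm_ge0.
by have := smooth_cont (@smooth_powR_enorm R n 1) x0; rewrite E.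
Qed.

Lemma measurable_cone : measurable_fun setT (cone : B -> R).
Proof.
apply: measurable_fun_ifT => //.
- by apply: measurable_fun_ltr => //; exact: measurable_enorm.
- by apply: measurable_funX; exact: measurable_enorm.
Qed.

Lemma cone_dil u x : x != 0 -> cone (expR (- u) *: x) = halfexp (u - ln (enorm x)).
Proof.
move=> x0; have e0 : 0 < enorm x by rewrite enorm_gt0.
rewrite /cone /halfexp enormZ gtr0_norm ?expR_gt0 //.
have -> : expR (- u) * enorm x = expR (- (u - ln (enorm x))).
  by rewrite opprB addrC expRD lnK // posrE.
by rewrite -[X in _ < X]expR0 ltr_expR oppr_lt0 -mulrN expRM_natl.
Qed.

Lemma itg_cone_prod H : (0 < n)%N -> itg mu H ->
  itg (mu \x leb)%E (fun z : B * measurableTypeR R => H z.1 * cone (expR (- z.2) *: (z.1 : V))).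
Proof.
move=> n0 iH; have mH := itg_meas iH.
have mF : measurable_fun setT
    (fun z : B * measurableTypeR R => H z.1 * cone (expR (- z.2) *: (z.1 : V))).
  apply: measurable_funM; first exact: (measurableT_comp mH measurable_fst).
  apply: (measurableT_comp measurable_cone).
  apply: (measurableT_comp (@measurable_dil2 R n)
    (g := fun z : B * measurableTypeR R => (z.1, - z.2 : measurableTypeR R))).
  apply: measurable_fun_pair; first exact: measurable_fst.
  exact: (measurableT_comp (@oppr_measurable R setT) measurable_snd).
apply/(integrable12ltyP mu leb); first exact/measurable_EFinP.
have /integrableP[_] := itgZ (\int[leb]_t halfexp t) iH; apply: le_lt_trans.
apply: ge0_le_integral => //.
- by move=> u _; exact: integral_ge0.
- apply: (measurable_fun_fubini_tonelli_F (fun z : B * measurableTypeR R =>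
    `|(H z.1 * cone (expR (- z.2) *: (z.1 : V)))%:E|)%E) => //.
  by apply: (measurableT_comp (f := abse)) => //; exact/measurable_EFinP.
- by apply: (measurableT_comp (f := abse)) => //; apply/measurable_EFinP;
    exact: (itg_meas (itgZ _ iH)).
move=> x _ /=; have [x0|x0] := eqVneq (x : V) 0.
  rewrite (eq_integral (cst 0%E)) ?integral0 ?lee_fin // => u _.
  by rewrite x0 scaler0 /cone enorm0 ltr01 expr0n gtn_eqF // mulr0 normr0.
have iW : itg leb (fun u : R => `|H x| * halfexp (u - ln (enorm (x : V)))).
  by apply: itgZ; apply: itg_leb_shift; exact: itg_halfexp.
have -> : (\int[leb]_u `|H x * cone (expR (- u) *: (x : V))|%:E =
   (\int[leb]_u (`|H x| * halfexp (u - ln (enorm (x : V)))))%:E)%E.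
  rewrite /Rintegral fineK; last exact: integrable_fin_num iW.
  by apply: eq_integral => u _; rewrite cone_dil // normrM (ger0_norm (halfexp_ge0 _)).
rewrite lee_fin (RintZ _ (itg_leb_shift _ (itg_halfexp n0))).
rewrite (Rint_leb_shift _ (itg_halfexp n0)) normrM mulrC.
by rewrite (ger0_norm (ltW (halfexp_int_gt0 n0))).
Qed.

Lemma itg_mul_cone H r : itg mu H -> itg mu (fun y : B => H y * cone (r *: (y : V))).
Proof.
move=> iH; apply: (itg_mulb (C := 1) iH); last by move=> x; exact: cone_le1.
apply: (measurableT_comp measurable_cone).
have := @measurable_affB R n r 0.
by congr measurable_fun; apply/funext => x; rewrite /affB addr0.
Qed.

(** Substituting e^(-u) x moves the dilation from H to [cone]; the Jacobian is the factor e^(nu). *)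
Lemma dil_cone H u : itg mu H ->
  itg mu (fun x : B => H (expR u *: (x : V)) * cone x * expR (n%:R * u)) /\
  \int[mu]_x (H (expR u *: x) * cone x * expR (n%:R * u)) =
  \int[mu]_x (H x * cone (expR (- u) *: x)).
Proof.
move=> iH; have eu := expR_gt0 u.
have wd := itg_scale eu (itg_mul_cone (expR (- u)) iH).
have E : (fun x : B => H (expR u *: (x : V)) * cone x * expR (n%:R * u)) =
  (fun x : B => expR (n%:R * u) *
      (H (expR u *: (x : V)) * cone (expR (- u) *: (expR u *: (x : V))))).
  by apply/funext => x; rewrite scalerA -expRD addNr expR0 scale1r mulrC.
rewrite E; split; first exact: itgZ.
rewrite (RintZ _ wd) (Rint_scale eu (itg_mul_cone (expR (- u)) iH)) mulrA expRM_natl.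
by rewrite divff ?mul1r // expf_neq0 // gt_eqF.
Qed.

(** By [dil_cone] applied to |H|, the absolute value has, for each u, the same x-integral as the
    function of [itg_cone_prod]. *)
Lemma itg_dil_cone H : (0 < n)%N -> itg mu H ->
  itg (mu \x leb)%E (fun z : B * measurableTypeR R =>
    H (expR z.2 *: (z.1 : V)) * cone z.1 * expR (n%:R * z.2)).
Proof.
move=> n0 iH; have mF := measurable_dilM n%:R (itg_meas iH) measurable_cone.
apply/(integrable21ltyP mu leb); first exact/measurable_EFinP.
have iG := itg_cone_prod n0 iH.
have := (integrable21ltyP mu leb (measurable_int _ iG)).1 iG.
apply: le_lt_trans; rewrite le_eqVlt; apply/orP; left; apply/eqP; apply: eq_integral => u _ /=.
have [iD ED] := dil_cone u (itg_norm iH).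
symmetry; transitivity (\int[mu]_x (`|H x| * cone (expR (- u) *: (x : V))))%:E.
  rewrite /Rintegral fineK; last first.
    exact: integrable_fin_num (itg_mul_cone (expR (- u)) (itg_norm iH)).
  by apply: eq_integral => x _; rewrite normrM (ger0_norm (cone_ge0 _)).
rewrite -ED /Rintegral fineK; last exact: integrable_fin_num iD.
apply: eq_integral => x _; rewrite !normrM (ger0_norm (cone_ge0 _)).
by rewrite (ger0_norm (expR_ge0 _)).
Qed.

(** The constant is the orbit integral of [cone] through x, inserted under the integral of H.
    Exchange the order, substitute by [dil_cone], and exchange back. *)
Lemma polar_Rint H : (0 < n)%N -> itg mu H ->
  (\int[leb]_t halfexp t) * \int[mu]_x H x =
  \int[mu]_x \int[leb]_u (H (expR u *: x) * cone x * expR (n%:R * u)).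
Proof.
move=> n0 iH; rewrite (Rfubini (itg_dil_cone n0 iH)) /=.
transitivity (\int[leb]_u \int[mu]_x (H x * cone (expR (- u) *: x))); last first.
  by apply: eq_Rintegral => u _; rewrite (dil_cone u iH).2.
rewrite -(Rfubini (itg_cone_prod n0 iH)) -(RintZ _ iH).
apply: eq_Rintegral_ae; exists [set 0 : V]; split.
- exact: measurable_set0B.
- exact: lebRn_set0.
move=> x /= K; apply/eqP/negPn/negP => x0; apply: K.
rewrite mulrC -(Rint_leb_shift (- ln (enorm x)) (itg_halfexp n0)).
rewrite -(RintZ _ (itg_leb_shift _ (itg_halfexp n0))).
by apply: eq_Rintegral => u _; rewrite cone_dil.
Qed.

Lemma bmM h1 h2 : bm h1 -> bm h2 -> bm (fun x => h1 x * h2 x).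
Proof.
move=> [m1 [M1 H1]] [m2 [M2 H2]]; split; first exact: measurable_funM.
by exists (M1 * M2) => x; rewrite normrM ler_pM.
Qed.

Lemma sphere_itg h : bm h ->
  itg mu (fun x : B => if enorm (x : V) < 1 then h (normalize (x : V)) else 0).
Proof.
move=> [mh [M HM]]; have M0 : 0 <= M by apply: le_trans (HM 0).
apply: (itg_le (itgZ (M * 2 ^+ n.*2) (itg_wt R (leqnn n.*2)))).
  apply: measurable_fun_ifT => //.
  by apply: measurable_fun_ltr => //; exact: measurable_enorm.
move=> x /=; case: ifP => [x1|_]; last first.
  by rewrite normr0 !mulr_ge0 ?exprn_ge0 // invr_ge0 exprn_ge0 // addr_ge0.
apply: le_trans (HM x) _; rewrite -mulrA ler_peMr // -expr_div_n exprn_ege1 //.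
rewrite ler_pdivlMr ?ltr_pwDl // mul1r [leRHS]mulr2n lerD2l.
exact: le_trans (norm_le_enorm _) (ltW x1).
Qed.

Lemma sphere_intE h : bm h ->
  sphere_int h = n%:R * \int[mu]_x (if enorm x < 1 then h (normalize x) else 0).
Proof. by move=> bh; rewrite /sphere_int intRnE //; exact: sphere_itg. Qed.

(** In [polar_Rint] the homogeneous factors leave the inner integral, which becomes the Mellin
    integral of Phi with exponent n - s. The constant k is n times the integral of e^(-nt) over t >
    0; only its sign is retained. *)
Lemma polar : (0 < n)%N -> exists2 k, 0 < k & forall s h Phi, 0 < s < n%:R -> bm h -> sch Phi ->
  even_fun Phi ->
  k * hom_pair (- s) h Phi = sphere_int (fun x => h x * mel (n%:R - s) Phi x).
Proof.
move=> n0; exists (n%:R * \int[leb]_t halfexp t).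
  by rewrite mulr_gt0 ?halfexp_int_gt0 // ltr0n.
move=> s h Phi sn bh sP eP; have [s0 s1] := andP sn.
have ns0 : 0 < n%:R - s by rewrite subr_gt0.
rewrite sphere_intE; last by apply: bmM => //; exact: Ce_inf_bm (Ce_inf_mel ns0 sP eP).
rewrite (hom_pairE sn bh sP) -mulrA (polar_Rint n0 (hom_itg_bm sn bh sP)).
congr (_ * _); apply: (off0_ae sn) => x x0; have ex : 0 < enorm x by rewrite enorm_gt0.
have im := itg_mel ns0 sP x0.
transitivity (\int[leb]_u (enorm x `^ (- s) * h (normalize x) * cone x *
    (Phi (expR u *: x) * expR ((n%:R - s) * u)))).
  apply: eq_Rintegral => u _; rewrite enormZ gtr0_norm ?expR_gt0 // normalizeZ ?expR_gt0 //.
  rewrite powRM ?expR_ge0 ?enorm_ge0 // -expRM mulrBl expRD [u * - s]mulrN [u * s]mulrC.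
  ring.
rewrite (RintZ _ im) -/(mel _ _ _) (mel_normalize ns0 sP x0) /cone.
case: ifP => _; last by rewrite mulr0 mul0r.
rewrite -powR_mulrn ?enorm_ge0 //.
have <- : enorm x `^ (- s) * enorm x `^ n%:R * enorm x `^ (- (n%:R - s)) * (h (normalize x) *
  mel (n%:R - s) Phi (normalize x)) = h (normalize x) * mel (n%:R - s) Phi (normalize x).
  rewrite -!powRD; [|by apply/implyP => _; rewrite enorm_eq0..].
  have -> : - s + n%:R + - (n%:R - s) = 0 by ring.
  by rewrite powRr0 mul1r.
ring.
Qed.
End Polar.

(** * The operator T_q *)

Section FourierMellin.
Variables (R : realType) (n : nat).
Local Notation V := 'rV[R]_n.
Local Notation mu := (lebRn R n).
Local Notation B := (borelRn R n).
Local Notation leb := (@lebesgue_measure R).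
Implicit Types (f g h Phi Psi : V -> R) (x y : V) (s u : R).

Lemma fourier_reE f : itg mu f -> fourier_re f = ct 0 f.
Proof.
move=> fi; apply/funext => x; rewrite /fourier_re intRnE; last first.
  by have := itg_cos 0 x fi; under eq_fun do rewrite addr0.
by rewrite /ct; apply: eq_Rintegral => y _; rewrite addr0.
Qed.

Lemma fourier_imE f : itg mu f -> fourier_im f = ct (pi / 2) f.
Proof.
move=> fi; apply/funext => x; have i1 := itg_cos (pi / 2) x fi.
have E : (fun y => f y * sin (dotp x y)) = (fun y => -1 * (f y * cos (dotp x y + pi / 2))).
  by apply/funext => y; rewrite cosDpihalf mulrN mulN1r opprK.
by rewrite /fourier_im E intRnE; [rewrite (RintZ _ i1) mulN1r opprK | exact: itgZ].
Qed.

Lemma ct0_even f : even_fun (ct 0 f).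
Proof. by move=> x; apply: eq_Rintegral => y _; rewrite dotpNl !addr0 cosN. Qed.

Lemma ct_pihalf_odd f x : itg mu f -> ct (pi / 2) f (- x) = - ct (pi / 2) f x.
Proof.
move=> fi; rewrite -mulN1r /ct -(RintZ _ (itg_cos _ _ fi)).
by apply: eq_Rintegral => y _; rewrite dotpNl !cosDpihalf sinN; ring.
Qed.

(** The imaginary part of a Fourier transform is odd and h is even, so the integrand is odd. *)
Lemma hom_pair_im0 s h Psi : 0 < s < n%:R -> bm h -> (forall x, sphere x -> h (- x) = h x) ->
  sch Psi -> hom_pair (- s) h (fourier_im Psi) = 0.
Proof.
move=> sn bh eh sP; rewrite (fourier_imE (itg_sch sP)).
have sC := sch_ct (pi / 2) sP.
rewrite (hom_pairE sn bh sC); have iF := hom_itg_bm sn bh sC.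
pose F x := enorm x `^ (- s) * h (normalize x) * ct (pi / 2) Psi x.
have FN x : F (- x) = -1 * F x.
  rewrite /F enormN normalizeN ct_pihalf_odd ?itg_sch //.
  have [->|x0] := eqVneq x 0; first by rewrite enorm0 powR0_neg ?mul0r ?mulr0 //; case/andP: sn.
  by rewrite eh ?mulrN ?mulN1r //; exact: sphere_normalize.
apply/eqP; rewrite -eqNr -mulN1r -(RintZ (-1) iF) -[X in _ == X](Rint_opp iF).
by apply/eqP; apply: eq_Rintegral => x _; rewrite -[RHS]/(F (- x)) FN.
Qed.

Lemma itg_mel_pair s Phi Psi (C : R) : 0 < s < n%:R -> sch Phi -> itg mu Psi ->
  (forall x, `|Psi x| <= C) ->
  itg leb (fun u => expR (s * u) * \int[mu]_x (Phi (expR u *: x) * Psi x)).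
Proof.
move=> sn sP iPsi PC; have := itg_fubini2 (itg_mel_prod sn sP iPsi PC).
congr (itg _ _); apply/funext => u /=.
have iu : itg mu (fun x : B => Phi (expR u *: (x : V)) * Psi x).
  apply: (itg_mulb _ (itg_meas iPsi) PC).
  by apply: itg_scale; [exact: expR_gt0 | exact: itg_sch].
rewrite -(RintZ _ iu); apply: eq_Rintegral => x _; exact: mulrC.
Qed.

Lemma sch0_bound Psi : sch Psi -> exists C, forall x, `|Psi x| <= C.
Proof.
move=> sP; have [C C0 HC] := sch_bound 0 sP.
by exists C => x; rewrite (le_trans (HC x)) // expr0 divr1.
Qed.

(** With the u-integral outside, symmetry moves the transform from Psi to the dilate of Phi^, giving
    c e^(-nu) Phi(e^(-u) x). The change u -> -u turns the weight e^((s-n)u) into e^((n-s)u). *)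
Lemma Parseval_mel s Phi Psi (c : R) : 0 < s < n%:R -> sch Phi -> sch Psi ->
  (forall x, ct 0 (ct 0 Phi) x = c * Phi x) ->
  \int[mu]_x (mel s (ct 0 Phi) x * ct 0 Psi x) =
  \int[mu]_x (mel (n%:R - s) (fun y => c * Phi y) x * Psi x).
Proof.
move=> sn sP sQ inv; have [s0 s1] := andP sn.
have sn' : 0 < n%:R - s < n%:R by rewrite subr_gt0 s1 ltrBlDr ltrDl.
have [C1 H1] := sch0_bound (sch_ct 0 sQ); have [C2 H2] := sch0_bound sQ.
have scP := schZ c sP.
rewrite (mel_pair sn (sch_ct 0 sP) (itg_sch (sch_ct 0 sQ)) H1).
rewrite (mel_pair sn' scP (itg_sch sQ) H2).
rewrite -(Rint_lebN (itg_mel_pair sn' scP (itg_sch sQ) H2)).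
apply: eq_Rintegral => u _; have eu := expR_gt0 u.
rewrite -(ct_sym 0 (itg_scale eu (itg_sch (sch_ct 0 sP))) (itg_sch sQ)).
have iu : itg mu (fun x : B => c * Phi (expR (- u) *: (x : V)) * Psi x).
  apply: (itg_mulb _ (itg_meas (itg_sch sQ)) H2).
  exact: (itg_scale (expR_gt0 _) (itg_sch scP)).
transitivity (expR (s * u) * \int[mu]_x (expR u ^- n * (c * Phi (expR (- u) *: x) * Psi x))).
  congr (_ * _); apply: eq_Rintegral => x _.
  by rewrite ct_scale ?inv -?expRN ?mulrA // ; exact: itg_sch (sch_ct 0 sP).
rewrite (RintZ _ iu) mulrA; congr (_ * _).
by rewrite mulrBl !mulrN opprK expRD -expRM_natl expRN mulrC.
Qed.

(** [Parseval_mel] at s = n + q, where n - s = -q; the clause on imaginary parts holds by parity. *)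
Lemma is_Tq_mel q Phi (c : R) : - n%:R < q -> q < 0 -> sch Phi -> even_fun Phi ->
  (forall x, ct 0 (ct 0 Phi) x = c * Phi x) ->
  is_Tq q (mel (n%:R + q) (ct 0 Phi)) (mel (- q) (fun x => c * Phi x)).
Proof.
move=> nq q0 sP eP inv.
have sn : 0 < n%:R + q < n%:R by apply/andP; split; lra.
have qn : 0 < - q < n%:R by apply/andP; split; lra.
have [s0 _] := andP sn; have [q'0 _] := andP qn.
have sC := sch_ct 0 sP; have scP := schZ c sP.
have eC : even_fun (ct 0 Phi) := ct0_even _.
have ec : even_fun (fun x => c * Phi x) by move=> x; rewrite eP.
split=> [|Psi /schP sQ]; first exact: Ce_inf_mel.
have E : - n%:R - q = - (n%:R + q) by rewrite opprD.
rewrite E fourier_reE ?itg_sch // (hom_pair_mel sn sC eC (sch_ct 0 sQ)) (Parseval_mel sn sP sQ inv).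
have bK := Ce_inf_bm (Ce_inf_mel s0 sC eC).
split; last exact: (hom_pair_im0 sn bK (fun x _ => mel_even _ _ eC) sQ).
have -> : n%:R - (n%:R + q) = - q by ring.
by rewrite -[in hom_pair q](opprK q) (hom_pair_mel qn scP ec sQ).
Qed.

Lemma smooth_lin U f g (c : R) : open U -> smooth_on U f -> smooth_on U g ->
  smooth_on U (fun x => f x + c * g x).
Proof.
move=> oU sf sg; apply: (@smoothD _ _ _ f (fun x => c * g x)) => //.
by apply: (@smoothM _ _ _ (fun=> c) g) => //; exact: smooth_cst.
Qed.

Lemma Ce_inf_lin f g (c : R) : Ce_inf f -> Ce_inf g -> Ce_inf (fun x => f x + c * g x).
Proof.
move=> [sf ef] [sg eg]; split; last by move=> x sx; rewrite ef // eg.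
exact: (smooth_lin _ (@open_neq0 R n) sf sg).
Qed.

Lemma hom_pair_lin s f g (c : R) Psi : 0 < s < n%:R -> bm f -> bm g -> sch Psi ->
  hom_pair (- s) (fun x => f x + c * g x) Psi =
  hom_pair (- s) f Psi + c * hom_pair (- s) g Psi.
Proof.
move=> sn bf bg sP; have i1 := hom_itg_bm sn bf sP; have i2 := hom_itg_bm sn bg sP.
rewrite !hom_pairE // -?(RintZ _ i2) -?(RintD i1 (itgZ c i2)); last first.
  have [[m1 [M1 H1]] [m2 [M2 H2]]] := (bf, bg); split.
    by apply: measurable_funD => //; exact: measurable_funM.
  exists (M1 + `|c| * M2) => x; apply: le_trans (ler_normD _ _) _.
  by rewrite lerD // normrM ler_wpM2l.
by apply: eq_Rintegral => x _; ring.
Qed.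

(** Testing the difference d = f - g against d times the shell gives a nonnegative integrand
    containing d^2, continuous off 0, whose integral vanishes. *)
Lemma hom_pair_inj s f g : 0 < s < n%:R -> Ce_inf f -> Ce_inf g ->
  (forall Psi, sch Psi -> even_fun Psi -> hom_pair (- s) f Psi = hom_pair (- s) g Psi) ->
  forall x, sphere x -> f x = g x.
Proof.
move=> sn Cf Cg H x sx; pose d y := f y + -1 * g y.
have Cd : Ce_inf d by exact: Ce_inf_lin.
have sP := Ce_inf_sch Cd; set P := (fun y => _) in sP.
have eP : even_fun P.
  move=> y; rewrite /P shellN normalizeN; have [->|y0] := eqVneq y 0.
    by rewrite !shell_in ?mulr0 // /qf big1 ?invr_gt0 // => i _; rewrite mxE expr0n.
  by congr (_ * _); apply: Cd.2; exact: sphere_normalize.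
have := hom_pair_lin (-1) sn (Ce_inf_bm Cf) (Ce_inf_bm Cg) sP.
rewrite (H _ sP eP) mulN1r subrr (hom_pairE sn (Ce_inf_bm Cd) sP) => I0.
have iF := hom_itg_bm sn (Ce_inf_bm Cd) sP.
have x0 := sphere_neq0 sx.
have F0 y : 0 <= enorm y `^ (- s) * d (normalize y) * P y.
  by rewrite /P -mulrA mulr_ge0 ?powR_ge0 // mulrA mulr_ge0 ?shell_ge0 // -expr2 sqr_ge0.
have Fc : {for x, continuous (fun y => enorm y `^ (- s) * d (normalize y) * P y)}.
  apply: (@continuousM _ _ (fun y => enorm y `^ (- s) * d (normalize y)) P); last exact: sch_cont.
  apply: (@continuousM _ _ (fun y => enorm y `^ (- s)) (fun y => d (normalize y))).
    by have := smooth_cont (@smooth_powR_enorm R n (- s)) x0.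
  exact: Ce_inf_cont.
have := Rint_pos_eq0 F0 iF Fc I0; rewrite /P normalize_sphere //.
have := shell_sphere sx; have := powR_gt0 (- s); rewrite -enorm_gt0 in x0.
move=> /(_ _ x0) /lt0r_neq0 e0 /lt0r_neq0 h0 /eqP.
rewrite mulf_eq0 (mulf_eq0 (d x)) (negbTE h0) orbF mulf_eq0 (negbTE e0) orbb /=.
by rewrite /d mulN1r subr_eq0 => /eqP.
Qed.

Section InvertibleTq.
Variables (q c : R).
Hypotheses (nq : - n%:R < q) (q0 : q < 0) (c0 : 0 < c).
Hypothesis inv : forall f x, sch f -> even_fun f -> ct 0 (ct 0 f) x = c * f x.

Let sn : 0 < n%:R + q < n%:R. Proof. by move: nq q0 => *; apply/andP; split; lra. Qed.
Let qn : 0 < - q < n%:R. Proof. by move: nq q0 => *; apply/andP; split; lra. Qed.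
Let E : - n%:R - q = - (n%:R + q). Proof. by rewrite opprD. Qed.

(** Inversion read backwards: the preimage of Psi is its own transform divided by c. *)
Lemma ct_onto Psi : sch Psi -> even_fun Psi ->
  exists P, [/\ sch P, even_fun P & ct 0 P = Psi].
Proof.
move=> sP eP; pose P0 x := c^-1 * Psi x.
have sP0 : sch P0 by exact: schZ.
have eP0 : even_fun P0 by move=> x; rewrite /P0 eP.
exists (ct 0 P0); split; [exact: sch_ct | exact: ct0_even |].
by apply/funext => x; rewrite inv // /P0 mulrA divff ?mul1r // gt_eqF.
Qed.

Lemma is_Tq_unique f F G : is_Tq q f F -> is_Tq q f G -> forall x, sphere x -> F x = G x.
Proof.
move=> [CF HF] [CG HG]; apply: (hom_pair_inj qn) => // P /schP sP eP.
by rewrite opprK -(HF _ sP).1 -(HG _ sP).1.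
Qed.

Lemma is_Tq_ext f1 f2 F : (forall x, sphere x -> f1 x = f2 x) -> is_Tq q f1 F -> is_Tq q f2 F.
Proof.
move=> ff [CF HF]; split=> // P sP; have [s0 _] := andP sn.
by have := HF _ sP; rewrite E !(@hom_pair_ext _ _ _ f1 f2).
Qed.

Lemma is_Tq_lin (a : R) f g F G : Ce_inf f -> Ce_inf g -> is_Tq q f F -> is_Tq q g G ->
  is_Tq q (fun x => f x + a * g x) (fun x => F x + a * G x).
Proof.
move=> Cf Cg [CF HF] [CG HG]; split; first exact: Ce_inf_lin.
move=> P sP; have [F1 F2] := HF P sP; have [G1 G2] := HG P sP.
have {sP}/schP sP := sP; have iP := itg_sch sP.
have [bf bg bF bG] := And4 (Ce_inf_bm Cf) (Ce_inf_bm Cg) (Ce_inf_bm CF) (Ce_inf_bm CG).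
rewrite E in F1 F2 G1 G2 *.
have s1 : sch (fourier_re P) by rewrite fourier_reE //; exact: sch_ct.
have s2 : sch (fourier_im P) by rewrite fourier_imE //; exact: sch_ct.
split; last by rewrite (hom_pair_lin a sn bf bg s2) F2 G2 mulr0 addr0.
rewrite (hom_pair_lin a sn bf bg s1) F1 G1 -(opprK q).
by rewrite (hom_pair_lin a qn bF bG sP).
Qed.

(** By [ct_onto] every even test function is a transform, so f pairs to 0 with all of them and
    [hom_pair_inj] applies. *)
Lemma is_Tq_inj f F : Ce_inf f -> is_Tq q f F -> (forall x, sphere x -> F x = 0) ->
  forall x, sphere x -> f x = 0.
Proof.
(* The zero function is written as f - f, so that smoothness and linearity of the pairing come from
   the general lemmas. *)
move=> Cf [CF HF] F0; have Cz : Ce_inf (fun x => f x + -1 * f x) by exact: Ce_inf_lin.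
have z0 x : f x + -1 * f x = 0 by rewrite mulN1r subrr.
have bf := Ce_inf_bm Cf; have bF := Ce_inf_bm CF.
move=> x sx; rewrite -[RHS](z0 x); apply: (hom_pair_inj sn Cf Cz _ sx) => P sP eP.
rewrite (hom_pair_lin _ sn bf bf sP) mulN1r subrr.
have [Q [sQ eQ <-]] := ct_onto sP eP.
have [+ _] := HF Q (iffRL (schP _) sQ); rewrite E fourier_reE ?itg_sch // => ->.
rewrite -(opprK q) (@hom_pair_ext _ _ _ F (fun y => F y + -1 * F y)); last first.
- by move=> y sy; rewrite F0 // mulr0 addr0.
- by case/andP: qn.
by rewrite (hom_pair_lin _ qn bF bF sQ) mulN1r subrr.
Qed.

(** The Mellin integral of the radial [shell] is a positive constant b on the sphere, and the factor
    f(x/|x|) is constant on rays; dividing by b gives P. The sign clause yields the nonnegative test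
    function that positive definiteness asks for. *)
Lemma mel_onto s f : 0 < s -> (0 < n)%N -> Ce_inf f -> exists P, [/\ sch P, even_fun P,
  (forall x, sphere x -> mel s P x = f x) &
  (forall x, sphere x -> 0 <= f x) -> forall x, 0 <= P x].
Proof.
move=> s0 n0 Cf.
have [z sz] : exists z : V, sphere z.
  exists (normalize (const_mx 1)); apply: sphere_normalize.
  apply/eqP => /matrixP/(_ ord0 (Ordinal n0)); rewrite !mxE => /eqP.
  by rewrite oner_eq0.
have b0 := mel_shell_gt0 s0 sz; set b := mel _ _ _ in b0.
have sP := schZ b^-1 (Ce_inf_sch Cf).
have sh0 : shell (0 : V) = 0.
  by rewrite shell_in // /qf big1 ?invr_gt0 // => i _; rewrite mxE expr0n.
exists (fun x => b^-1 * (f (normalize x) * shell x)); split => //.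
- move=> x; rewrite shellN normalizeN; have [->|x0] := eqVneq x 0.
    by rewrite sh0 !mulr0.
  by rewrite Cf.2 //; exact: sphere_normalize.
- move=> x sx; have x0 := sphere_neq0 sx.
  have -> : f x = b^-1 * (f (normalize x) * mel s (@shell R n) x).
    rewrite (mel_shell_sphere s sx sz) -/b normalize_sphere //.
    by rewrite mulrC mulfK // gt_eqF.
  rewrite mulrA /mel -(RintZ _ (itg_mel s0 (@sch_shell R n) x0)).
  by apply: eq_Rintegral => u _; rewrite normalizeZ ?expR_gt0 // !mulrA.
- move=> f0 x; apply: mulr_ge0; first by rewrite invr_ge0 ltW.
  have [->|x0] := eqVneq x 0; first by rewrite sh0 mulr0.
  by rewrite mulr_ge0 ?shell_ge0 // f0 //; exact: sphere_normalize.
Qed.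

Lemma is_Tq_Tq f : Ce_inf f -> is_Tq q f (Tq q f).
Proof.
move=> Cf; have [s0 _] := andP sn.
have [P [sP eP PE _]] := mel_onto s0 (dim_gt0 sn) Cf.
have [Q [sQ eQ QP]] := ct_onto sP eP.
apply: getPex; exists (mel (- q) (fun x => c * Q x)).
apply: (is_Tq_ext PE); rewrite -QP; apply: is_Tq_mel => // x.
exact: inv.
Qed.

End InvertibleTq.
End FourierMellin.

(** * Comparison of L_p norms *)

Section SphereIntegral.
Variables (R : realType) (n : nat).
Local Notation V := 'rV[R]_n.
Local Notation mu := (lebRn R n).
Local Notation B := (borelRn R n).
Implicit Types (f g h : V -> R) (x y : V).

(** Young's inequality for b and a^(p-1) with the conjugate exponents p and p/(p-1); equivalently,
    t^p lies above its tangent at a. *)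
Lemma Young_powR (p a b : R) : 1 < p -> 0 <= a -> 0 <= b ->
  p * (a `^ (p - 1) * (b - a)) <= b `^ p - a `^ p.
Proof.
move=> p1 a0 b0; have p0 : 0 < p by exact: lt_trans p1.
have q0 : 0 < p - 1 by rewrite subr_gt0.
have := conjugate_powR b0 (powR_ge0 a (p - 1)) p0 (divr_gt0 p0 q0).
have -> : p^-1 + (p / (p - 1))^-1 = 1 by field; rewrite !gt_eqF.
move=> /(_ erefl); rewrite -powRrM.
have -> : (p - 1) * (p / (p - 1)) = p by field; rewrite gt_eqF.
move=> H.
have -> : p * (a `^ (p - 1) * (b - a)) = p * (b * a `^ (p - 1)) - p * (a * a `^ (p - 1)) by ring.
have -> : a * a `^ (p - 1) = a `^ p.
  have [->|a1] := eqVneq a 0; first by rewrite mul0r powR0 // gt_eqF.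
  rewrite -{1}[a]powRr1 // -powRD; last by rewrite a1 implybT.
  by congr (_ `^ _); ring.
have : p * (b * a `^ (p - 1)) <= p * (b `^ p / p + a `^ p / (p / (p - 1))).
  by rewrite ler_pM2l.
have -> : p * (b `^ p / p + a `^ p / (p / (p - 1))) = b `^ p + (p - 1) * a `^ p.
  by field; rewrite !gt_eqF.
lra.
Qed.

Lemma bm_powR h (r : R) : 0 <= r -> bm h -> bm (fun x => h x `^ r).
Proof.
move=> r0 [mh [M HM]]; split; first exact: (measurableT_comp (measurable_powR r) mh).
(* The 1 covers negative values of h: since [ln] is 0 there, the power of a negative base is exp 0 =
   1. *)
exists (M `^ r + 1) => x; rewrite ger0_norm ?powR_ge0 //.
have [h0|h0] := leP 0 (h (normalize x)).
  apply: (@le_trans _ _ (M `^ r)); last by rewrite lerDl.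
  have hM : h (normalize x) <= M by apply: le_trans (HM x); exact: ler_norm.
  by apply: ge0_ler_powR; rewrite ?nnegrE // (le_trans h0).
by rewrite [leLHS]/powR lt_eqF // (ln0 (ltW h0)) mulr0 expR0 lerDr powR_ge0.
Qed.

Lemma bm_norm h : bm h -> bm (fun x => `|h x|).
Proof.
move=> [mh [M HM]]; split; first exact: (measurableT_comp (@normr_measurable R setT) mh).
by exists M => x; rewrite normr_id.
Qed.

Lemma bm_lin h1 h2 (c : R) : bm h1 -> bm h2 -> bm (fun x => h1 x + c * h2 x).
Proof.
move=> [m1 [M1 H1]] [m2 [M2 H2]]; split.
  by apply: measurable_funD => //; exact: measurable_funM.
exists (M1 + `|c| * M2) => x; apply: le_trans (ler_normD _ _) _.
by rewrite lerD // normrM ler_wpM2l.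
Qed.

Lemma sphere_int_lin h1 h2 (c : R) : bm h1 -> bm h2 ->
  sphere_int (fun x => h1 x + c * h2 x) = sphere_int h1 + c * sphere_int h2.
Proof.
move=> b1 b2; rewrite !sphere_intE //; last exact: bm_lin.
rewrite mulrCA -mulrDr -(RintZ _ (sphere_itg b2)) -(RintD (sphere_itg b1)); last first.
  exact: itgZ (sphere_itg b2).
congr (_ * _); apply: eq_Rintegral => x _; case: ifP => // _.
by rewrite mulr0 addr0.
Qed.

Lemma sphere_int_ext h1 h2 : (0 < n)%N -> bm h1 -> bm h2 ->
  (forall x, sphere x -> h1 x = h2 x) -> sphere_int h1 = sphere_int h2.
Proof.
move=> n0 b1 b2 E; rewrite !sphere_intE //; congr (_ * _).
apply: eq_Rintegral_ae; exists [set 0 : V]; split.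
- exact: measurable_set0B.
- exact: lebRn_set0.
move=> x /= K; apply/eqP/negPn/negP => x0; apply: K.
by rewrite E //; exact: sphere_normalize.
Qed.

Lemma sphere_int_ge0 h : (0 < n)%N -> bm h -> (forall x, sphere x -> 0 <= h x) ->
  0 <= sphere_int h.
Proof.
move=> n0 bh h0; rewrite (sphere_int_ext n0 bh (bm_norm bh)).
  rewrite sphere_intE; last exact: bm_norm.
  by rewrite mulr_ge0 //; apply: Rintegral_ge0 => x _; case: ifP.
by move=> x sx; rewrite ger0_norm // h0.
Qed.

Lemma strictly_positive_min g : Ce_inf g -> strictly_positive_on_sphere g ->
  exists2 m, 0 < m & forall x, sphere x -> m <= g x.
Proof.
move=> Cg g0; have [E0|S0] := eqVneq (@sphere R n) set0.
  by exists 1 => // x; rewrite E0.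
have cw : {within @sphere R n, continuous (fun x => g (normalize x))}.
  apply: continuous_in_subspaceT => x; rewrite inE => sx.
  by apply: Ce_inf_cont => //; exact: sphere_neq0.
have [z] := EVT_min_rV ((set0P _).1 S0) (@sphere_compact R n) cw.
rewrite inE => sz Hz; exists (g z); first exact: g0.
move=> x sx; have := Hz x; rewrite inE => /(_ sx).
by rewrite !normalize_sphere.
Qed.

Lemma Lpnorm_pow_ge0 (p : R) h : (0 < n)%N -> bm h -> 0 <= p ->
  0 <= sphere_int (fun x => `|h x| `^ p).
Proof.
by move=> n0 bh p0; apply: sphere_int_ge0 => //; apply: bm_powR => //; exact: bm_norm.
Qed.

End SphereIntegral.

Theorem theorem4 (R : realType) (n : nat) (p q : R) :
  1 < p -> - n%:R < q -> q < 0 ->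
  (forall f g : 'rV[R]_n -> R,
     Ce_inf f -> positive_on_sphere f ->
     pos_def q (fun x => powR (f x) (p - 1)) ->
     Ce_inf g -> positive_on_sphere g ->
     (forall xi, sphere xi -> Tq q f xi <= Tq q g xi) ->
     Lpnorm p f <= Lpnorm p g)
  /\
  (forall g : 'rV[R]_n -> R,
     Ce_inf g -> strictly_positive_on_sphere g ->
     ~ pos_def q (fun x => powR (g x) (p - 1)) ->
     exists f : 'rV[R]_n -> R,
       [/\ Ce_inf f, strictly_positive_on_sphere f,
           (forall xi, sphere xi -> Tq q f xi <= Tq q g xi)
         & Lpnorm p g < Lpnorm p f]).
Proof.
move=> p1 nq q0.
have sn : 0 < n%:R + q < n%:R by apply/andP; split; lra.
have qn : 0 < - q < n%:R by apply/andP; split; lra.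
have n0 := dim_gt0 sn; have [s0 _] := andP sn; have [q'0 _] := andP qn.
have p0 : 0 < p by exact: lt_trans p1.
have p10 : 0 <= p - 1 by rewrite subr_ge0 ltW.
have [c c0 inv] := Fourier_inversion (@bump_gaussian R n).
have [k k0 kP] := @polar R n n0.
have TqP (f : 'rV[R]_n -> R) (Cf : Ce_inf f) := is_Tq_Tq nq q0 c0 inv Cf.
have bp (h : 'rV[R]_n -> R) : Ce_inf h -> bm (fun x => powR `|h x| p).
  by move=> Ch; apply: bm_powR (ltW p0) _; apply: bm_norm; exact: Ce_inf_bm.
have pairE (h P : 'rV[R]_n -> R) : bm h -> sch P ->
    k * hom_pair q h (fourier_re P) = sphere_int (fun x => h x * mel (n%:R + q) (ct 0 P) x).
  move=> bh sP; rewrite fourier_reE ?itg_sch //.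
  by have := kP _ _ _ qn bh (sch_ct 0 sP) (@ct0_even _ _ P); rewrite !opprK.
have CK (P : 'rV[R]_n -> R) : sch P -> Ce_inf (mel (n%:R + q) (ct 0 P)).
  by move=> sP; apply: Ce_inf_mel => //; [exact: sch_ct | exact: ct0_even].
split.
  move=> f g Cf f0 fp Cg g0 Tfg.
  have Cu : Ce_inf (fun x => Tq q g x + -1 * Tq q f x).
    by apply: Ce_inf_lin; [exact: (TqP g Cg).1 | exact: (TqP f Cf).1].
  (* [P] represents T_q g - T_q f as a Mellin integral of exponent -q; it inherits the sign of that
     difference. *)
  have [P [sP eP melP P0]] := mel_onto q'0 n0 Cu.
  have {}P0 x : 0 <= P x by apply: P0 => y sy; rewrite mulN1r subr_ge0 Tfg.
  pose K := mel (n%:R + q) (ct 0 P).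
  (* Both sides have image c (T_q g - T_q f) on the sphere, the left one by [is_Tq_mel]; injectivity
     is applied to their difference. *)
  have KE x : sphere x -> K x = c * (g x - f x).
    move=> sx; have T1 := is_Tq_lin nq q0 (-1) Cg Cf (TqP g Cg) (TqP f Cf).
    have T2 := is_Tq_mel nq q0 sP eP (fun x => inv P x sP eP).
    have Cgf := Ce_inf_lin (-1) Cg Cf.
    have T3 := is_Tq_lin nq q0 (- c) (CK P sP) Cgf T2 T1.
    have := is_Tq_inj nq q0 c0 inv (Ce_inf_lin (- c) (CK P sP) Cgf) T3 _ sx.
    have melcP y : sphere y -> mel (- q) (fun x => c * P x) y = c * mel (- q) P y.
      move=> sy; rewrite /mel -(RintZ _ (itg_mel q'0 sP (sphere_neq0 sy))).
      by apply: eq_Rintegral => u _; rewrite mulrA.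
    have Z y : sphere y ->
        mel (- q) (fun x => c * P x) y + - c * (Tq q g y + -1 * Tq q f y) = 0.
      by move=> sy; rewrite melcP // melP //; ring.
    by move=> /(_ Z); rewrite -/K; lra.
  have bF : bm (fun x => f x `^ (p - 1)) by apply: bm_powR => //; exact: Ce_inf_bm.
  have [/(mulr_ge0 (ltW k0)) SK _] := fp P (iffRL (schP _) sP) eP P0.
  rewrite (pairE _ _ bF sP) -/K in SK.
  have bFK : bm (fun x => f x `^ (p - 1) * K x).
    by apply: bmM => //; apply: Ce_inf_bm; exact: CK.
  (* On the sphere the integrand is g^p - f^p - p f^(p-1) (g - f), because dividing by c turns [K]
     into g - f; Young makes it nonnegative. *)
  have := @sphere_int_ge0 _ _ (fun x => (`|g x| `^ p + -1 * `|f x| `^ p) +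
    - (p / c) * (f x `^ (p - 1) * K x)) n0.
  rewrite (sphere_int_lin _ (bm_lin (-1) (bp _ Cg) (bp _ Cf)) bFK).
  rewrite (sphere_int_lin _ (bp _ Cg) (bp _ Cf)).
  move=> /(_ (bm_lin _ (bm_lin (-1) (bp _ Cg) (bp _ Cf)) bFK)) H.
  have {H} : 0 <= sphere_int (fun x => `|g x| `^ p) + -1 * sphere_int (fun x => `|f x| `^ p) +
      - (p / c) * sphere_int (fun x => f x `^ (p - 1) * K x).
    apply: H => x sx; rewrite KE // !ger0_norm ?f0 ?g0 //.
    have := Young_powR p1 (f0 x sx) (g0 x sx).
    have -> : - (p / c) * (f x `^ (p - 1) * (c * (g x - f x))) =
      - (p * (f x `^ (p - 1) * (g x - f x))) by field; rewrite gt_eqF.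
    lra.
  have : 0 <= p / c * sphere_int (fun x => f x `^ (p - 1) * K x).
    by rewrite mulr_ge0 // divr_ge0 // ltW.
  move=> H1 H2; have {H1 H2} : sphere_int (fun x => `|f x| `^ p) <= sphere_int (fun x => `|g x| `^ p).
    move: H1 H2; lra.
  apply: ge0_ler_powR; rewrite ?nnegrE ?invr_ge0 ?(ltW p0) //;
    exact: Lpnorm_pow_ge0 (Ce_inf_bm _) (ltW p0).
move=> g Cg g0 ngp.
have bG : bm (fun x => g x `^ (p - 1)) by apply: bm_powR => //; exact: Ce_inf_bm.
(* A failure of [pos_def] must come from its sign clause: the imaginary pairing vanishes by
   parity. *)
have [P [/schP sP eP P0 HP]] : exists P, [/\ schwartz P, even_fun P, (forall x, 0 <= P x) &
    hom_pair q (fun x => g x `^ (p - 1)) (fourier_re P) < 0].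
  apply: contrapT => nP; apply: ngp => P sP eP P0; split.
    by rewrite leNgt; apply/negP => HP; apply: nP; exists P.
  rewrite -(opprK q); apply: hom_pair_im0 => //; last exact/schP.
  by move=> x sx; rewrite Cg.2.
pose K := mel (n%:R + q) (ct 0 P).
have CKP : Ce_inf K := CK P sP.
have bGK : bm (fun x => g x `^ (p - 1) * K x) by apply: bmM => //; exact: Ce_inf_bm.
have SK : sphere_int (fun x => g x `^ (p - 1) * K x) < 0.
  by rewrite -pairE // pmulr_rlt0.
have [m m0 mg] := strictly_positive_min Cg g0.
have [M M0 MK] := Ce_inf_bound CKP.
(* Makes e |K| < m <= g on the sphere, hence f > 0; adding 1 guards against M = 0. *)
pose e := m / (M + 1).
have e0 : 0 < e by rewrite divr_gt0 // ltr_wpDl.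
have eM : e * M < m.
  by rewrite /e mulrAC ltr_pdivrMr ?ltr_wpDl // ltr_pM2l // ltrDl.
pose f x := g x + - e * K x.
have Cf : Ce_inf f by exact: Ce_inf_lin.
have f0 : strictly_positive_on_sphere f.
  move=> x sx; have := mg x sx; have := MK x; rewrite normalize_sphere // => Kx.
  have : e * K x <= e * M by rewrite ler_pM2l // (le_trans (ler_norm _)).
  rewrite /f; lra.
exists f; split => //.
  (* By linearity and uniqueness T_q f = T_q g - e mel(-q)(c P) on the sphere, and the subtracted
     term is nonnegative since P >= 0 and c > 0. *)
  move=> x sx; have T2 := is_Tq_mel nq q0 sP eP (fun x => inv P x sP eP).
  have T3 := is_Tq_lin nq q0 (- e) Cg CKP (TqP g Cg) T2.
  rewrite (is_Tq_unique nq q0 (TqP f Cf) T3 sx) gerDl mulNr oppr_le0.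
  by rewrite mulr_ge0 ?(ltW e0) // mel_ge0 // => y; rewrite mulr_ge0 // ltW.
(* Since f - g = -e K, this is the Young inequality expanded at g. Strictness of the conclusion
   comes from [SK], the negative integral of g^(p-1) K. *)
have := @sphere_int_ge0 _ _ (fun x => (`|f x| `^ p + -1 * `|g x| `^ p) +
  (p * e) * (g x `^ (p - 1) * K x)) n0.
rewrite (sphere_int_lin _ (bm_lin (-1) (bp _ Cf) (bp _ Cg)) bGK).
rewrite (sphere_int_lin _ (bp _ Cf) (bp _ Cg)).
move=> /(_ (bm_lin _ (bm_lin (-1) (bp _ Cf) (bp _ Cg)) bGK)) H.
have {H} : 0 <= sphere_int (fun x => `|f x| `^ p) + -1 * sphere_int (fun x => `|g x| `^ p) +
    (p * e) * sphere_int (fun x => g x `^ (p - 1) * K x).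
  apply: H => x sx; rewrite !gtr0_norm ?f0 ?g0 //.
  have := Young_powR p1 (ltW (g0 x sx)) (ltW (f0 x sx)).
  have -> : p * (g x `^ (p - 1) * (f x - g x)) = - (p * e * (g x `^ (p - 1) * K x)).
    by rewrite /f; ring.
  lra.
have : p * e * sphere_int (fun x => g x `^ (p - 1) * K x) < 0 by rewrite pmulr_rlt0 // mulr_gt0.
move=> H1 H2; have {H1 H2} : sphere_int (fun x => `|g x| `^ p) < sphere_int (fun x => `|f x| `^ p).
  move: H1 H2; lra.
apply: gt0_ltr_powR; rewrite ?nnegrE ?invr_gt0 //;
  exact: Lpnorm_pow_ge0 (Ce_inf_bm _) (ltW p0).
Qed.
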